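(* Let $(M^{3},\varphi,\xi,\eta,g)$ be a $3$-dimensional almost Kenmotsu generalized $(\kappa,\mu)$-manifold, with $\kappa,\mu$ smooth functions on $M^3$ such that $d\kappa\wedge\eta=0$ and $\kappa<-1$ everywhere. Put $\lambda=\sqrt{-1-\kappa}$. Then, in a neighbourhood $U$ of every point $p\in M^3$ there exist coordinates $x,y,z$ with $z<-1$ and an orthonormal frame $\{\xi, X, \varphi X\}$ of eigenvectors of $h$ with $hX=\lambda X$, such that on $U$ one has $\kappa=z$, $\mu$ only depends on $z$, and $$X=\frac{\partial}{\partial x},\quad \varphi X=\frac{\partial}{\partial y}, \quad \xi=a\frac{\partial}{\partial x}+b \frac{\partial}{\partial y}-4(z+1)\frac{\partial}{\partial z},$$ where $a=x-\tfrac12\left(\mu+2\sqrt{-1-z}\right)y+f$ and $b=y+\tfrac12\left(\mu-2\sqrt{-1-z}\right)x+r$, with $f,r$ smooth functions of $z$ on $U$.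
   Context: All manifolds are smooth and connected. An almost contact metric manifold $(M^{2n+1},\varphi,\xi,\eta,g)$ is a manifold with a $(1,1)$-tensor field $\varphi$, a vector field $\xi$, a $1$-form $\eta$ and a Riemannian metric $g$ such that $\varphi^2=-I+\eta\otimes\xi$, $\eta(\xi)=1$ and $g(\varphi X,\varphi Y)=g(X,Y)-\eta(X)\eta(Y)$. Its fundamental $2$-form is $\Phi(X,Y)=g(X,\varphi Y)$. It is almost Kenmotsu if $d\eta=0$ and $d\Phi=2\eta\wedge\Phi$. Put $h:=\frac12\mathcal{L}_{\xi}\varphi$, where $\mathcal L$ is the Lie derivative. With $R(X,Y)=[\nabla_X,\nabla_Y]-\nabla_{[X,Y]}$ ($\nabla$ the Levi-Civita connection of $g$), an almost Kenmotsu manifold is called a generalized $(\kappa,\mu)$-manifold, for smooth functions $\kappa,\mu$ on $M$, if for all vector fields $X,Y$: $R(X,Y)\xi=\kappa(\eta(Y)X-\eta(X)Y)+\mu(\eta(Y)hX-\eta(X)hY)$. *)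

(* Defs.v *)
From mathcomp Require Export all_boot all_order all_algebra.
From mathcomp Require Export all_classical all_reals all_analysis.
Export numFieldNormedType.Exports.
Export Order.TTheory GRing.Theory Num.Theory.

Set Implicit Arguments.
Unset Strict Implicit.
Unset Printing Implicit Defensive.

Local Open Scope classical_set_scope.
Local Open Scope ring_scope.

Section EuclideanSmoothness.
Context {R : realType} {n : nat}.
Implicit Types (D : set 'rV[R]_n) (f : 'rV[R]_n -> R).

Fixpoint Ck (k : nat) D f : Prop :=
  if k is k'.+1 then
    (forall x, D x -> differentiable f x) /\
    (forall i : 'I_n, Ck k' D ('D_(delta_mx 0 i) f))
  else forall x, D x -> {for x, continuous f}.

(* Meant for open [D]: the values of [f] outside [D] are then irrelevant. *)
Definition smooth_rV D f := forall k, Ck k D f.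

Definition smooth_R (D : set R) (f : R -> R) :=
  forall k t, D t -> derivable (derive1n k f) t 1.

End EuclideanSmoothness.

(* A chart is a homeomorphism between the open sets [chart_dom] and
   [chart_coord @` chart_dom]; [chart_coord] and its inverse [chart_param] are
   total functions with arbitrary values outside these sets. *)
Record chart (R : realType) (n : nat) (M : topologicalType) := Chart {
  chart_dom : set M;
  chart_coord : M -> 'rV[R]_n;
  chart_param : 'rV[R]_n -> M;
  chart_dom_open : open chart_dom;
  chart_coord_open : open (chart_coord @` chart_dom);
  chart_coordK : forall p, chart_dom p -> chart_param (chart_coord p) = p;
  chart_coord_continuous :
    forall p, chart_dom p -> {for p, continuous chart_coord};
  chart_param_continuous :
    forall p, chart_dom p -> {for chart_coord p, continuous chart_param}
}.

Definition smooth_transition (R : realType) n (M : topologicalType)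
    (c d : chart R n M) :=
  forall i, smooth_rV (chart_coord c @` (chart_dom c `&` chart_dom d))
                      (fun x => chart_coord d (chart_param c x) 0 i).

Definition compatible (R : realType) n (M : topologicalType)
    (c d : chart R n M) :=
  smooth_transition c d /\ smooth_transition d c.

(* [chart_at p] is a preferred chart around [p]; it is only used to represent
   tangent vectors at [p] by their components. *)
Record manifold (R : realType) (n : nat) := Manifold {
  carrier :> topologicalType;
  atlas : set (chart R n carrier);
  chart_at : carrier -> chart R n carrier;
  chart_at_atlas : forall p, atlas (chart_at p);
  chart_at_dom : forall p, chart_dom (chart_at p) p;
  atlas_compatible : forall c d, atlas c -> atlas d -> compatible c d;
  manifold_hausdorff : hausdorff_space carrier;
  manifold_second_countable : @second_countable carrier;
  manifold_connected : connected [set: carrier]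
}.

(* Membership in the maximal atlas. *)
Definition smooth_chart (R : realType) n (M : manifold R n) (c : chart R n M) :=
  forall d, atlas d -> compatible c d.

Definition smooth_on (R : realType) n (M : manifold R n) (U : set M)
    (f : M -> R) :=
  forall c, atlas c ->
    smooth_rV (chart_coord c @` (chart_dom c `&` U)) (f \o chart_param c).

(* A tangent vector at [p] is given by its components in [chart_at p]. *)
Definition tangent (R : realType) n (M : manifold R n) (p : M) : lmodType R :=
  'rV[R]_n.

(* Rough vector fields; regularity is the separate predicate [smooth_vf]. *)
Notation vfield M := (forall p : M, tangent p).

(* [dfun f p v] is the derivative [df_p(v)] of [f] along [v]. *)
Definition dfun (R : realType) n (M : manifold R n) (f : M -> R) (p : M)
    (v : tangent p) : R :=
  'D_(v : 'rV[R]_n) (f \o chart_param (chart_at p))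
    (chart_coord (chart_at p) p).

Section VectorFields.
Context {R : realType} {n : nat} {M : manifold R n}.
Implicit Types (X Y Z : vfield M) (U : set M) (f : M -> R).

(* The function [X(f)]. *)
Definition act X f : M -> R := fun p => dfun f (X p).

(* [X] is a (smooth) vector field on the open set [U]. *)
Definition smooth_vf U X :=
  forall V f, open V -> V `<=` U -> smooth_on V f -> smooth_on V (act X f).

(* The component of [[X, Y]] at [p] along the coordinate function [x^i] of
   [chart_at p] is [X(Y(x^i)) - Y(X(x^i))]. *)
Definition lie X Y : vfield M := fun p =>
  \row_i (act X (act Y (fun q => chart_coord (chart_at p) q 0 i)) p
          - act Y (act X (fun q => chart_coord (chart_at p) q 0 i)) p).

(* The coordinate vector field [d/dx^i] of the chart [c], on [chart_dom c]. *)
Definition coord_vf (c : chart R n M) (i : 'I_n) : vfield M := fun p =>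
  'D_(delta_mx 0 i) (chart_coord (chart_at p) \o chart_param c)
    (chart_coord c p).

End VectorFields.

(* Identities between tensor fields that involve derivatives are tested on
   vector fields defined on arbitrary open subsets: such identities are local,
   and this determines the tensors at each point. *)

Section Calculus.
Context {R : realType} {n : nat} {M : manifold R n}.
Implicit Types (X Y Z : vfield M) (U : set M) (f : M -> R).

Definition one_form := forall p : M, tangent p -> R.
Definition two_tensor := forall p : M, tangent p -> tangent p -> R.
Definition endo_field := forall p : M, tangent p -> tangent p.

Definition smooth_one_form (w : one_form) :=
  (forall p, scalar (w p)) /\
  (forall U X, open U -> smooth_vf U X -> smooth_on U (fun p => w p (X p))).

Definition smooth_two_tensor (b : two_tensor) :=
  [/\ forall p u, scalar (b p u),
      forall p v, scalar (fun u => b p u v)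
    & forall U X Y, open U -> smooth_vf U X -> smooth_vf U Y ->
        smooth_on U (fun p => b p (X p) (Y p))].

Definition smooth_endo_field (t : endo_field) :=
  (forall p, linear (t p)) /\
  (forall U X, open U -> smooth_vf U X -> smooth_vf U (fun p => t p (X p))).

Definition riemannian_metric (g : two_tensor) :=
  [/\ smooth_two_tensor g,
      forall p u v, g p u v = g p v u
    & forall p v, v != 0 -> 0 < g p v v].

(* Unnormalized conventions for [d] and the wedge product; replacing both by
   their versions with the factors 1/(k+1) and 1/binomial gives the same
   equations [dw = 0], [df /\ w = 0] and [dPhi = 2 w /\ Phi]. *)
Definition d1 (w : one_form) X Y : M -> R := fun p =>
  act X (fun q => w q (Y q)) p - act Y (fun q => w q (X q)) p
  - w p (lie X Y p).

Definition d2 (b : two_tensor) X Y Z : M -> R := fun p =>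
  act X (fun q => b q (Y q) (Z q)) p
  + act Y (fun q => b q (Z q) (X q)) p
  + act Z (fun q => b q (X q) (Y q)) p
  - b p (lie X Y p) (Z p) - b p (lie Y Z p) (X p) - b p (lie Z X p) (Y p).

Definition wedge11 (w w' : one_form) : two_tensor := fun p u v =>
  w p u * w' p v - w p v * w' p u.

Definition wedge12 (w : one_form) (b : two_tensor) (p : M)
    (u v z : tangent p) : R :=
  w p u * b p v z + w p v * b p z u + w p z * b p u v.

(* [(L_X t)(Y)]. *)
Definition lie_endo X (t : endo_field) Y : vfield M := fun p =>
  lie X (fun q => t q (Y q)) p - t p (lie X Y p).

(* Covariant derivative [nabla X Y]; only its values on vector fields that are
   smooth on a neighbourhood of the point under consideration matter. *)
Definition connection := vfield M -> vfield M -> vfield M.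

Record affine_connection (nabla : connection) : Prop := {
  nabla_smooth : forall U X Y, open U -> smooth_vf U X -> smooth_vf U Y ->
    smooth_vf U (nabla X Y);
  nabla_linear_l : forall U X X' Y f, open U ->
    smooth_vf U X -> smooth_vf U X' -> smooth_vf U Y -> smooth_on U f ->
    forall p, U p ->
    nabla (fun q => f q *: X q + X' q) Y p
      = f p *: nabla X Y p + nabla X' Y p;
  nabla_add_r : forall U X Y Y', open U ->
    smooth_vf U X -> smooth_vf U Y -> smooth_vf U Y' ->
    forall p, U p ->
    nabla X (fun q => Y q + Y' q) p = nabla X Y p + nabla X Y' p;
  nabla_leibniz : forall U X Y f, open U ->
    smooth_vf U X -> smooth_vf U Y -> smooth_on U f ->
    forall p, U p ->
    nabla X (fun q => f q *: Y q) p = act X f p *: Y p + f p *: nabla X Y p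
}.

Record levi_civita (g : two_tensor) (nabla : connection) : Prop := {
  levi_civita_affine : affine_connection nabla;
  levi_civita_torsion_free : forall U X Y, open U ->
    smooth_vf U X -> smooth_vf U Y ->
    forall p, U p -> nabla X Y p - nabla Y X p = lie X Y p;
  levi_civita_metric : forall U X Y Z, open U ->
    smooth_vf U X -> smooth_vf U Y -> smooth_vf U Z ->
    forall p, U p ->
    act X (fun q => g q (Y q) (Z q)) p
      = g p (nabla X Y p) (Z p) + g p (Y p) (nabla X Z p)
}.

Definition curvature (nabla : connection) X Y Z : vfield M := fun p =>
  nabla X (nabla Y Z) p - nabla Y (nabla X Z) p - nabla (lie X Y) Z p.

End Calculus.

Arguments one_form {R n} M.
Arguments two_tensor {R n} M.
Arguments endo_field {R n} M.
Arguments connection {R n} M.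

(* The dimension is necessarily odd. *)
Record almost_contact_metric (R : realType) (n : nat) (M : manifold R n) :=
  AlmostContactMetric {
  phi : endo_field M;
  xi : vfield M;
  eta : one_form M;
  g : two_tensor M;
  phi_smooth : smooth_endo_field phi;
  xi_smooth : smooth_vf setT xi;
  eta_smooth : smooth_one_form eta;
  g_metric : riemannian_metric g;
  phi_phi : forall p v, phi (phi v) = - v + eta v *: xi p;
  eta_xi : forall p, eta (xi p) = 1;
  g_phi_phi : forall p (u v : tangent p),
    g (phi u) (phi v) = g u v - eta u * eta v
}.

Section AlmostKenmotsu.
Context {R : realType} {n : nat} {M : manifold R n}.
Variable S : almost_contact_metric M.
Implicit Types (X Y Z : vfield M) (U : set M).

Definition fundamental_form : two_tensor M := fun p u v => g S u (phi S v).

Definition almost_kenmotsu :=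
  (forall U X Y, open U -> smooth_vf U X -> smooth_vf U Y ->
     forall p, U p -> d1 (eta S) X Y p = 0) /\
  (forall U X Y Z, open U -> smooth_vf U X -> smooth_vf U Y -> smooth_vf U Z ->
     forall p, U p -> d2 fundamental_form X Y Z p
       = 2 * wedge12 (eta S) fundamental_form (X p) (Y p) (Z p)).

(* [hX], for [h = (1/2) L_xi phi]. *)
Definition h_op X : vfield M := fun p => 2^-1 *: lie_endo (xi S) (phi S) X p.

Definition generalized_kappa_mu (nabla : connection M) (kappa mu : M -> R) :=
  [/\ smooth_on setT kappa, smooth_on setT mu
    & forall U X Y, open U -> smooth_vf U X -> smooth_vf U Y ->
        forall p, U p -> curvature nabla X Y (xi S) p
          = kappa p *: (eta S (Y p) *: X p - eta S (X p) *: Y p)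
            + mu p *: (eta S (Y p) *: h_op X p - eta S (X p) *: h_op Y p)].

End AlmostKenmotsu.

(* Main.v *)
From HB Require Import structures.
From mathcomp Require Import ring lra.
Require Import Defs.

(** The proof has an algebraic half, which finds the brackets of an adapted frame, and
an analytic half, which turns a frame with these brackets into coordinates.

Let [E] be a local unit section of the kernel of [eta], so that [xi], [E], [phi E] is an
orthonormal frame. Closedness of [eta] says that [nabla xi] is self-adjoint
([gnabla_xi_sym]), and [d Phi = 2 eta /\ Phi] that its trace is 2 ([kenmotsu_trace]).
Thus [nabla xi], and with it [h], is described in the frame by the two functions
[hEE] and [hEF], the entries of the symmetric traceless matrix of [h] ([frame_gnabla_xi],
[h_op_frame]). The equation for [R(xi, .) xi] then reads as three scalar equations
([frame_curvature]), a combination of which is [hEE^2 + hEF^2 = -1 - kappa]. As the right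
side is positive, [h] has the simple eigenvalues [lambda] and [-lambda] on the kernel of
[eta], and a smooth unit eigenvector [X] for [lambda] exists near every point
([exists_eigen_section]). With [E = X] the same equations give
[xi(lambda) = -2 lambda] and the rotation speed [- mu / 2] of the frame along [xi]
([eigen_w]), hence
[[xi, X] = - X + (lambda - mu/2) phi X], [[xi, phi X] = (lambda + mu/2) X - phi X]
([eigen_lie_xi]) and [xi(kappa) = -4 (kappa + 1)] ([eigen_kappa]). Moreover [kappa] has
zero derivative along [X] and [phi X] because [d kappa /\ eta = 0], and the equation
[R(X, phi X) xi = 0] becomes [lambda g(nabla_X X, phi X) = 0] and
[lambda g(nabla_(phi X) X, phi X) = 0]; as [lambda] is positive, [[X, phi X] = 0]
([eigen_commute]).

Now [X] and [phi X] commute and are tangent to the levels of [kappa], and [kappa] is a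
submersion. On each level the forms dual to [X] and [phi X] are closed; integrating them
along rays, smoothly in the value of [kappa] ([leafwise_poincare]), produces functions [x]
and [y] which together with [kappa] form a chart by the inverse function theorem
([inverse_function], [chart_of_functions], [straightening]).

It remains to determine [a = xi(x)] and [b = xi(y)]. The brackets with [xi] give their
derivatives along [X] and [phi X] ([act_components]). Since [X] and [phi X] commute on [a]
and on [b], the function [mu] is constant on the leaves ([act_mu]); consequently so is what
remains of [a] and [b] once their parts affine in [x] and [y] are subtracted
([rest_constant]). As the image of the chart is a ball, a smooth function that is constant
along the leaves is a smooth function of [z] ([function_of_last_coordinate]). *)

Local Open Scope classical_set_scope.
Local Open Scope ring_scope.

Set Implicit Arguments.
Unset Strict Implicit.
Unset Printing Implicit Defensive.

(** * Calculus of C^k functions on open sets *)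

Section CkCalculus.
Context {R : realType} {n : nat}.
Implicit Types (D E : set 'rV[R]_n) (f g : 'rV[R]_n -> R).

Lemma Ck_sub k D E f : D `<=` E -> Ck k E f -> Ck k D f.
Proof.
move=> DE; elim: k f => [|k IH] f /=; first by move=> cf x /DE; exact: cf.
by move=> [df pf]; split=> [x /DE/df//|i]; exact/IH/pf.
Qed.

(** The condition bears on the derivatives of the total function [f] at each point
separately, so the set may vary with the point. *)
Lemma Ck_pointwise k D f : (forall x, D x -> exists2 E, E x & Ck k E f) -> Ck k D f.
Proof.
elim: k f => [|k IH] f /= H.
  by move=> x /H [E Ex]; apply.
split=> [x /H [E Ex [df _]]|i]; first exact: df.
by apply: IH => x /H [E Ex [_ pf]]; exists E.
Qed.

(** Differentiability depends only on the germ; this is what lets a formula valid on an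
open set be used for derivatives there, whatever the values outside. *)
Lemma near_eq_differentiable (V W : normedModType R) (f g : V -> W) x :
  (\near x, f x = g x) -> differentiable f x -> differentiable g x.
Proof.
move=> fg df.
have dfc : continuous ('d f x) by apply: diff_continuous.
have E : g \o shift x = cst (g x) + 'd f x +o_ 0 id.
  have fgx : f x = g x by apply: (nbhs_singleton fg).
  apply/eqaddoP => e e0.
  have /eqaddoP /(_ _ e0) := diff_locally df.
  have : \forall y \near 0, f (y + x) = g (y + x).
    by have := fg; rewrite (near_shift 0 x) subr0; apply: filterS.
  apply: filterS2 => y fgy; rewrite /= !fctE fgx /= fgy; apply: le_trans.
  by [].
have gd := diff_unique dfc E.
by apply/diff_locallyP; rewrite gd.
Unshelve. all: by end_near. Qed.

Lemma open_near_eq (V W : topologicalType) (D : set V) (f g : V -> W) x : open D -> D x ->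
  (forall y, D y -> f y = g y) -> \near x, f x = g x.
Proof. by move=> oD Dx fg; near=> y; apply: fg; near: y; exact: open_nbhs_nbhs. Unshelve. all: by end_near. Qed.

Lemma near_eq_continuous (V W : topologicalType) (f g : V -> W) x :
  (\near x, f x = g x) -> {for x, continuous f} -> {for x, continuous g}.
Proof.
move=> fg cf; rewrite /prop_for /continuous_at -(nbhs_singleton fg).
by apply: cvg_trans cf; exact: near_eq_cvg.
Qed.

Lemma Ck_ext k D f g : open D -> (forall x, D x -> f x = g x) -> Ck k D f -> Ck k D g.
Proof.
move=> oD; elim: k f g => [|k IH] f g fg /=.
  by move=> cf x Dx; exact: near_eq_continuous (open_near_eq oD Dx fg) (cf x Dx).
move=> [df pf]; split=> [x Dx|i].
  exact: near_eq_differentiable (open_near_eq oD Dx fg) (df x Dx).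
apply: IH (pf i) => x Dx; apply: near_eq_derive.
exact: open_near_eq oD Dx fg.
Qed.

Lemma CkS k D f : Ck k.+1 D f -> Ck k D f.
Proof.
elim: k f => [|k IH] f [df pf] /=.
  by move=> x /df; exact: differentiable_continuous.
by split=> // i; apply: IH.
Qed.

Lemma Ck_cst k D (a : R) : Ck k D (cst a).
Proof.
elim: k a => [|k IH] a /=; first by move=> x _; exact: cst_continuous.
split=> // i; rewrite (_ : 'D_ _ (cst a) = cst 0) //.
by apply/funext => x; exact: derive_cst.
Qed.

Lemma CkD k D f g : open D -> Ck k D f -> Ck k D g -> Ck k D (f \+ g).
Proof.
move=> oD; elim: k f g => [|k IH] f g /=.
  by move=> cf cg x Dx; apply: continuousD; [exact: cf|exact: cg].
move=> [df pf] [dg pg]; split=> [x Dx|i].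
  by apply: differentiableD; [exact: df|exact: dg].
apply: Ck_ext (IH _ _ (pf i) (pg i)) => // x Dx.
by rewrite [RHS]deriveD //; apply: diff_derivable; [exact: df|exact: dg].
Qed.

Lemma CkM k D f g : open D -> Ck k D f -> Ck k D g -> Ck k D (f \* g).
Proof.
move=> oD; elim: k f g => [|k IH] f g.
  by move=> cf cg x Dx; apply: continuousM; [exact: cf|exact: cg].
move=> Cf Cg; move: (Cf) (Cg) => [df pf] [dg pg]; split=> [x Dx|i].
  by apply: differentiableM; [exact: df|exact: dg].
apply: Ck_ext (CkD oD (IH _ _ (CkS Cf) (pg i)) (IH _ _ (CkS Cg) (pf i))) => // x Dx.
by rewrite [RHS]deriveM //; apply: diff_derivable; [exact: df|exact: dg].
Qed.

Lemma CkZ k D (a : R) f : open D -> Ck k D f -> Ck k D (fun x => a * f x).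
Proof. by move=> oD Cf; apply: (@CkM k D (cst a) f) => //; exact: Ck_cst. Qed.

Lemma CkN k D f : open D -> Ck k D f -> Ck k D (fun x => - f x).
Proof.
move=> oD /(CkZ (-1) oD); apply: Ck_ext => // x _; exact: mulN1r.
Qed.

Lemma CkB k D f g : open D -> Ck k D f -> Ck k D g -> Ck k D (fun x => f x - g x).
Proof. by move=> oD Cf /(CkN oD); exact: CkD. Qed.

Lemma Ck_sum k D (I : Type) (r : seq I) (P : pred I) (F : I -> 'rV[R]_n -> R) : open D ->
  (forall i, P i -> Ck k D (F i)) -> Ck k D (fun x => \sum_(i <- r | P i) F i x).
Proof.
move=> oD CF; elim: r => [|i r IH].
  by apply: Ck_ext (Ck_cst k D 0) => // x _; rewrite [RHS]big_nil.
apply: (@Ck_ext k D (fun x => (if P i then F i x else 0) + \sum_(i <- r | P i) F i x)) => //.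
  by move=> x _; rewrite big_cons; case: ifP; rewrite ?add0r.
apply: CkD => //; case: (P i) (CF i) => [/(_ isT)//|_]; exact: Ck_cst.
Qed.

Lemma Ck_prod k D (I : Type) (r : seq I) (P : pred I) (F : I -> 'rV[R]_n -> R) : open D ->
  (forall i, P i -> Ck k D (F i)) -> Ck k D (fun x => \prod_(i <- r | P i) F i x).
Proof.
move=> oD CF; elim: r => [|i r IH].
  by apply: Ck_ext (Ck_cst k D 1) => // x _; rewrite [RHS]big_nil.
apply: (@Ck_ext k D (fun x => (if P i then F i x else 1) * \prod_(i <- r | P i) F i x)) => //.
  by move=> x _; rewrite big_cons; case: ifP; rewrite ?mul1r.
apply: CkM => //; case: (P i) (CF i) => [/(_ isT)//|_]; exact: Ck_cst.
Qed.

Lemma derive_coord (i : 'I_n) (x v : 'rV[R]_n) : 'D_v (fun u : 'rV[R]_n => u 0 i : R) x = v 0 i.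
Proof.
rewrite deriveE; last exact: differentiable_coord.
have @c : {linear 'rV[R]_n -> R}.
  by exists (fun N : 'rV[R]_n => N 0 i); do 2![eexists]; do ?[constructor];
     rewrite ?mxE// => ? *; rewrite ?mxE//; move=> ?; rewrite !mxE.
rewrite (_ : (fun _ => _) = c) //.
by rewrite diff_lin //; exact: coord_continuous.
Qed.

Lemma Ck_coord k D (i : 'I_n) : Ck k D (fun u => u 0 i).
Proof.
case: k => [|k] /=; first by move=> x _; exact: coord_continuous.
split=> [x _|j]; first exact: differentiable_coord.
rewrite (_ : 'D_ _ _ = cst ((delta_mx 0 j : 'rV[R]_n) 0 i)); first exact: Ck_cst.
by apply/funext => x; exact: derive_coord.
Qed.

Lemma CkV k D f : open D -> (forall x, D x -> f x != 0) -> Ck k D f -> Ck k D (fun x => (f x)^-1).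
Proof.
move=> oD f0; elim: k => [|k IH] Cf.
  by move=> x Dx; apply: continuousV; [exact: f0|exact: Cf].
have [df pf] := Cf; split=> [x Dx|i].
  by apply: differentiableV; [exact: df|exact: f0].
apply: (@Ck_ext k D (fun x => - ((f x)^-1 * (f x)^-1 * 'D_(delta_mx 0 i) f x))) => //.
  move=> x Dx; rewrite [RHS]deriveV ?f0 //; last by apply: diff_derivable; exact: df.
  by rewrite scaleNr [in RHS]/GRing.scale /= expr2 invfM.
have Ci := IH (CkS Cf).
exact: CkN oD (CkM oD (CkM oD Ci Ci) (pf i)).
Qed.

End CkCalculus.

(** * Composition and closure properties of smooth functions *)

Section Composition.
Context {R : realType}.

Lemma differentiable_row (V : normedModType R) n (G : V -> 'rV[R]_n) x :
  (forall j, differentiable (fun y => G y 0 j) x) -> differentiable G x.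
Proof.
move=> dG.
rewrite (_ : G = \sum_(j < n) (fun y => G y 0 j *: delta_mx 0 j : 'rV[R]_n)).
  by apply: differentiable_sum => j; apply: differentiableZl; exact: dG.
apply/funext => y; rewrite fct_sumE; exact: row_sum_delta.
Qed.

Lemma continuous_row (T : topologicalType) n (G : T -> 'rV[R]_n) x :
  (forall j, {for x, continuous (fun y => G y 0 j)}) -> {for x, continuous G}.
Proof.
move=> cG; apply/cvgrPdist_lt => e e0; near=> z.
rewrite [ltLHS]/Num.Def.normr /= mx_normrE; apply/bigmax_ltP; split; first by [].
move=> [a b] _; rewrite /= ord1 !mxE; move: b; near: z; apply: filter_forall => b.
by have /cvgrPdist_lt /(_ _ e0) := cG b.
Unshelve. all: by end_near. Qed.

Lemma derive_row (V : normedModType R) n (G : V -> 'rV[R]_n) x v :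
  differentiable G x -> 'D_v G x = \row_j 'D_v (fun y => G y 0 j) x.
Proof.
move=> dG; rewrite (derive_mx (diff_derivable dG)).
by apply/rowP => j; rewrite !mxE.
Qed.

Lemma differentiable_comp_coord (V : normedModType R) n (G : V -> 'rV[R]_n) x j :
  differentiable G x -> differentiable (fun y => G y 0 j) x.
Proof.
move=> dG; apply: (@differentiable_comp _ _ _ _ G (fun u : 'rV[R]_n => u 0 j : R)) => //.
exact: differentiable_coord.
Qed.

Lemma derive_dir_sum n (W : normedModType R) (f : 'rV[R]_n -> W) x v : differentiable f x ->
  'D_v f x = \sum_j v 0 j *: 'D_(delta_mx 0 j) f x.
Proof.
move=> df; rewrite deriveE // {1}[v]row_sum_delta linear_sum; apply: eq_bigr => j _.
by rewrite linearZ deriveE.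
Qed.

Lemma derive_comp (V U W : normedModType R) (G : V -> U) (f : U -> W) x v :
  differentiable G x -> differentiable f (G x) ->
  'D_v (f \o G) x = 'D_('D_v G x) f (G x).
Proof.
move=> dG df; rewrite !deriveE //; last exact: differentiable_comp.
by rewrite diff_comp.
Qed.

Lemma derive_comp_sum (V : normedModType R) n (G : V -> 'rV[R]_n) (f : 'rV[R]_n -> R) x v :
  differentiable G x -> differentiable f (G x) ->
  'D_v (f \o G) x = \sum_j 'D_v (fun y => G y 0 j) x * 'D_(delta_mx 0 j) f (G x).
Proof.
move=> dG df; rewrite derive_comp // derive_dir_sum //; apply: eq_bigr => j _.
by rewrite derive_row // mxE.
Qed.

(** By the chain rule the partial derivatives of the composite are sums of products of
partial derivatives of [G] with partial derivatives of [f] composed with [G], to which the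
induction hypothesis applies. *)
Lemma Ck_comp m n k (D : set 'rV[R]_m) (E : set 'rV[R]_n) (G : 'rV[R]_m -> 'rV[R]_n) f :
  open D -> open E -> (forall x, D x -> E (G x)) ->
  (forall j, Ck k D (fun x => G x 0 j)) -> Ck k E f -> Ck k D (f \o G).
Proof.
move=> oD oE DE; elim: k f => [|k IH] f.
  move=> cG cf x Dx; apply: continuous_comp; last exact: cf (DE _ Dx).
  by apply: continuous_row => j; exact: cG.
move=> CG Cf; have [df pf] := Cf.
have dG x : D x -> differentiable G x.
  by move=> Dx; apply: differentiable_row => j; have [dGj _] := CG j; exact: dGj.
split=> [x Dx|i].
  by apply: differentiable_comp; [exact: dG|exact: df (DE _ Dx)].
apply: (@Ck_ext _ _ k D (fun x => \sum_j 'D_(delta_mx 0 i) (fun y => G y 0 j) x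
                         * ('D_(delta_mx 0 j) f \o G) x)) => //.
  by move=> x Dx; rewrite [RHS]derive_comp_sum //; [exact: dG|exact: df (DE _ Dx)].
apply: Ck_sum => // j _; apply: CkM => //.
  by have [_] := CG j; apply.
by apply: IH (pf j) => j'; exact: CkS.
Qed.

Lemma smooth_coord n D (i : 'I_n) : @smooth_rV R n D (fun u => u 0 i).
Proof. by move=> k; exact: Ck_coord. Qed.

Lemma smooth_cst n D a : @smooth_rV R n D (cst a).
Proof. by move=> k; exact: Ck_cst. Qed.

Lemma differentiable_sqrt (a : R) : 0 < a -> differentiable (Num.sqrt : R -> R) a.
Proof. by move=> a0; apply/derivable1_diffP; have [] := is_derive1_sqrt a0. Qed.

Section Closure.
Context {n : nat}.
Variable D : set 'rV[R]_n.
Hypothesis oD : open D.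
Implicit Types f g : 'rV[R]_n -> R.

Lemma smoothD f g : smooth_rV D f -> smooth_rV D g -> smooth_rV D (fun x => f x + g x).
Proof. by move=> sf sg k; exact: CkD. Qed.

Lemma smoothM f g : smooth_rV D f -> smooth_rV D g -> smooth_rV D (fun x => f x * g x).
Proof. by move=> sf sg k; exact: CkM. Qed.

Lemma smoothN f : smooth_rV D f -> smooth_rV D (fun x => - f x).
Proof. by move=> sf k; exact: CkN. Qed.

Lemma smoothB f g : smooth_rV D f -> smooth_rV D g -> smooth_rV D (fun x => f x - g x).
Proof. by move=> sf sg k; exact: CkB. Qed.

Lemma smoothV f : (forall x, D x -> f x != 0) -> smooth_rV D f -> smooth_rV D (fun x => (f x)^-1).
Proof. by move=> f0 sf k; exact: CkV. Qed.

Lemma smooth_sum (I : Type) (r : seq I) (P : pred I) (F : I -> 'rV[R]_n -> R) :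
  (forall i, P i -> smooth_rV D (F i)) -> smooth_rV D (fun x => \sum_(i <- r | P i) F i x).
Proof. by move=> sF k; apply: Ck_sum => // i Pi; exact: sF. Qed.

Lemma smooth_prod (I : Type) (r : seq I) (P : pred I) (F : I -> 'rV[R]_n -> R) :
  (forall i, P i -> smooth_rV D (F i)) -> smooth_rV D (fun x => \prod_(i <- r | P i) F i x).
Proof. by move=> sF k; apply: Ck_prod => // i Pi; exact: sF. Qed.

Lemma smooth_partial f i : smooth_rV D f -> smooth_rV D ('D_(delta_mx 0 i) f).
Proof. by move=> sf k; have [_] := sf k.+1; apply. Qed.

Lemma smooth_differentiable f x : smooth_rV D f -> D x -> differentiable f x.
Proof. by move=> sf Dx; have [df _] := sf 1%N; exact: df. Qed.

Lemma smooth_continuous f x : smooth_rV D f -> D x -> {for x, continuous f}.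
Proof. by move=> sf Dx; exact: sf 0%N x Dx. Qed.

Lemma smooth_ext f g : (forall x, D x -> f x = g x) -> smooth_rV D f -> smooth_rV D g.
Proof. by move=> fg sf k; exact: Ck_ext (sf k). Qed.

(** The partial derivatives of the root are those of [f] divided by twice the root, so
class C^k of the root yields class C^(k+1). *)
Lemma smooth_sqrt f : (forall x, D x -> 0 < f x) -> smooth_rV D f ->
  smooth_rV D (fun x => Num.sqrt (f x)).
Proof.
move=> f0 sf.
have ds x : D x -> differentiable (fun x => Num.sqrt (f x)) x.
  move=> Dx; have df := smooth_differentiable sf Dx.
  exact: (@differentiable_comp _ _ _ _ f (Num.sqrt : R -> R) _ df (differentiable_sqrt (f0 _ Dx))).
elim=> [|k IH]; first by move=> x /ds/differentiable_continuous.
split=> // i.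
apply: (@Ck_ext _ _ k D (fun x => (2 * Num.sqrt (f x))^-1 * 'D_(delta_mx 0 i) f x)) => //.
  move=> x Dx; have df := smooth_differentiable sf Dx.
  have dsq := differentiable_sqrt (f0 _ Dx).
  rewrite [RHS](@derive_comp _ _ _ f (Num.sqrt : R -> R) x _ df dsq).
  set v := 'D_(delta_mx 0 i) f x.
  rewrite (deriveE _ dsq) -[X in 'd _ _ X]mulr1 [RHS]linearZ /= -(deriveE _ dsq).
  by rewrite derive_sqrt ?f0 // mulrC.
have nz x : D x -> 2 * Num.sqrt (f x) != 0.
  by move=> Dx; rewrite mulf_neq0 // gt_eqF // sqrtr_gt0 f0.
apply: (CkM oD (CkV oD nz (CkZ 2 oD IH))).
exact: smooth_partial.
Qed.

End Closure.

Lemma smooth_sub n (D E : set 'rV[R]_n) f : D `<=` E -> smooth_rV E f -> smooth_rV D f.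
Proof. by move=> DE sf k; exact: Ck_sub (sf k). Qed.

Lemma smooth_comp m n (D : set 'rV[R]_m) (E : set 'rV[R]_n) (G : 'rV[R]_m -> 'rV[R]_n) f :
  open D -> open E -> (forall x, D x -> E (G x)) ->
  (forall j, smooth_rV D (fun x => G x 0 j)) -> smooth_rV E f -> smooth_rV D (f \o G).
Proof. by move=> oD oE DE sG sf k; apply: (@Ck_comp _ _ _ D E) => // j; exact: sG. Qed.

End Composition.

(** * Mean value theorem along segments *)

Section MeanValue.
Context {R : realType}.

(** The Landau form of differentiability, restated with an explicit constant as the mean
value estimates produce it. *)
Lemma differentiable_eps (V W : normedModType R) (f : V -> W) x (df : {linear V -> W}) :
  continuous df ->
  (forall e, 0 < e -> \forall h \near 0, `|f (h + x) - f x - df h| <= e * `|h|) ->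
  differentiable f x /\ 'd f x = df :> (V -> W).
Proof.
move=> cdf H.
have E : f \o shift x = cst (f x) + df +o_ 0 id.
  apply/eqaddoP => e e0; apply: filterS (H e e0) => h.
  by rewrite /= !fctE /= opprD addrA.
have dE := diff_unique cdf E.
by split => //; apply/diff_locallyP; rewrite dE.
Qed.

Lemma is_derive_line (V W : normedModType R) (f : V -> W) x v t l :
  is_derive (t *: v + x) v f l -> is_derive t 1 (fun s : R => f (s *: v + x)) l.
Proof.
have E : (fun h : R => h^-1 *: (f ((h *: (1 : R) + t) *: v + x) - f (t *: v + x))) =
    (fun h => h^-1 *: (f (h *: v + (t *: v + x)) - f (t *: v + x))).
  by apply/funext => h; rewrite scalerDl [h *: 1]mulr1 addrA.
by move=> [df <-]; split; [rewrite /derivable /= E | rewrite /derive /= E].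
Qed.

Lemma mean_value_line (V : normedModType R) (f : V -> R) (df : V -> R) x v r : 0 < r ->
  (forall t, t \in `[0, r] -> is_derive (t *: v + x) v f (df (t *: v + x))) ->
  exists2 t, t \in `]0, r[ & f (r *: v + x) - f x = df (t *: v + x) * r.
Proof.
move=> r0 dfl.
have dl t : t \in `[0, r] -> is_derive t 1 (fun s : R => f (s *: v + x)) (df (t *: v + x)).
  by move=> /dfl; exact: is_derive_line.
have cl : {within `[0, r], continuous (fun s : R => f (s *: v + x))}.
  by apply: derivable_within_continuous => t /dl [].
have dl' t : t \in `]0, r[ -> is_derive t 1 (fun s : R => f (s *: v + x)) (df (t *: v + x)).
  by move=> t0r; apply: dl; exact: subset_itv_oo_cc.
have [t t01] := MVT r0 dl' cl.
rewrite scale0r add0r subr0 => E; exists t => //.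
Qed.

Lemma norm_coord_le n (x : 'rV[R]_n) i : `|x 0 i| <= `|x|.
Proof.
rewrite [leRHS]/Num.Def.normr /= mx_normrE.
exact: (le_bigmax _ (fun ij : 'I_1 * 'I_n => `|x ij.1 ij.2|) (0, i)).
Qed.

Lemma norm_row_le n (x : 'rV[R]_n) e : 0 <= e -> (forall i, `|x 0 i| <= e) -> `|x| <= e.
Proof.
move=> e0 xe; rewrite [leLHS]/Num.Def.normr /= mx_normrE.
by apply/bigmax_leP; split => // -[a b] _; rewrite ord1.
Qed.

Lemma linear_rV_continuous n (W : normedModType R) (f : {linear 'rV[R]_n -> W}) : continuous f.
Proof.
rewrite (_ : f = (fun v : 'rV[R]_n => \sum_j v 0 j *: f (delta_mx 0 j)) :> (_ -> _)).
  move=> x; apply: differentiable_continuous.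
  rewrite (_ : (fun v => _) = \sum_j (fun v : 'rV[R]_n => v 0 j *: f (delta_mx 0 j))).
    by apply: differentiable_sum => j; apply: differentiableZl; exact: differentiable_coord.
  by apply/funext => v; rewrite fct_sumE.
apply/funext => v; rewrite {1}[v]row_sum_delta linear_sum; apply: eq_bigr => j _.
by rewrite linearZ.
Qed.

(** Packaged as a linear map in order to serve as the differential of a function given by
its partial derivatives. *)
Definition row_form n (a : 'I_n -> R) (v : 'rV[R]_n) : R := \sum_i v 0 i * a i.

Lemma row_form_linear n (a : 'I_n -> R) : linear (row_form a).
Proof.
move=> k u v; rewrite /row_form scaler_sumr -big_split /=; apply: eq_bigr => i _.
by rewrite !mxE mulrDl -mulrA.
Qed.

HB.instance Definition _ n (a : 'I_n -> R) :=
  GRing.isLinear.Build R 'rV[R]_n R *:%R (row_form a) (@row_form_linear n a).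

End MeanValue.

(** * Symmetry of second derivatives *)

Section Clairaut.
Context {R : realType}.

(** Two applications of the mean value theorem, to the difference in direction [v] as a
function of the displacement in direction [u], and then to its derivative. *)
Lemma second_difference (V : normedModType R) (f : V -> R) x u v r : 0 < r ->
  (forall s t, s \in `[0, r] -> t \in `[0, r] ->
     differentiable f (t *: v + (s *: u + x)) /\
     differentiable ('D_u f) (t *: v + (s *: u + x))) ->
  exists s t, [/\ s \in `[0, r], t \in `[0, r] &
    f (r *: v + (r *: u + x)) - f (r *: u + x) - (f (r *: v + x) - f x)
    = 'D_v ('D_u f) (t *: v + (s *: u + x)) * r * r].
Proof.
move=> r0 df.
have z0 : 0 \in `[0, r] by rewrite in_itv /= lexx ltW.
have rr : r \in `[0, r] by rewrite in_itv /= lexx ltW.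
have [|s s0r Es] := @mean_value_line _ _ (fun y => f (r *: v + y) - f y)
  (fun y => 'D_u f (r *: v + y) - 'D_u f y) x u r r0.
  move=> s s0r; have [d1 _] := df s r s0r rr; have [d0 _] := df s 0 s0r z0.
  rewrite scale0r add0r in d0.
  apply: is_deriveB; last by apply: DeriveDef => //; exact: diff_derivable.
  have dsh : is_diff (s *: u + x) (fun y => r *: v + y) id.
    have -> : (fun y => r *: v + y) = cst (r *: v) + id by [].
    by apply: is_diff_eq; rewrite add0r.
  have dg : differentiable (fun y => r *: v + y) (s *: u + x) by [].
  apply: DeriveDef; first by apply: diff_derivable; exact: differentiable_comp.
  rewrite (derive_comp (f := f) u dg d1).
  by rewrite (deriveE u dg) diff_val.
have {}s0r := subset_itv_oo_cc s0r.
have [|t t0r Et] := @mean_value_line _ _ ('D_u f) ('D_v ('D_u f)) (s *: u + x) v r r0.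
  move=> t t0r; have [_ d1] := df s t s0r t0r.
  by apply: DeriveDef => //; exact: diff_derivable.
exists s, t; split => //; first exact: subset_itv_oo_cc.
by rewrite Es Et.
Qed.

(** The second difference of [f] is symmetric in the two directions, and divided by the
square of the step it is a value of either mixed derivative near [x]; let the step tend to 0. *)
Lemma partialC n (D : set 'rV[R]_n) (f : 'rV[R]_n -> R) x i j : open D -> Ck 2 D f -> D x ->
  'D_(delta_mx 0 j) ('D_(delta_mx 0 i) f) x = 'D_(delta_mx 0 i) ('D_(delta_mx 0 j) f) x.
Proof.
move=> oD Cf Dx.
have delta1 k : `|delta_mx 0 k : 'rV[R]_n| <= 1.
  by apply: norm_row_le => // l; rewrite mxE; case: (_ && _); rewrite /= ?normr1 ?normr0 ?ler01.
apply/subr0_eq/eqP; rewrite -normr_le0; apply/ler_addgt0Pl => e e0.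
have e2 : 0 < e / 2 by rewrite divr_gt0.
have near1 a b : \forall y \near x, `|'D_(delta_mx 0 b) ('D_(delta_mx 0 a) f) x
     - 'D_(delta_mx 0 b) ('D_(delta_mx 0 a) f) y| <= e / 2.
  have [_ /(_ a) [_ /(_ b) /= c]] := Cf.
  by have /cvgrPdist_le /(_ _ e2) := c x Dx.
have nD : \forall y \near x, D y by apply: open_nbhs_nbhs.
have : \forall y \near x, D y /\ (`|'D_(delta_mx 0 j) ('D_(delta_mx 0 i) f) x
     - 'D_(delta_mx 0 j) ('D_(delta_mx 0 i) f) y| <= e / 2 /\
    `|'D_(delta_mx 0 i) ('D_(delta_mx 0 j) f) x
     - 'D_(delta_mx 0 i) ('D_(delta_mx 0 j) f) y| <= e / 2).
  exact: filterI nD (filterI (near1 i j) (near1 j i)).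
move=> /nbhs_ballP [d d0 dP].
(* Two steps of length at most d / 3 stay inside the ball of radius d. *)
pose r := d / 3; have r0 : 0 < r by rewrite divr_gt0.
have inb a b s t : s \in `[0, r] -> t \in `[0, r] ->
    ball x d (t *: delta_mx 0 b + (s *: delta_mx 0 a + x)).
  rewrite !in_itv /= => /andP [s0 sr] /andP [t0 tr].
  rewrite -ball_normE /= addrA opprD [x + _]addrC subrK normrN.
  rewrite (le_lt_trans (ler_normD _ _)) // !normrZ (ger0_norm s0) (ger0_norm t0).
  apply: (@le_lt_trans _ _ (r + r)).
    by rewrite lerD // -[leRHS]mulr1 ler_pM.
  rewrite -mulr2n -mulr_natr /r -mulrA gtr_pMr // mulrC ltr_pdivrMr // mul1r.
  by rewrite ltr_nat.
have sd a b := @second_difference _ f x (delta_mx 0 a) (delta_mx 0 b) r r0.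
have [|s [t [s0 t0 E1]]] := sd i j.
  move=> s t s0 t0; have [Dy _] := dP _ (inb i j s t s0 t0).
  have [df /(_ i) [ddf _]] := Cf.
  by split; [exact: df|exact: ddf].
have [|s' [t' [s0' t0' E2]]] := sd j i.
  move=> s' t' s0' t0'; have [Dy _] := dP _ (inb j i s' t' s0' t0').
  have [df /(_ j) [ddf _]] := Cf.
  by split; [exact: df|exact: ddf].
have E : 'D_(delta_mx 0 j) ('D_(delta_mx 0 i) f) (t *: delta_mx 0 j + (s *: delta_mx 0 i + x))
    = 'D_(delta_mx 0 i) ('D_(delta_mx 0 j) f) (t' *: delta_mx 0 i + (s' *: delta_mx 0 j + x)).
  have rn : r != 0 by rewrite gt_eqF.
  have cancel a b X Y : X = a * r * r -> Y = b * r * r -> X = Y -> a = b.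
    by move=> -> -> /(mulIf rn)/(mulIf rn).
  apply: (cancel _ _ _ _ E1 E2).
  rewrite [r *: delta_mx 0 i + (r *: delta_mx 0 j + x)]addrCA.
  by rewrite !opprB addrACA [RHS]addrACA [X in _ = _ + X]addrC.
have [_ [H1 _]] := dP _ (inb i j s t s0 t0).
have [_ [_ H2]] := dP _ (inb j i s' t' s0' t0').
rewrite addr0 [leRHS]splitr.
apply: le_trans (lerD H1 _); last first.
  by rewrite distrC in H2; exact: H2.
by rewrite E; exact: ler_distD.
Qed.

End Clairaut.

(** * The inverse function theorem *)

Section InverseFunction.
Context {R : realType}.

Lemma closed_norm_ball_compact n (p : 'rV[R]_n) r : 0 < r -> compact [set u | `|p - u| <= r].
Proof.
move=> r0; apply: bounded_closed_compact; last first.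
  by have := @closed_ball_closed _ _ p r; rewrite closed_ballE.
exists (r + `|p|); split; first by rewrite num_real.
move=> M rM u /= ur; apply: le_trans (ltW rM).
by rewrite -[u](subKr p) (le_trans (ler_normB _ _)) // addrC lerD2r.
Qed.

(** The displacement [|T u - u|] attains its minimum on the compact set; since [T] halves
it, the minimum is 0. *)
Lemma half_contraction_fixed_point n (T : 'rV[R]_n -> 'rV[R]_n) (B : set 'rV[R]_n) :
  compact B -> B !=set0 -> (forall u, B u -> B (T u)) ->
  (forall u v, B u -> B v -> `|T u - T v| <= 2^-1 * `|u - v|) ->
  exists2 u, B u & T u = u.
Proof.
move=> cB B0 BT lip.
have cT : {within B, continuous (fun u => `|T u - u|)}.
  apply/subspace_continuousP => u Bu; apply/cvgrPdist_le => e e0.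
  have e2 : 0 < e / 2 by rewrite divr_gt0.
  rewrite near_withinE; apply/nbhs_ballP; exists (e / 2) => // v.
  rewrite -ball_normE /= => uv Bv.
  apply: le_trans (ler_dist_dist _ _) _.
  have -> : T u - u - (T v - v) = (T u - T v) - (u - v) by apply/rowP => i; rewrite !mxE; ring.
  apply: le_trans (ler_normB _ _) _.
  have := lip _ _ Bu Bv; lra.
have [u Bu umin] := EVT_min_rV B0 cB cT.
exists u; first exact: set_mem.
apply/eqP; rewrite -subr_eq0 -normr_eq0; apply/negPn/negP => d0.
have dp : 0 < `|T u - u| by rewrite lt_neqAle eq_sym d0 normr_ge0.
have BTu : B (T u) by apply/BT/set_mem.
have := umin (T u) (mem_set BTu); rewrite leNgt => /negP; apply.
apply: le_lt_trans (lip _ _ BTu (set_mem Bu)) _.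
by rewrite gtr_pMl // invf_lt1 ?ltr1n.
Qed.

Lemma smooth_det n m (D : set 'rV[R]_n) (A : 'rV[R]_n -> 'M[R]_m) : open D ->
  (forall i j, smooth_rV D (fun u => A u i j)) -> smooth_rV D (fun u => \det (A u)).
Proof.
move=> oD sA; apply: smooth_sum => // s _.
apply: smoothM => //; first exact: smooth_cst.
by apply: smooth_prod => // i _; exact: sA.
Qed.

Lemma smooth_invmx n m (D : set 'rV[R]_n) (A : 'rV[R]_n -> 'M[R]_m) i j : open D ->
  (forall u, D u -> A u \in unitmx) ->
  (forall i j, smooth_rV D (fun u => A u i j)) -> smooth_rV D (fun u => invmx (A u) i j).
Proof.
move=> oD uA sA.
apply: (@smooth_ext _ _ _ oD (fun u => (\det (A u))^-1 * ((-1) ^+ (j + i) * \det (row' j (col' i (A u)))))).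
  by move=> u Du; rewrite /invmx uA // !mxE.
apply: smoothM => //.
  apply: smoothV => //; last exact: smooth_det.
  by move=> u /uA; rewrite unitmxE unitfE.
apply: smoothM => //; first exact: smooth_cst.
by apply: smooth_det => // k l; apply: smooth_ext (sA (lift j k) (lift i l)) => // u _; rewrite !mxE.
Qed.

(** Points are row vectors, so the differential of [G] at [u] is right multiplication by
this matrix, and the rows are indexed by the source. *)
Definition jac m n (G : 'rV[R]_m -> 'rV[R]_n) u : 'M[R]_(m, n) :=
  \matrix_(i, j) 'D_(delta_mx 0 i) (fun v => G v 0 j) u.

Lemma derive_jac m n (G : 'rV[R]_m -> 'rV[R]_n) u v : differentiable G u ->
  'D_v G u = v *m jac G u.
Proof.
move=> dG; rewrite derive_row //; apply/rowP => j; rewrite !mxE.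
rewrite derive_dir_sum; last exact: differentiable_comp_coord.
by apply: eq_bigr => i _; rewrite mxE.
Qed.

Lemma smooth_jac m n (D : set 'rV[R]_m) (G : 'rV[R]_m -> 'rV[R]_n) i j :
  (forall k, smooth_rV D (fun u => G u 0 k)) -> smooth_rV D (fun u => jac G u i j).
Proof.
move=> sG k.
rewrite (_ : (fun u => _) = 'D_(delta_mx 0 i) (fun v => G v 0 j)).
  exact: smooth_partial.
by apply/funext => u; rewrite mxE.
Qed.

Section NearIdentity.
Variables (n : nat) (D : set 'rV[R]_n) (N : 'rV[R]_n -> 'rV[R]_n) (p : 'rV[R]_n).
Hypotheses (oD : open D) (Dp : D p) (sN : forall j, smooth_rV D (fun u => N u 0 j))
  (jN : jac N p = 1%:M).

(** The map [N - id] has small partial derivatives near [p], so the mean value theorem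
makes it contract distances by one half. *)
Lemma near_identity_lipschitz : exists r, [/\ 0 < r,
  forall u, `|p - u| <= r -> D u,
  forall u, `|p - u| <= r -> jac N u \in unitmx &
  forall u v, `|p - u| <= r -> `|p - v| <= r -> `|(N u - u) - (N v - v)| <= 2^-1 * `|u - v|].
Proof.
(* A bound e on each entry of jac N - 1 gives the Lipschitz constant n * e <= 1/2 for the
   sup norm. *)
pose e : R := (2 * n.+1%:R)^-1.
have e0 : 0 < e by rewrite invr_gt0 mulr_gt0.
have H1 : \forall u \near p, D u by apply: open_nbhs_nbhs.
have H2 : \forall u \near p, jac N u \in unitmx.
  have sd : smooth_rV D (fun u => \det (jac N u)).
    by apply: smooth_det => // i j; exact: smooth_jac.
  have cd := smooth_continuous sd Dp.
  have : \forall u \near p, `|\det (jac N p) - \det (jac N u)| < 1.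
    by move/cvgrPdist_lt : cd; apply.
  apply: filterS => u; rewrite jN det1 unitmxE unitfE.
  by apply: contraPneq => ->; rewrite subr0 normr1 ltxx.
have H3 : \forall u \near p, forall ij : 'I_n * 'I_n, `|(jac N u - 1%:M) ij.1 ij.2| <= e.
  apply: (@filter_forall _ _ _ (nbhs p) _) => -[i j].
  have cj := smooth_continuous (smooth_jac i j sN) Dp.
  have : \forall u \near p, `|jac N p i j - jac N u i j| <= e.
    by move/cvgrPdist_le : cj; apply.
  apply: filterS => u; rewrite jN /= distrC.
  by rewrite !mxE.
have : \forall u \near p, D u /\ (jac N u \in unitmx /\
  forall ij : 'I_n * 'I_n, `|(jac N u - 1%:M) ij.1 ij.2| <= e).
  exact: filterI H1 (filterI H2 H3).
move=> /nbhs_ballP [d /= d0 dP].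
have inb u : `|p - u| <= d / 2 -> ball p d u.
  rewrite -ball_normE /= => /le_lt_trans; apply.
  by rewrite ltr_pdivrMr // ltr_pMr // ltr1n.
exists (d / 2); split; first by rewrite divr_gt0.
- by move=> u /inb /dP [].
- by move=> u /inb /dP [_ []].
move=> u v ub vb; apply: norm_row_le; first by rewrite mulr_ge0 ?invr_ge0.
move=> j; set h := u - v; have hv : h + v = u by rewrite subrK.
clearbody h.
have seg t : t \in `[0, 1] -> `|p - (t *: h + v)| <= d / 2.
  rewrite in_itv /= => /andP [t0 t1].
  have -> : p - (t *: h + v) = t *: (p - u) + (1 - t) *: (p - v).
    by rewrite -hv; apply/rowP => i; rewrite !mxE; ring.
  rewrite (le_trans (ler_normD _ _)) // !normrZ ger0_norm // (@ger0_norm _ (1 - t)) ?subr_ge0 //.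
  have -> : d / 2 = t * (d / 2) + (1 - t) * (d / 2) by ring.
  by rewrite lerD // ler_wpM2l ?subr_ge0.
pose phi (w : 'rV[R]_n) : R := N w 0 j - w 0 j.
pose dphi (w : 'rV[R]_n) : R := \sum_i h 0 i * (jac N w - 1%:M) i j.
have dphiP t : t \in `[0, 1] -> is_derive (t *: h + v) h phi (dphi (t *: h + v)).
  move=> /seg /inb /dP [Dw _]; set w := t *: h + v.
  have dN : differentiable (fun u => N u 0 j) w by apply: smooth_differentiable (sN j) Dw.
  have dc : differentiable (fun u : 'rV[R]_n => u 0 j : R) w by exact: differentiable_coord.
  have -> : dphi w = 'D_h (fun u => N u 0 j) w - 'D_h (fun u : 'rV[R]_n => u 0 j : R) w.
    rewrite derive_coord derive_dir_sum // /dphi.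
    under eq_bigr do rewrite !mxE mulrBr.
    rewrite sumrB; congr (_ - _).
    rewrite (bigD1 j) //= eqxx mulr1 big1 ?addr0 // => i ij.
    by rewrite (negbTE ij) mulr0.
  by apply: is_deriveB; apply: DeriveDef => //; exact: diff_derivable.
have [t t01 Et] := @mean_value_line _ _ phi dphi v h 1 ltr01 dphiP.
rewrite scale1r hv mulr1 in Et.
rewrite !mxE -/(phi u) -/(phi v) Et.
have /seg /inb /dP [_ [_ je]] : t \in `[0, 1] by exact: subset_itv_oo_cc.
apply: le_trans (ler_norm_sum _ _ _) _.
apply: (@le_trans _ _ (\sum_(i < n) `|h| * e)).
  apply: ler_sum => i _; rewrite normrM ler_pM ?norm_coord_le //.
  exact: (je (i, j)).
rewrite sumr_const card_ord -mulrnAr mulrC ler_wpM2r // -mulr_natr /e invfM -mulrA.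
by rewrite ler_piMr ?invr_ge0 // mulrC ler_pdivrMr // mul1r ler_nat.
Qed.

End NearIdentity.

Section NearIdentity.
Variables (n : nat) (D : set 'rV[R]_n) (N : 'rV[R]_n -> 'rV[R]_n) (p : 'rV[R]_n).
Hypotheses (oD : open D) (Dp : D p) (sN : forall j, smooth_rV D (fun u => N u 0 j))
  (jN : jac N p = 1%:M).

(** The point with image [y] is the fixed point of [u -> u - N u + y], a contraction by
one half; the same estimate gives injectivity and the Lipschitz constant 2 of the inverse. *)
Lemma near_identity_inverse : exists r W H,
  [/\ [/\ 0 < r, open W, W p, W `<=` D & N @` W = ball (N p) r],
  forall u, W u -> H (N u) = u,
  forall u, W u -> jac N u \in unitmx &
  forall y y', ball (N p) r y -> ball (N p) r y' -> `|H y - H y'| <= 2 * `|y - y'|].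
Proof.
have [r [r0 rD rJ lip]] := near_identity_lipschitz oD Dp sN jN.
have r20 : 0 < r / 2 by rewrite divr_gt0.
have lip2 u v : `|p - u| <= r -> `|p - v| <= r -> `|u - v| <= 2 * `|N u - N v|.
  move=> ur vr; have := lip u v ur vr.
  have E : u - v = (N u - N v) - ((N u - u) - (N v - v)).
    by apply/rowP => i; rewrite !mxE; ring.
  have := ler_normB (N u - N v) ((N u - u) - (N v - v)); rewrite -E; lra.
pose W := [set u | D u /\ (`|p - u| < r /\ `|N p - N u| < r / 2)].
have cN u : D u -> {for u, continuous N}.
  by move=> Du; apply: continuous_row => j; exact: smooth_continuous (sN j) Du.
have oW : open W.
  rewrite openE => u [Du [ur Nur]].
  have H1 : \forall v \near u, D v by apply: open_nbhs_nbhs.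
  have H2 : \forall v \near u, `|p - v| < r.
    apply: open_nbhs_nbhs; split => //; have := @ball_open _ _ p r.
    by rewrite -ball_normE; apply.
  have H3 : \forall v \near u, `|N p - N v| < r / 2.
    have nb : nbhs (N u) [set z | `|N p - z| < r / 2].
      apply: open_nbhs_nbhs; split => //.
      by have := @ball_open _ _ (N p) (r / 2); rewrite -ball_normE; apply.
    exact: (cN u Du _ nb).
  by apply: filterI H1 (filterI H2 H3).
have surj y : ball (N p) (r / 2) y -> exists2 u, W u & N u = y.
  rewrite -ball_normE /= => yr.
  have Bp : `|p - p| <= r by rewrite subrr normr0 ltW.
  have [|||u ur Tu] := @half_contraction_fixed_point _ (fun u => u - N u + y) [set u | `|p - u| <= r]
     (@closed_norm_ball_compact _ p r r0).
  - by exists p.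
  - move=> u /= ur; have := lip u p ur Bp.
    have -> : p - (u - N u + y) = ((N u - u) - (N p - p)) + (N p - y).
      by apply/rowP => i; rewrite !mxE; ring.
    rewrite [`|u - p|]distrC.
    have := ler_normD ((N u - u) - (N p - p)) (N p - y); lra.
  - move=> u v /= ur vr; have := lip u v ur vr.
    rewrite -normrN; congr (_ <= _); congr (`|_|).
    by apply/rowP => i; rewrite !mxE; ring.
  have Nu : N u = y.
    apply/eqP; rewrite eq_sym -subr_eq0; apply/eqP/rowP => i.
    by have /rowP /(_ i) := Tu; rewrite !mxE => E; move: E; rewrite -addrA -[X in _ = X]addr0 => /addrI; rewrite addrC.
  exists u => //; split; [exact: rD|rewrite Nu; split => //].
  by have := lip2 _ _ Bp ur; rewrite Nu; move: yr; lra.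
pose H y := get [set u | W u /\ N u = y].
have HN u : W u -> H (N u) = u.
  move=> Wu; have : [set v | W v /\ N v = N u] (H (N u)) by apply: (@getI _ _ u).
  move=> [[_ [/ltW hr _]] Nh]; have [_ [/ltW ur _]] := Wu.
  apply/eqP; rewrite -subr_eq0 -normr_le0 (le_trans (lip2 _ _ hr ur)) //.
  by rewrite Nh subrr normr0 mulr0.
exists (r / 2), W, H; split.
- split => //; first by rewrite /W /= !subrr !normr0.
    by move=> u [].
  apply/seteqP; split => [_ [u [_ [_ ur]] <-]|y /surj [u Wu <-]]; last by exists u.
  by rewrite -ball_normE.
- exact: HN.
- by move=> u [_ [/ltW ur _]]; exact: rJ.
- move=> y y' /surj [u Wu <-] /surj [u' Wu' <-]; rewrite !HN //.
  by apply: lip2; [have [_ [/ltW]] := Wu|have [_ [/ltW]] := Wu'].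
Qed.

End NearIdentity.

Lemma diff_eps (V W : normedModType R) (f : V -> W) x e : differentiable f x -> 0 < e ->
  \forall h \near 0, `|f (h + x) - f x - 'd f x h| <= e * `|h|.
Proof.
move=> /diff_locally /eqaddoP H e0; apply: filterS (H e e0) => h.
by rewrite /= !fctE /= opprD addrA.
Qed.

(** With [h = H (N u + k) - u], the differential of [N] gives [k = h J + o(h)], and the
Lipschitz bound makes [o(h)] an [o(k)]; multiply by the inverse of [J]. *)
Lemma inverse_differentiable n (N H : 'rV[R]_n -> 'rV[R]_n) u C :
  differentiable N u -> jac N u \in unitmx -> H (N u) = u ->
  (\forall y \near N u, N (H y) = y /\ `|H y - u| <= C * `|y - N u|) ->
  differentiable H (N u) /\ forall k, 'd H (N u) k = k *m invmx (jac N u).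
Proof.
move=> dN Ju HNu Hnear.
have dNE h : 'd N u h = h *m jac N u by rewrite -deriveE // derive_jac.
set J := jac N u in Ju dNE *.
have [c c0 cJ] := linear_lipschitz (@linear_rV_continuous _ _ _ (mulmxr (invmx J))).
suff [dH E] : differentiable H (N u) /\ 'd H (N u) = mulmxr (invmx J) :> (_ -> _).
  split; first exact: dH.
  by move=> k; exact: (@congr1 ('rV[R]_n -> 'rV[R]_n) _ (fun f => f k) _ _ E).
apply: differentiable_eps; first exact: linear_rV_continuous.
move=> e e0.
pose C' := `|C| + 1; have C'0 : 0 < C' by rewrite ltr_wpDl.
have e'0 : 0 < e / (c * C') by rewrite divr_gt0 // mulr_gt0.
have /nbhs_ballP [d /= d0 dP] := diff_eps dN e'0.
have Hk : \forall k \near (0 : 'rV[R]_n), N (H (k + N u)) = k + N u /\ `|H (k + N u) - u| <= C * `|k + N u - N u|.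
  by have := Hnear; rewrite (near_shift 0 (N u)) subr0; apply: filterS.
have dk : \forall k \near (0 : 'rV[R]_n), `|k| < d / C'.
  apply/nbhs_ballP; exists (d / C') => /=; first by rewrite divr_gt0.
  by move=> k; rewrite -ball_normE /= sub0r normrN.
apply: filterS2 Hk dk => k [Nk Hku] kd.
rewrite addrK in Hku; rewrite HNu; set h := H (k + N u) - u.
have hu : h + u = H (k + N u) by rewrite subrK.
have hk : `|h| <= C' * `|k|.
  apply: le_trans Hku _; rewrite ler_wpM2r //.
  by rewrite (le_trans (ler_norm _)) // lerDl.
have hd : ball 0 d h.
  rewrite -ball_normE /= sub0r normrN (le_lt_trans hk) //.
  by rewrite mulrC -ltr_pdivlMr.
have := dP h hd; rewrite /= hu Nk addrK dNE => Hh.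
have -> : h - k *m invmx J = - ((k - h *m J) *m invmx J).
  by rewrite mulmxBl -mulmxA mulmxV // mulmx1 opprB.
rewrite normrN; apply: le_trans (cJ _) _.
apply: (@le_trans _ _ (c * (e / (c * C') * (C' * `|k|)))).
  rewrite ler_wpM2l ?(ltW c0) //; apply: le_trans Hh _.
  by rewrite ler_wpM2l // ltW.
rewrite le_eqVlt; apply/orP; left; apply/eqP; field.
by rewrite !gt_eqF.
Qed.

(** The Jacobian of the inverse is the inverse matrix of the Jacobian of [N] evaluated at
the inverse: if the inverse is C^k then so is its Jacobian. *)
Lemma inverse_smooth n (W Y : set 'rV[R]_n) (N H : 'rV[R]_n -> 'rV[R]_n) :
  open W -> open Y -> (forall j, smooth_rV W (fun u => N u 0 j)) ->
  (forall u, W u -> jac N u \in unitmx) ->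
  (forall y, Y y -> [/\ W (H y), differentiable H y &
      forall k, 'd H y k = k *m invmx (jac N (H y))]) ->
  forall j, smooth_rV Y (fun y => H y 0 j).
Proof.
move=> oW oY sN JN dH j k; elim: k j => [|k IH] j.
  by move=> y /dH [_ dHy _]; apply/differentiable_continuous/differentiable_comp_coord.
split=> [y /dH [_ dHy _]|i]; first exact: differentiable_comp_coord.
apply: (@Ck_ext _ _ k Y ((fun u => invmx (jac N u) i j) \o H)) => //.
  move=> y /dH [_ dHy E] /=.
  have /rowP /(_ j) := derive_row (delta_mx 0 i) dHy; rewrite mxE => <-.
  by rewrite deriveE // E -rowE mxE.
apply: (@Ck_comp _ _ _ _ Y W) => //; first by move=> y /dH [].
by apply: smooth_invmx => // i' j'; exact: smooth_jac.
Qed.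

Lemma smooth_mulmx m n (E : set 'rV[R]_m) (A : 'M[R]_(m, n)) j :
  smooth_rV E (fun y => (y *m A) 0 j).
Proof.
apply: (@smooth_sub _ _ _ setT) => //.
apply: (@smooth_ext _ _ _ openT (fun y => \sum_k y 0 k * A k j)).
  by move=> y _; rewrite mxE.
apply: (smooth_sum openT) => k _; apply: (smoothM openT); [exact: smooth_coord|exact: smooth_cst].
Qed.

Lemma near_identity_diffeo n (D : set 'rV[R]_n) (N : 'rV[R]_n -> 'rV[R]_n) p :
  open D -> D p -> (forall j, smooth_rV D (fun u => N u 0 j)) -> jac N p = 1%:M ->
  exists r W H,
  [/\ [/\ 0 < r, open W, W p, W `<=` D & N @` W = ball (N p) r],
  forall u, W u -> H (N u) = u &
  forall j, smooth_rV (ball (N p) r) (fun y => H y 0 j)].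
Proof.
move=> oD Dp sN jN.
have [r [W [H [[r0 oW Wp WD NW] HN JW lip]]]] := near_identity_inverse oD Dp sN jN.
exists r, W, H; split => //.
have inW y : ball (N p) r y -> W (H y) /\ N (H y) = y.
  by rewrite -NW => -[u Wu <-]; rewrite HN.
have sNW j : smooth_rV W (fun u => N u 0 j) by exact: smooth_sub (sN j).
apply: (@inverse_smooth _ W _ N) => //; first exact: ball_open.
move=> y yb; have [Wy NHy] := inW y yb.
have dN : differentiable N (H y).
  by apply: differentiable_row => j; exact: smooth_differentiable (sNW j) Wy.
have [||dH E] := @inverse_differentiable _ N H (H y) 2 dN (JW _ Wy).
- by rewrite NHy.
- rewrite NHy; have : \forall z \near y, ball (N p) r z.
    by apply: open_nbhs_nbhs; split => //; exact: ball_open.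
  by apply: filterS => z zb; have [_ ->] := inW z zb; split => //; exact: lip.
by rewrite NHy in dH E; split.
Qed.

(** Composition with the linear map inverse to the Jacobian at [p] reduces to a map
whose Jacobian at [p] is the identity. *)
Theorem inverse_function n (D : set 'rV[R]_n) (G : 'rV[R]_n -> 'rV[R]_n) p :
  open D -> D p -> (forall j, smooth_rV D (fun u => G u 0 j)) -> jac G p \in unitmx ->
  exists W H,
  [/\ [/\ open W, W p, W `<=` D & open (G @` W)],
  forall u, W u -> H (G u) = u &
  forall j, smooth_rV (G @` W) (fun y => H y 0 j)].
Proof.
move=> oD Dp sG Ju; set A := invmx (jac G p).
pose L (y : 'rV[R]_n) := y *m A.
have sL E j : smooth_rV E (fun y => L y 0 j).
  exact: smooth_mulmx.
have cL : continuous L by exact: (@linear_rV_continuous _ _ _ (mulmxr A)).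
pose N u := L (G u).
have sN j : smooth_rV D (fun u => N u 0 j).
  apply: (@smooth_comp _ _ _ D setT G (fun y => L y 0 j)) => //; exact: openT.
have jN : jac N p = 1%:M.
  rewrite -(mulmxV Ju) -/A; apply/row_matrixP => i; rewrite !rowE mulmxA.
  have dG : differentiable G p.
    by apply: differentiable_row => j; exact: smooth_differentiable (sG j) Dp.
  have dL : differentiable L (G p).
    by apply: differentiable_row => j; exact: smooth_differentiable (sL setT j) _.
  rewrite -!derive_jac //; last exact: differentiable_comp.
  rewrite (@derive_comp _ _ _ _ G L) // deriveE //.
  by rewrite (@diff_lin _ _ _ (mulmxr A)).
have [r [W [H [[r0 oW Wp WD NW] HN sH]]]] := near_identity_diffeo oD Dp sN jN.
have GW : G @` W = L @^-1` ball (N p) r.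
  rewrite -NW; apply/seteqP; split => [_ [u Wu <-]|y [u Wu E]]; first by exists u.
  exists u => //; have := congr1 (mulmx^~ (jac G p)) E.
  by rewrite /N /L -!mulmxA mulVmx // !mulmx1.
have oGW : open (G @` W).
  by rewrite GW; apply: open_comp => //; exact: ball_open.
exists W, (H \o L); split; [by split|by move=> u Wu; exact: HN|].
move=> j; apply: (@smooth_comp _ _ _ _ (ball (N p) r) L (fun y => H y 0 j)) => //.
- exact: ball_open.
- by rewrite GW.
Qed.

End InverseFunction.

(** * Integrals over the unit interval *)

Section UnitIntervalIntegral.
Context {R : realType}.
Implicit Types f g : R -> R.

Definition int01 f : R := Rintegral (@lebesgue_measure R) `[0, 1] f.

(** Continuity on the whole line at the points of the interval; the integrands below
extend beyond its end points. *)
Definition continuous01 f := forall s, s \in `[0, 1] -> {for s, continuous f}.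

Lemma integrable01 f : continuous01 f -> (@lebesgue_measure R).-integrable `[0, 1] (EFin \o f).
Proof.
move=> cf; apply: continuous_compact_integrable; first exact: segment_compact.
by apply: continuous_in_subspaceT => s /set_mem; exact: cf.
Qed.

Lemma continuous01D f g : continuous01 f -> continuous01 g -> continuous01 (fun s => f s + g s).
Proof. by move=> cf cg s s01; apply: continuousD; [exact: cf|exact: cg]. Qed.

Lemma continuous01B f g : continuous01 f -> continuous01 g -> continuous01 (fun s => f s - g s).
Proof. by move=> cf cg s s01; apply: continuousB; [exact: cf|exact: cg]. Qed.

Lemma continuous01Z a f : continuous01 f -> continuous01 (fun s => a * f s).
Proof. by move=> cf s s01; apply: continuousM; [exact: cst_continuous|exact: cf]. Qed.

Lemma int01D f g : continuous01 f -> continuous01 g ->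
  int01 (fun s => f s + g s) = int01 f + int01 g.
Proof. by move=> cf cg; apply: RintegralD => //; exact: integrable01. Qed.

Lemma int01B f g : continuous01 f -> continuous01 g ->
  int01 (fun s => f s - g s) = int01 f - int01 g.
Proof. by move=> cf cg; apply: RintegralB => //; exact: integrable01. Qed.

Lemma int01Z a f : continuous01 f -> int01 (fun s => a * f s) = a * int01 f.
Proof. by move=> cf; apply: RintegralZl => //; exact: integrable01. Qed.

Lemma int01_sum n (F : 'I_n -> R -> R) : (forall i, continuous01 (F i)) ->
  continuous01 (fun s => \sum_i F i s) /\ int01 (fun s => \sum_i F i s) = \sum_i int01 (F i).
Proof.
move=> cF; elim: n F cF => [|n IH] F cF.
  have -> : (fun s => \sum_(i < 0) F i s) = cst 0 by apply/funext => s; rewrite big_ord0.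
  split; first by move=> s _; exact: cst_continuous.
  by rewrite big_ord0 /int01 Rintegral_cst ?mul0r.
have [c E] := IH (fun i => F (widen_ord (leqnSn n) i)) (fun i => cF _).
have -> : (fun s => \sum_i F i s) =
    (fun s => \sum_(i < n) F (widen_ord (leqnSn n) i) s + F ord_max s).
  by apply/funext => s; rewrite big_ord_recr.
split; first exact: continuous01D.
by rewrite int01D // E big_ord_recr.
Qed.

Lemma eq_int01 f g : (forall s, s \in `[0, 1] -> f s = g s) -> int01 f = int01 g.
Proof. by move=> fg; apply: eq_Rintegral => s /set_mem; exact: fg. Qed.

Lemma int01_le f e : continuous01 f -> (forall s, s \in `[0, 1] -> `|f s| <= e) -> `|int01 f| <= e.
Proof.
move=> cf fe; have intf := integrable01 cf.
apply: le_trans (le_normr_Rintegral _ intf) _ => //.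
have -> : e = int01 (cst e).
  by rewrite /int01 Rintegral_cst //= lebesgue_measure_itv /= lte01 oppr0 adde0 mulr1.
apply: le_Rintegral => //.
- apply: (@integrable01 (fun s => `|f s|)) => s s01.
  by apply: continuous_comp; [exact: cf|exact: norm_continuous].
- by apply: integrable01 => s _; exact: cst_continuous.
Qed.

Lemma int01_FTC f F : continuous01 f -> (forall s : R, s \in `[0, 1] -> is_derive s 1 F (f s)) ->
  int01 f = F 1 - F 0.
Proof.
move=> cf dF.
have cF s : s \in `[0, 1] -> {for s, continuous F}.
  by move=> /dF [d _]; apply/differentiable_continuous/derivable1_diffP.
rewrite /int01 /Rintegral.
rewrite (@continuous_FTC2 _ f F) //.
- by apply: continuous_in_subspaceT => s /set_mem; exact: cf.
- split.
  + by move=> s /subset_itv_oo_cc /dF [].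
  + by apply: cvg_at_right_filter; apply: cF; rewrite in_itv /= lexx ler01.
  + by apply: cvg_at_left_filter; apply: cF; rewrite in_itv /= lexx ler01.
- by move=> s /subset_itv_oo_cc /dF [_ <-]; rewrite derive1E.
Qed.

End UnitIntervalIntegral.

Lemma continuous_eps (R : realType) (T : topologicalType) (f : T -> R) x :
  (forall e, 0 < e -> \forall y \near x, `|f x - f y| <= e) -> {for x, continuous f}.
Proof. by move=> H; apply/cvgrPdist_le. Qed.

(** * Smooth dependence of integrals on a parameter *)

Section ParametricIntegral.
Context {R : realType} {n : nat}.
Variables (O : set 'rV[R]_(1 + n)) (D : set 'rV[R]_n).
Hypothesis oD : open D.

Definition slice (s : R) (v : 'rV[R]_n) : 'rV[R]_(1 + n) := row_mx (const_mx s) v.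

Hypothesis DO : forall (s : R) v, s \in `[0, 1] -> D v -> O (slice s v).
Implicit Types F : 'rV[R]_(1 + n) -> R.

Lemma slice_continuous_l v : continuous (slice^~ v).
Proof.
move=> s; apply: continuous_row => j; rewrite -[j]fintype.splitK; case: (fintype.split j) => i /=.
  have -> : (fun y => slice y v 0 (lshift n i)) = id.
    by apply/funext => t; rewrite /slice row_mxEl mxE.
  exact: cvg_id.
have -> : (fun y => slice y v 0 (rshift 1 i)) = cst (v 0 i).
  by apply/funext => t; rewrite /slice row_mxEr.
exact: cst_continuous.
Qed.

Lemma slice_sub_le s v s' v' e : 0 <= e -> `|s - s'| <= e -> `|v - v'| <= e ->
  `|slice s v - slice s' v'| <= e.
Proof.
move=> e0 se ve.
have -> : slice s v - slice s' v' = row_mx (const_mx (s - s')) (v - v').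
  rewrite /slice opp_row_mx add_row_mx; congr row_mx.
  by apply/matrixP => i j; rewrite !mxE.
apply: norm_row_le => // j; rewrite -[j]fintype.splitK; case: (fintype.split j) => i /=.
  by rewrite row_mxEl mxE.
by rewrite row_mxEr; apply: le_trans ve; exact: norm_coord_le.
Qed.

Lemma slice_line s v h t : t *: row_mx 0 h + slice s v = slice s (t *: h + v).
Proof. by rewrite /slice scale_row_mx scaler0 add_row_mx add0r. Qed.

Lemma derive_slice F s h v : 'D_(row_mx 0 h) F (slice s v) = 'D_h (fun u => F (slice s u)) v.
Proof.
have E : (fun t : R => t^-1 *: (F (t *: row_mx 0 h + slice s v) - F (slice s v)) : R) =
    (fun t => t^-1 *: (F (slice s (t *: h + v)) - F (slice s v))).
  by apply/funext => t; rewrite slice_line.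
by rewrite /derive /= E.
Qed.

Lemma row_mx0_delta (i : 'I_n) :
  row_mx 0 (delta_mx 0 i) = delta_mx 0 (rshift 1 i) :> 'rV[R]_(1 + n).
Proof.
apply/rowP => j; rewrite -[j]fintype.splitK; case: (fintype.split j) => k /=.
  by rewrite row_mxEl !mxE eq_lrshift andbF.
by rewrite row_mxEr !mxE eq_rshift.
Qed.

Lemma derive_row_mx0 F x h : differentiable F x ->
  'D_(row_mx 0 h) F x = \sum_i h 0 i * 'D_(delta_mx 0 (rshift 1 i)) F x.
Proof.
move=> dF; rewrite derive_dir_sum // big_split_ord /= big_ord1 row_mxEl mxE scale0r add0r.
by apply: eq_bigr => i _; rewrite row_mxEr.
Qed.

Lemma continuous01_slice F v : Ck 0 O F -> D v -> continuous01 (fun s => F (slice s v)).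
Proof.
move=> cF Dv s s01; apply: (@continuous_comp _ _ _ (slice^~ v) F).
  exact: slice_continuous_l.
exact: cF (DO s01 Dv).
Qed.

(** Compactness of the unit interval makes continuity in the parameter uniform in the
variable of integration. *)
Lemma slice_uniform F v e : Ck 0 O F -> D v -> 0 < e ->
  \forall u \near v, forall s : R, s \in `[0, 1] -> `|F (slice s u) - F (slice s v)| <= e.
Proof.
move=> cF Dv e0.
have e2 : 0 < e / 2 by rewrite divr_gt0.
have /compact_near_coveringP := @segment_compact R 0 1.
move=> /(_ _ (nbhs v) (fun u s => `|F (slice s u) - F (slice s v)| <= e) _).
suff H : forall s : R, `[0, 1]%classic s ->
    \forall s' \near s & u \near v, `|F (slice s' u) - F (slice s' v)| <= e.
  by move=> /(_ H); apply: filterS => u uP s; exact: uP.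
move=> s s01.
have /cvgrPdist_le /(_ _ e2) := cF _ (DO s01 Dv); move=> /nbhs_ballP [d /= d0 dP].
have d2 : 0 < d / 2 by rewrite divr_gt0.
have close s' u : ball s (d / 2) s' -> ball v (d / 2) u -> ball (slice s v) d (slice s' u).
  rewrite -!ball_normE /= => sd vd; apply: (@le_lt_trans _ _ (d / 2)).
    by apply: slice_sub_le; rewrite ltW.
  by rewrite ltr_pdivrMr // ltr_pMr // ltr1n.
exists (ball s (d / 2), ball v (d / 2)).
  by split; exact: nbhsx_ballx.
move=> [s' u] [/= sd vd].
have H1 := dP _ (close _ _ sd vd).
have H2 := dP _ (close _ _ sd (ballxx v d2)).
rewrite -(subrKA (F (slice s v))) (le_trans (ler_normD _ _)) // [leRHS]splitr lerD //.
by rewrite distrC.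
Qed.

Lemma int01_slice_continuous F v : Ck 0 O F -> D v ->
  {for v, continuous (fun v => int01 (fun s => F (slice s v)))}.
Proof.
move=> cF Dv; apply: continuous_eps => e e0.
have H1 : \forall u \near v, D u by apply: open_nbhs_nbhs.
apply: filterS2 H1 (slice_uniform cF Dv e0) => u Du H.
rewrite -int01B; [|exact: continuous01_slice..].
apply: int01_le; first by apply: continuous01B; exact: continuous01_slice.
by move=> s s01; rewrite distrC; exact: H.
Qed.

(** For each [s] the mean value theorem writes the increment of [F] through partial
derivatives at an intermediate point; these are uniformly close to those at [v], and the
estimate survives integration. *)
Lemma int01_slice_differentiable F v : Ck 1 O F -> D v ->
  differentiable (fun v => int01 (fun s => F (slice s v))) v /\
  forall w, 'D_w (fun v => int01 (fun s => F (slice s v))) v =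
    int01 (fun s => 'D_w (fun u => F (slice s u)) v).
Proof.
move=> CF Dv; have [dF /= pF] := CF.
have c0F : Ck 0 O F by exact: CkS.
pose P i := 'D_(delta_mx 0 (rshift 1 i)) F.
have cP i : Ck 0 O (P i) by exact: pF.
have DE w s : s \in `[0, 1] ->
    'D_w (fun u => F (slice s u)) v = \sum_i w 0 i * P i (slice s v).
  by move=> s01; rewrite -derive_slice; apply: derive_row_mx0; exact: dF (DO s01 Dv).
have cPs u i : D u -> continuous01 (fun s => P i (slice s u)).
  by move=> Du; exact: continuous01_slice.
pose L := row_form (fun i => int01 (fun s => P i (slice s v))).
have LE w : L w = int01 (fun s => \sum_i w 0 i * P i (slice s v)).
  have [|_ ->] := @int01_sum _ _ (fun i s => w 0 i * P i (slice s v)).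
    by move=> i; apply: continuous01Z; exact: cPs.
  by apply: eq_bigr => i _; rewrite int01Z //; exact: cPs.
suff [d E] : differentiable (fun v => int01 (fun s => F (slice s v))) v /\
    'd (fun v => int01 (fun s => F (slice s v))) v = L :> (_ -> _).
  split; first exact: d.
  move=> w; rewrite deriveE //; transitivity (L w).
    exact: (@congr1 ('rV[R]_n -> R) _ (fun f => f w) _ _ E).
  by rewrite LE; apply: eq_int01 => s s01; rewrite DE.
apply: differentiable_eps; first exact: linear_rV_continuous.
move=> e e0.
pose e' := e / n.+1%:R; have e'0 : 0 < e' by rewrite divr_gt0.
have H1 : \forall u \near v, D u by apply: open_nbhs_nbhs.
have H2 : \forall u \near v, forall i s, s \in `[0, 1] -> `|P i (slice s u) - P i (slice s v)| <= e'.
  by apply: (@filter_forall _ _ _ (nbhs v) _) => i; exact: slice_uniform.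
have : \forall u \near v, D u /\
    forall i s, s \in `[0, 1] -> `|P i (slice s u) - P i (slice s v)| <= e'.
  exact: filterI H1 H2.
move=> /nbhs_ballP [d /= d0 dP].
apply/nbhs_ballP; exists d => //= h; rewrite -ball_normE /= sub0r normrN => hd.
have inb (t : R) : t \in `[0, 1] -> ball v d (t *: h + v).
  rewrite in_itv /= => /andP [t0 t1].
  rewrite -ball_normE /= opprD addrC subrK normrN normrZ (le_lt_trans _ hd) //.
  by rewrite ger0_norm // ler_piMl.
have Dhv : D (h + v).
  have hb : ball v d (h + v).
    by rewrite -[h]scale1r; apply: inb; rewrite in_itv /= lexx ler01.
  by have [] := dP _ hb.
have cD : continuous01 (fun s => \sum_i h 0 i * P i (slice s v)).
  have [|c _] := @int01_sum _ _ (fun i s => h 0 i * P i (slice s v)); last exact: c.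
  by move=> i; apply: continuous01Z; exact: cPs.
have c1 : continuous01 (fun s => F (slice s (h + v)) - F (slice s v)).
  by apply: continuous01B; exact: continuous01_slice.
rewrite -[X in _ - X]/(L h) LE -int01B; [|exact: continuous01_slice..].
rewrite -int01B //.
apply: int01_le; first exact: continuous01B.
move=> s s01.
have [|t t01 Et] := @mean_value_line _ _ F (fun x => \sum_i h 0 i * P i x) (slice s v) (row_mx 0 h) 1 ltr01.
  move=> t t01; rewrite slice_line; have [Du _] := dP _ (inb t t01).
  have dFu := dF _ (DO s01 Du).
  by rewrite -derive_row_mx0 //; apply: DeriveDef => //; exact: diff_derivable.
rewrite !slice_line scale1r mulr1 in Et; rewrite Et -sumrB.
have {}t01 := subset_itv_oo_cc t01.
have [_ Pt] := dP _ (inb t t01).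
apply: le_trans (ler_norm_sum _ _ _) _.
apply: (@le_trans _ _ (\sum_(i < n) `|h| * e')).
  by apply: ler_sum => i _; rewrite -mulrBr normrM ler_pM // ?norm_coord_le // Pt.
rewrite sumr_const card_ord -mulrnAr [leRHS]mulrC ler_wpM2l // -mulr_natr /e' -mulrA.
by rewrite ler_piMr ?(ltW e0) // mulrC ler_pdivrMr // mul1r ler_nat.
Qed.

Lemma int01_slice_smooth F : smooth_rV O F ->
  smooth_rV D (fun v => int01 (fun s => F (slice s v))).
Proof.
move=> sF k; elim: k F sF => [|k IH] F sF.
  by move=> v Dv; apply: int01_slice_continuous => //; exact: sF.
split=> [v Dv|i]; first by have [] := int01_slice_differentiable (sF 1%N) Dv.
apply: (@Ck_ext _ _ k D (fun v => int01 (fun s => 'D_(delta_mx 0 (rshift 1 i)) F (slice s v)))) => //.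
  move=> v Dv; have [_ ->] := int01_slice_differentiable (sF 1%N) Dv.
  by apply: eq_int01 => s _; rewrite -derive_slice row_mx0_delta.
exact: (IH _ (smooth_partial (rshift 1 i) sF)).
Qed.

End ParametricIntegral.

Lemma is_derive_coord (R : realType) n (i : 'I_n) (x v : 'rV[R]_n) :
  is_derive x v (fun u : 'rV[R]_n => u 0 i : R) (v 0 i).
Proof.
apply: DeriveDef; last exact: derive_coord.
by apply: diff_derivable; exact: differentiable_coord.
Qed.

(** * A leafwise Poincare lemma *)

Section LeafwisePoincare.
Context {R : realType} {n : nat}.
Variables (a : pred 'I_n) (o : 'rV[R]_n) (r : R) (theta : 'I_n -> 'rV[R]_n -> R).
Hypotheses (stheta : forall i, a i -> smooth_rV (ball o r) (theta i))
  (closed_theta : forall i j v, a i -> a j -> ball o r v ->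
     'D_(delta_mx 0 j) (theta i) v = 'D_(delta_mx 0 i) (theta j) v).

(** The leaves are the affine subspaces in the directions [i] with [a i]; the remaining
coordinates are parameters. *)
Definition leaf_part (v : 'rV[R]_n) : 'rV[R]_n := \row_i (if a i then v 0 i else 0).

(** The homothety of ratio [s] of each leaf, centred at its point whose leaf coordinates
are those of [o]. *)
Definition leaf_shrink (s : R) (v : 'rV[R]_n) : 'rV[R]_n :=
  s *: leaf_part (v - o) + (v - leaf_part (v - o)).

Lemma leaf_shrinkE s v i :
  leaf_shrink s v 0 i = if a i then o 0 i + s * (v 0 i - o 0 i) else v 0 i.
Proof. by rewrite !mxE; case: (a i); ring. Qed.

(** Balls of the sup norm are products of intervals, so shrinking some coordinates
towards the centre stays inside. *)
Lemma leaf_shrink_ball s v : s \in `[0, 1] -> ball o r v -> ball o r (leaf_shrink s v).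
Proof.
rewrite in_itv /= => /andP [s0 s1]; rewrite -ball_normE /= => vr.
apply: le_lt_trans vr; apply: norm_row_le => // i.
have subE (u w : 'rV[R]_n) : (u - w) 0 i = u 0 i - w 0 i by rewrite !mxE.
have := norm_coord_le (o - v) i; rewrite !subE leaf_shrinkE => vi.
case: (a i) => //.
rewrite opprD addNKr -mulrN opprB normrM ger0_norm //.
by apply: le_trans vi; rewrite ler_piMl.
Qed.

Lemma leaf_shrink1 v : leaf_shrink 1 v = v.
Proof. by rewrite /leaf_shrink scale1r addrC subrK. Qed.

Lemma leaf_shrink_derive s v j : a j ->
  differentiable (leaf_shrink s) v /\ 'D_(delta_mx 0 j) (leaf_shrink s) v = s *: delta_mx 0 j.
Proof.
move=> aj.
have dc i : is_derive v (delta_mx 0 j) (fun u => leaf_shrink s u 0 i)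
    ((s *: delta_mx 0 j : 'rV[R]_n) 0 i) /\ differentiable (fun u => leaf_shrink s u 0 i) v.
  rewrite (_ : (fun u => _) = (fun u : 'rV[R]_n => if a i then o 0 i + s * (u 0 i - o 0 i) else u 0 i)).
    have dv := is_derive_coord i v (delta_mx 0 j).
    have dd : differentiable (fun u : 'rV[R]_n => u 0 i : R) v by exact: differentiable_coord.
    have de : (delta_mx 0 j : 'rV[R]_n) 0 i = (i == j)%:R by rewrite mxE.
    rewrite mxE de; rewrite de in dv; case ai: (a i); last first.
      have nij : (i == j) = false by apply/negP => /eqP ij; rewrite ij aj in ai.
      by rewrite nij mulr0; rewrite nij in dv.
    split.
      have d1 := @is_deriveD _ _ _ (cst (o 0 i)) _ v _ _ _ (is_derive_cst _ _ _)
        (@is_deriveZ _ _ _ _ s v _ _ (@is_deriveB _ _ _ _ (cst (o 0 i)) v _ _ _ dv (is_derive_cst _ _ _))).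
      by apply: is_derive_eq; rewrite subr0 add0r.
    apply: (@differentiableD _ _ _ (cst (o 0 i))) => //.
    by apply: differentiableZ; apply: differentiableB.
  by apply/funext => u; rewrite leaf_shrinkE.
have dS : differentiable (leaf_shrink s) v by apply: differentiable_row => i; have [] := dc i.
split => //; rewrite derive_row //; apply/rowP => i; rewrite mxE.
by have [[_ ->] _] := dc i.
Qed.

(** The primitive is the integral of the 1-form along the ray from the centre of the leaf.
By closedness the derivative of the integrand in the direction [j] is the derivative of
[s theta_j] along the ray, so the fundamental theorem of calculus applies; the formula also
shows that the primitive is smooth transversally to the leaves. *)
Theorem leafwise_poincare : exists x : 'rV[R]_n -> R, smooth_rV (ball o r) x /\
  forall i v, a i -> ball o r v -> 'D_(delta_mx 0 i) x v = theta i v.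
Proof.
(* The parameter s of the ray is the first coordinate of the integrand, so that smoothness
   of F in all its variables can be expressed. *)
pose S (w : 'rV[R]_(1 + n)) : 'rV[R]_n := leaf_shrink (w 0 (lshift n 0)) (rsubmx w).
have sS E j : smooth_rV E (fun w => S w 0 j).
  apply: (@smooth_sub _ _ _ setT) => //.
  apply: (@smooth_ext _ _ _ openT (fun w => if a j
     then o 0 j + w 0 (lshift n 0) * (w 0 (rshift 1 j) - o 0 j) else w 0 (rshift 1 j))).
    by move=> w _; rewrite /S leaf_shrinkE !mxE.
  case: (a j); last exact: smooth_coord.
  apply: (smoothD openT); first exact: smooth_cst.
  apply: (smoothM openT); first exact: smooth_coord.
  by apply: (smoothB openT); [exact: smooth_coord|exact: smooth_cst].
have cS : continuous S.
  move=> w; apply: continuous_row => j.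
  exact: (@smooth_continuous _ _ setT _ _ (sS setT j) I).
pose O := S @^-1` ball o r.
have oO : open O by apply: open_comp => //; exact: ball_open.
have Sslice s v : S (slice s v) = leaf_shrink s v.
  by rewrite /S /slice row_mxKr row_mxEl mxE.
have DO (s : R) v : s \in `[0, 1] -> ball o r v -> O (slice s v).
  by move=> s01 vb; rewrite /O /= Sslice; exact: leaf_shrink_ball.
pose F (w : 'rV[R]_(1 + n)) : R := \sum_(i | a i) (w 0 (rshift 1 i) - o 0 i) * theta i (S w).
have Fslice s v : F (slice s v) = \sum_(i | a i) (v 0 i - o 0 i) * theta i (leaf_shrink s v).
  by apply: eq_bigr => i _; rewrite Sslice /slice row_mxEr.
have sF : smooth_rV O F.
  apply: smooth_sum => // i ai; apply: smoothM => //.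
    by apply: smoothB => //; [exact: smooth_coord|exact: smooth_cst].
  by apply: (@smooth_comp _ _ _ O (ball o r) S (theta i)) => //; [exact: ball_open|exact: stheta].
exists (fun v => int01 (fun s => F (slice s v))); split.
  exact: (int01_slice_smooth (@ball_open _ _ o r) DO sF).
move=> j v aj vb.
have [_ ->] := int01_slice_differentiable (@ball_open _ _ o r) DO (sF 1%N) vb.
have dtheta i u : a i -> ball o r u -> differentiable (theta i) u.
  by move=> ai ub; exact: (smooth_differentiable (stheta ai)).
pose h := leaf_part (v - o).
pose g s := theta j (leaf_shrink s v) + s * \sum_(i | a i) (v 0 i - o 0 i) *
   'D_(delta_mx 0 i) (theta j) (leaf_shrink s v).
have E1 s : s \in `[0, 1] -> 'D_(delta_mx 0 j) (fun u => F (slice s u)) v = g s.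
  move=> s01; have sb := leaf_shrink_ball s01 vb.
  have -> : (fun u => F (slice s u)) = \sum_(i < n) (fun u : 'rV[R]_n => if a i then
      (u 0 i - o 0 i) * theta i (leaf_shrink s u) else 0).
    by apply/funext => u; rewrite Fslice fct_sumE big_mkcond.
  have [dsh Dsh] := leaf_shrink_derive s v aj.
  have dti i : a i -> is_derive v (delta_mx 0 j)
      (fun u : 'rV[R]_n => (u 0 i - o 0 i) * theta i (leaf_shrink s u))
      ((i == j)%:R * theta j (leaf_shrink s v) + s * ((v 0 i - o 0 i) *
   'D_(delta_mx 0 i) (theta j) (leaf_shrink s v))).
    move=> ai.
    have d1 : is_derive v (delta_mx 0 j) (fun u : 'rV[R]_n => u 0 i - o 0 i) (i == j)%:R.
      have := @is_deriveB _ _ _ _ (cst (o 0 i)) v _ _ _ (is_derive_coord i v (delta_mx 0 j)) (is_derive_cst _ _ _).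
      by move=> /is_derive_eq; apply; rewrite subr0 mxE.
    have dth := dtheta _ _ ai sb.
    have d2 : is_derive v (delta_mx 0 j) (fun u => theta i (leaf_shrink s u))
        (s * 'D_(delta_mx 0 i) (theta j) (leaf_shrink s v)).
      apply: DeriveDef; first by apply: diff_derivable; exact: differentiable_comp.
      rewrite (@derive_comp _ _ _ _ (leaf_shrink s) (theta i)) // Dsh deriveE // linearZ -deriveE //.
      by rewrite closed_theta.
    have := is_deriveM d1 d2; move=> /is_derive_eq; apply.
    by rewrite /GRing.scale /= addrC [theta i _ * _]mulrC mulrCA; case: eqVneq => [->|]; rewrite ?mul0r.
  have dif i : is_derive v (delta_mx 0 j)
      (fun u : 'rV[R]_n => if a i then (u 0 i - o 0 i) * theta i (leaf_shrink s u) else 0)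
      (if a i then (i == j)%:R * theta j (leaf_shrink s v) + s * ((v 0 i - o 0 i) *
        'D_(delta_mx 0 i) (theta j) (leaf_shrink s v)) else 0).
    by case: (boolP (a i)) => [/dti|_] //; exact: is_derive_cst.
  rewrite derive_sum; last by move=> i; have [] := dif i.
  rewrite (eq_bigr _ (fun i _ => @derive_val _ _ _ _ _ _ _ (dif i))) -big_mkcond big_split /=.
  rewrite /g mulr_sumr; congr (_ + _).
  rewrite (bigD1 j) //= eqxx mul1r big1 ?addr0 // => i /andP [_ /negbTE ->].
  by rewrite mul0r.
rewrite (eq_int01 E1).
have dg (s : R) : s \in `[0, 1] -> is_derive s 1 (fun s => s * theta j (leaf_shrink s v)) (g s).
  move=> s01; have sb := leaf_shrink_ball s01 vb.
  have dl : is_derive s 1 (fun s => theta j (leaf_shrink s v))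
     (\sum_(i | a i) (v 0 i - o 0 i) * 'D_(delta_mx 0 i) (theta j) (leaf_shrink s v)).
    apply: is_derive_line; apply: DeriveDef; first by apply: diff_derivable; exact: dtheta.
    rewrite derive_dir_sum; last exact: dtheta.
    rewrite [RHS]big_mkcond; apply: eq_bigr => i _.
    by rewrite !mxE; case: (a i); rewrite ?scale0r.
  apply: is_derive_eq.
  by rewrite /g /GRing.scale /= mulr1 addrC.
have cphi phi : smooth_rV (ball o r) phi -> continuous01 (fun s => phi (leaf_shrink s v)).
  move=> sphi s s01; apply: (@continuous_comp _ _ _ (leaf_shrink^~ v) phi); last first.
    exact: smooth_continuous sphi (leaf_shrink_ball s01 vb).
  apply: continuous_row => i.
  rewrite (_ : (fun y => _) = (fun y : R => if a i then o 0 i + y * (v 0 i - o 0 i) else v 0 i)).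
    case: (a i); last exact: cst_continuous.
    apply: continuousD; first exact: cst_continuous.
    by apply: continuousM; [exact: cvg_id|exact: cst_continuous].
  by apply/funext => y; rewrite leaf_shrinkE.
have cg : continuous01 g.
  apply: continuous01D; first exact/cphi/stheta.
  move=> s s01; apply: continuousM; first exact: cvg_id.
  have [|c _] := @int01_sum _ _ (fun i s => if a i then (v 0 i - o 0 i) *
     'D_(delta_mx 0 i) (theta j) (leaf_shrink s v) else 0); last first.
    rewrite (_ : (fun s => _) = (fun s => \sum_(i < n) (if a i then (v 0 i - o 0 i) *
     'D_(delta_mx 0 i) (theta j) (leaf_shrink s v) else 0))); first exact: c.
    by apply/funext => t; rewrite big_mkcond.
  move=> i; case: (a i); last by move=> t _; exact: cst_continuous.
  exact: continuous01Z (cphi _ (smooth_partial i (stheta aj))).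
by rewrite (int01_FTC cg dg) mul1r mul0r subr0 leaf_shrink1.
Qed.

End LeafwisePoincare.

(** * Smooth functions on a manifold *)

Section Charts.
Context {R : realType} {n : nat} {M : manifold R n}.
Implicit Types (c d : chart R n M) (U V : set M) (f g : M -> R).

Lemma chart_paramK c x : (chart_coord c @` chart_dom c) x -> chart_coord c (chart_param c x) = x.
Proof. by move=> [p cp <-]; rewrite chart_coordK. Qed.

Lemma chart_param_dom c V x : (chart_coord c @` (chart_dom c `&` V)) x ->
  (chart_dom c `&` V) (chart_param c x).
Proof. by move=> [p [cp Vp] <-]; rewrite chart_coordK. Qed.

Lemma chart_image_open c V : open V -> open (chart_coord c @` (chart_dom c `&` V)).
Proof.
move=> oV; rewrite openE => _ [p [cp Vp] <-].
have pV : nbhs (chart_param c (chart_coord c p)) V.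
  by rewrite chart_coordK //; apply: open_nbhs_nbhs.
have nV := chart_param_continuous cp pV.
have nD : nbhs (chart_coord c p) (chart_coord c @` chart_dom c).
  by apply: open_nbhs_nbhs; split; [exact: chart_coord_open|exists p].
apply: filterS2 nD nV => x [q cq <-] /= Vq; rewrite chart_coordK // in Vq.
by exists q.
Qed.

Arguments chart_image_open c [V] oV.

Lemma atlas_smooth c : atlas c -> smooth_chart c.
Proof. by move=> ac d ad; exact: atlas_compatible. Qed.

Lemma chart_at_smooth (p : M) : smooth_chart (chart_at p).
Proof. exact/atlas_smooth/chart_at_atlas. Qed.

Lemma smooth_on_param c V f : smooth_chart c -> open V -> smooth_on V f ->
  smooth_rV (chart_coord c @` (chart_dom c `&` V)) (f \o chart_param c).
Proof.
move=> sc oV sf k; apply: Ck_pointwise => _ [p [cp Vp] <-].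
set d := chart_at p; have dp : chart_dom d p by exact: chart_at_dom.
have odV : open (chart_dom d `&` V) by apply: openI => //; exact: chart_dom_open.
exists (chart_coord c @` (chart_dom c `&` (chart_dom d `&` V))); first by exists p.
have oc := chart_image_open c odV.
apply: (@Ck_ext _ _ _ _ ((f \o chart_param d) \o (fun x => chart_coord d (chart_param c x)))) => //.
  by move=> _ [q [cq [dq Vq]] <-] /=; rewrite (chart_coordK cq) chart_coordK.
apply: (@Ck_comp _ _ _ _ _ (chart_coord d @` (chart_dom d `&` V))) => //.
- exact: chart_image_open.
- by move=> _ [q [cq dVq] <-]; rewrite chart_coordK //; exists q.
- move=> j; have [/(_ j k) + _] := sc d (chart_at_atlas p); apply: Ck_sub.
  by move=> _ [q [cq [dq _]] <-]; exists q.
exact: sf d (chart_at_atlas p) k.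
Qed.

(** Transition maps are smooth, so one chart containing [V] suffices. *)
Lemma smooth_on_chart c V f : smooth_chart c -> open V -> V `<=` chart_dom c ->
  smooth_rV (chart_coord c @` V) (f \o chart_param c) -> smooth_on V f.
Proof.
move=> sc oV Vc sf d ad.
have od := chart_image_open d oV.
apply: (@smooth_ext _ _ _ od ((f \o chart_param c) \o (fun x => chart_coord c (chart_param d x)))).
  move=> _ [q [dq Vq] <-] /=; rewrite (chart_coordK dq) chart_coordK //; exact: Vc.
apply: (@smooth_comp _ _ _ _ (chart_coord c @` V)) => //.
- by rewrite -(setIidr Vc); exact: chart_image_open.
- by move=> _ [q [dq Vq] <-]; rewrite chart_coordK //; exists q.
move=> j; have [_ /(_ j)] := sc d ad; apply: smooth_sub.
by move=> _ [q [dq Vq] <-]; exists q => //; split => //; exact: Vc.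
Qed.

Lemma smooth_on_sub U V f : V `<=` U -> smooth_on U f -> smooth_on V f.
Proof.
move=> VU sf c ac; apply: smooth_sub (sf c ac).
by move=> _ [q [cq Vq] <-]; exists q => //; split => //; exact: VU.
Qed.

Section Closure.
Variable U : set M.
Hypothesis oU : open U.

Lemma smooth_on_ext f g : (forall p, U p -> f p = g p) -> smooth_on U f -> smooth_on U g.
Proof.
move=> fg sf c ac; apply: smooth_ext (sf c ac); first exact: chart_image_open.
by move=> _ [q [cq Uq] <-] /=; rewrite chart_coordK // fg.
Qed.

Lemma smooth_on_cst a : smooth_on U (cst a).
Proof. by move=> c ac; exact: smooth_cst. Qed.

Lemma smooth_onD f g : smooth_on U f -> smooth_on U g -> smooth_on U (fun p => f p + g p).
Proof.
by move=> sf sg c ac; apply: (smoothD (chart_image_open c oU)); [exact: sf|exact: sg].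
Qed.

Lemma smooth_onM f g : smooth_on U f -> smooth_on U g -> smooth_on U (fun p => f p * g p).
Proof.
by move=> sf sg c ac; apply: (smoothM (chart_image_open c oU)); [exact: sf|exact: sg].
Qed.

Lemma smooth_onN f : smooth_on U f -> smooth_on U (fun p => - f p).
Proof. by move=> sf c ac; apply: (smoothN (chart_image_open c oU)); exact: sf. Qed.

Lemma smooth_onB f g : smooth_on U f -> smooth_on U g -> smooth_on U (fun p => f p - g p).
Proof. by move=> sf sg; apply: smooth_onD => //; exact: smooth_onN. Qed.

Lemma smooth_onV f : (forall p, U p -> f p != 0) -> smooth_on U f ->
  smooth_on U (fun p => (f p)^-1).
Proof.
move=> f0 sf c ac.
apply: (@smoothV _ _ _ (chart_image_open c oU) (f \o chart_param c)); last exact: sf.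
by move=> x /chart_param_dom [_ /f0].
Qed.

Lemma smooth_on_sqrt f : (forall p, U p -> 0 < f p) -> smooth_on U f ->
  smooth_on U (fun p => Num.sqrt (f p)).
Proof.
move=> f0 sf c ac.
apply: (@smooth_sqrt _ _ _ (chart_image_open c oU) (f \o chart_param c)); last exact: sf.
by move=> x /chart_param_dom [_ /f0].
Qed.

Lemma smooth_on_sum (I : Type) (r : seq I) (P : pred I) (F : I -> M -> R) :
  (forall i, P i -> smooth_on U (F i)) -> smooth_on U (fun x => \sum_(i <- r | P i) F i x).
Proof.
move=> sF c ac; apply: (@smooth_sum _ _ _ (chart_image_open c oU) _ _ _ (fun i => F i \o chart_param c)).
by move=> i Pi; exact: sF.
Qed.

Lemma smooth_on_continuous f p : smooth_on U f -> U p -> {for p, continuous f}.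
Proof.
move=> sf Up; set c := chart_at p.
have cp : chart_dom c p by exact: chart_at_dom.
have ocU : open (chart_dom c `&` U) by apply: openI => //; exact: chart_dom_open.
have cf : {for p, continuous ((f \o chart_param c) \o chart_coord c)}.
  apply: continuous_comp; first exact: chart_coord_continuous.
  by apply: (smooth_continuous (sf c (chart_at_atlas p))); exists p.
apply: near_eq_continuous cf; apply: (open_near_eq ocU) => // q [cq _].
by rewrite /= chart_coordK.
Qed.

Lemma smooth_on_gt0_open f : smooth_on U f -> open (U `&` [set p | 0 < f p]).
Proof.
move=> sf; rewrite openE => p [Up fp].
have nU : \forall q \near p, U q by apply: open_nbhs_nbhs.
have cf := smooth_on_continuous sf Up.
have nf : \forall q \near p, 0 < f q by apply: (cvgr_gt (f p)).
exact: filterI nU nf.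
Qed.

End Closure.
End Charts.

(** * Tangent vectors, vector fields and the bracket *)

Section Derivations.
Context {R : realType} {n : nat} {M : manifold R n}.
Implicit Types (c d : chart R n M) (U V : set M) (f g : M -> R) (X Y : vfield M) (p q : M).

Lemma smooth_on_differentiable c V f p : smooth_chart c -> open V -> smooth_on V f ->
  chart_dom c p -> V p -> differentiable (f \o chart_param c) (chart_coord c p).
Proof.
move=> sc oV sf cp Vp; apply: (smooth_differentiable (smooth_on_param sc oV sf)).
by exists p.
Qed.

Lemma near_chart c V p : open V -> chart_dom c p -> V p ->
  \forall x \near chart_coord c p, (chart_coord c @` (chart_dom c `&` V)) x.
Proof.
move=> oV cp Vp; apply: open_nbhs_nbhs; split; first exact: chart_image_open.
by exists p.
Qed.

Lemma dfun_near U f g p (v : tangent p) : open U -> U p -> (forall q, U q -> f q = g q) ->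
  dfun f v = dfun g v.
Proof.
move=> oU Up fg; apply: near_eq_derive.
have := near_chart oU (chart_at_dom p) Up; apply: filterS => x /chart_param_dom [_ Ux].
exact: fg.
Qed.

Section AtPoint.
Variables (U : set M) (p : M).
Hypotheses (oU : open U) (Up : U p).

Let dif f : smooth_on U f -> differentiable (f \o chart_param (chart_at p)) (chart_coord (chart_at p) p).
Proof.
move=> sf; apply: (smooth_on_differentiable _ oU) => //; last exact: chart_at_dom.
exact: chart_at_smooth.
Qed.

Lemma dfunD f (u v : tangent p) : smooth_on U f ->
  dfun f (u + v : tangent p) = dfun f u + dfun f v.
Proof. by move=> /dif df; rewrite /dfun !deriveE // linearD. Qed.

Lemma dfunZ f (a : R) (u : tangent p) : smooth_on U f ->
  dfun f (a *: u : tangent p) = a * dfun f u.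
Proof. by move=> /dif df; rewrite /dfun !deriveE // linearZ. Qed.

Lemma dfunN f (u : tangent p) : smooth_on U f ->
  dfun f (- u : tangent p) = - dfun f u.
Proof. by move=> /dif df; rewrite /dfun !deriveE // linearN. Qed.

Lemma dfun_cst a (v : tangent p) : dfun (cst a : M -> R) v = 0.
Proof. exact: derive_cst. Qed.

Lemma dfun_addf f g (v : tangent p) : smooth_on U f -> smooth_on U g ->
  dfun (fun q => f q + g q) v = dfun f v + dfun g v.
Proof. by move=> /dif df /dif dg; apply: deriveD; exact: diff_derivable. Qed.

Lemma dfun_subf f g (v : tangent p) : smooth_on U f -> smooth_on U g ->
  dfun (fun q => f q - g q) v = dfun f v - dfun g v.
Proof. by move=> /dif df /dif dg; apply: deriveB; exact: diff_derivable. Qed.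

Lemma dfun_oppf f (v : tangent p) : smooth_on U f ->
  dfun (fun q => - f q) v = - dfun f v.
Proof. by move=> /dif df; apply: deriveN; exact: diff_derivable. Qed.

Lemma dfun_mulf f g (v : tangent p) : smooth_on U f -> smooth_on U g ->
  dfun (fun q => f q * g q) v = f p * dfun g v + g p * dfun f v.
Proof.
move=> /dif df /dif dg.
rewrite [LHS]deriveM; [|exact: diff_derivable..].
by rewrite /= chart_coordK //; exact: chart_at_dom.
Qed.

Lemma dfun_sumf (I : finType) (F : I -> M -> R) (v : tangent p) :
  (forall i, smooth_on U (F i)) ->
  dfun (fun q => \sum_i F i q) v = \sum_i dfun (F i) v.
Proof.
move=> sF; elim: (index_enum I) => [|i r IH].
  rewrite big_nil -[RHS](dfun_cst 0 v); apply: (dfun_near _ oU Up) => q _.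
  by rewrite big_nil.
rewrite big_cons -IH -dfun_addf //; last exact: smooth_on_sum.
by apply: (dfun_near _ oU Up) => q _; rewrite big_cons.
Qed.

Lemma smooth_on_coord c i : smooth_chart c -> smooth_on (chart_dom c) (fun q => chart_coord c q 0 i).
Proof.
move=> sc; apply: (smooth_on_chart sc) => //; first exact: chart_dom_open.
apply: (@smooth_ext _ _ _ _ (fun x => x 0 i)).
- exact: chart_coord_open.
- by move=> x /chart_paramK /= ->.
- exact: smooth_coord.
Qed.

(** The chain rule for the change from the preferred chart at [p], in which tangent
vectors have their components, to the chart [c]. *)
Lemma dfun_chart c f (v : tangent p) : smooth_chart c -> chart_dom c p -> smooth_on U f ->
  dfun f v = \sum_i dfun (fun q => chart_coord c q 0 i) v *
     'D_(delta_mx 0 i) (f \o chart_param c) (chart_coord c p).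
Proof.
move=> sc cp sf; set d := chart_at p.
have dp : chart_dom d p by exact: chart_at_dom.
pose T x := chart_coord c (chart_param d x).
have dT : differentiable T (chart_coord d p).
  apply: differentiable_row => j.
  apply: (@smooth_on_differentiable (chart_at p) (chart_dom c) (fun q => chart_coord c q 0 j) p) => //.
  - exact: chart_at_smooth.
  - exact: chart_dom_open.
  - exact: smooth_on_coord.
have Tp : T (chart_coord d p) = chart_coord c p by rewrite /T chart_coordK.
have dfT : differentiable (f \o chart_param c) (T (chart_coord d p)).
  by rewrite Tp; exact: smooth_on_differentiable sc oU sf cp Up.
have := derive_comp_sum v dT dfT; rewrite Tp => <-.
apply: near_eq_derive.
have := near_chart (chart_dom_open c) dp cp; apply: filterS => x /chart_param_dom [dx cx].
by rewrite /T /= chart_coordK.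
Qed.

End AtPoint.

Lemma dfun_chart_at p (v : tangent p) i :
  dfun (fun q => chart_coord (chart_at p) q 0 i) v = (v : 'rV[R]_n) 0 i.
Proof.
rewrite -(derive_coord i (chart_coord (chart_at p) p)); apply: near_eq_derive.
have := near_chart openT (chart_at_dom p) I; apply: filterS => x [q [cq _] <-].
by rewrite /= chart_coordK.
Qed.

Lemma dfun0 f p : dfun f (0 : tangent p) = 0.
Proof. exact: derive0. Qed.

Lemma coord_vf_differentiable c p : smooth_chart c -> chart_dom c p ->
  differentiable (chart_coord (chart_at p) \o chart_param c) (chart_coord c p).
Proof.
move=> sc cp; apply: differentiable_row => j.
apply: (@smooth_on_differentiable c (chart_dom (chart_at p))
    (fun q => chart_coord (chart_at p) q 0 j) p) => //.
- exact: chart_dom_open.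
- by apply: smooth_on_coord; exact: chart_at_smooth.
- exact: chart_at_dom.
Qed.

(** Both sides have the same derivatives of the coordinate functions of the preferred
chart at [p], by the chain rule. *)
Lemma tangent_coord_vf c p (v : tangent p) : smooth_chart c -> chart_dom c p ->
  v = \sum_i dfun (fun q => chart_coord c q 0 i) v *: coord_vf c i p.
Proof.
move=> sc cp; apply/rowP => j.
rewrite -dfun_chart_at.
rewrite (dfun_chart (chart_dom_open (chart_at p)) (chart_at_dom p) v sc cp); last first.
  by apply: smooth_on_coord; exact: chart_at_smooth.
rewrite [RHS]summxE; apply: eq_bigr => i _; rewrite [RHS]mxE /coord_vf.
by rewrite derive_row ?mxE //; exact: coord_vf_differentiable.
Qed.

Lemma dfun_coord_vf c U f p i : smooth_chart c -> open U -> smooth_on U f -> chart_dom c p -> U p ->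
  dfun f (coord_vf c i p) = 'D_(delta_mx 0 i) (f \o chart_param c) (chart_coord c p).
Proof.
move=> sc oU sf cp Up; set d := chart_at p.
have dp : chart_dom d p by exact: chart_at_dom.
have dT := coord_vf_differentiable sc cp.
have dfd : differentiable (f \o chart_param d) ((chart_coord d \o chart_param c) (chart_coord c p)).
  rewrite /= chart_coordK //.
  exact: (smooth_on_differentiable (chart_at_smooth p) oU).
have := derive_comp (delta_mx 0 i) dT dfd; rewrite /= chart_coordK // /dfun /coord_vf => <-.
apply: near_eq_derive.
have := near_chart (chart_dom_open d) cp dp; apply: filterS => x /chart_param_dom [cx dx].
by rewrite /= chart_coordK.
Qed.

Lemma coord_vf_smooth c i : smooth_chart c -> smooth_vf (chart_dom c) (coord_vf c i).
Proof.
move=> sc V f oV Vc sf.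
apply: (smooth_on_chart sc) => //.
have oc : open (chart_coord c @` V) by rewrite -(setIidr Vc); exact: chart_image_open.
apply: (@smooth_ext _ _ _ oc ('D_(delta_mx 0 i) (f \o chart_param c))).
  move=> _ [q Vq <-]; have cq := Vc _ Vq.
  by rewrite /= chart_coordK // /act (dfun_coord_vf i sc oV sf).
by apply: smooth_partial; rewrite -(setIidr Vc); exact: smooth_on_param.
Qed.

Lemma tangent_eq p (u v : tangent p) :
  (forall i, dfun (fun q => chart_coord (chart_at p) q 0 i) u
           = dfun (fun q => chart_coord (chart_at p) q 0 i) v) -> u = v.
Proof. by move=> H; apply/rowP => i; have := H i; rewrite !dfun_chart_at. Qed.

Section VectorFieldClosure.
Variable U : set M.
Hypothesis oU : open U.

Lemma smooth_vf_sub V X : V `<=` U -> smooth_vf U X -> smooth_vf V X.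
Proof. by move=> VU sX W f oW WV; apply: sX => // q /WV/VU. Qed.

Lemma smooth_vf_ext X Y : (forall q, U q -> X q = Y q) -> smooth_vf U X -> smooth_vf U Y.
Proof.
move=> XY sX V f oV VU sf; apply: (smooth_on_ext oV _ (sX V f oV VU sf)) => q Vq.
by rewrite /act XY //; exact: VU.
Qed.

Lemma smooth_vfD X Y : smooth_vf U X -> smooth_vf U Y -> smooth_vf U (fun q => X q + Y q).
Proof.
move=> sX sY V f oV VU sf.
apply: (smooth_on_ext oV _ (smooth_onD oV (sX V f oV VU sf) (sY V f oV VU sf))) => q Vq.
by rewrite [RHS](dfunD oV).
Qed.

Lemma smooth_vfZ X g : smooth_on U g -> smooth_vf U X -> smooth_vf U (fun q => g q *: X q).
Proof.
move=> sg sX V f oV VU sf.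
have sgV := smooth_on_sub VU sg.
apply: (smooth_on_ext oV _ (smooth_onM oV sgV (sX V f oV VU sf))) => q Vq.
by rewrite [RHS](dfunZ oV).
Qed.

Lemma smooth_vfN X : smooth_vf U X -> smooth_vf U (fun q => - X q).
Proof.
move=> sX V f oV VU sf.
apply: (smooth_on_ext oV _ (smooth_onN oV (sX V f oV VU sf))) => q Vq.
by rewrite [RHS](dfunN oV).
Qed.

Lemma smooth_vfB X Y : smooth_vf U X -> smooth_vf U Y -> smooth_vf U (fun q => X q - Y q).
Proof. by move=> sX sY; apply: smooth_vfD => //; exact: smooth_vfN. Qed.

(** The bracket is defined by its action on coordinate functions only. For a general [f],
expand along the coordinates: the terms with second derivatives of [f] cancel by symmetry. *)
Lemma act_lie X Y f p : smooth_vf U X -> smooth_vf U Y -> smooth_on U f -> U p ->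
  act (lie X Y) f p = act X (act Y f) p - act Y (act X f) p.
Proof.
move=> sX sY sf Up; set c := chart_at p.
have sc : smooth_chart c by exact: chart_at_smooth.
have cp : chart_dom c p by exact: chart_at_dom.
pose V := U `&` chart_dom c; have oV : open V by apply: openI => //; exact: chart_dom_open.
have Vp : V p by [].
have VU : V `<=` U by move=> q [].
have sfV := smooth_on_sub VU sf.
pose x i := fun q => chart_coord c q 0 i : R.
have sx i : smooth_on V (x i).
  by apply: (smooth_on_sub _ (smooth_on_coord i sc)) => q [].
pose pf j := 'D_(delta_mx 0 j) (f \o chart_param c).
have sfc := smooth_on_param sc oV sfV.
have oc : open (chart_coord c @` (chart_dom c `&` V)) by exact: chart_image_open.
pose F j := pf j \o chart_coord c.
have sF j : smooth_on V (F j).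
  apply: (smooth_on_chart sc oV) => [q []//|].
  rewrite -[chart_coord c @` V]/(chart_coord c @` V).
  have VE : chart_dom c `&` V = V by apply/setIidr => q [].
  rewrite VE in sfc oc; apply: (@smooth_ext _ _ _ oc (pf j)); last exact: smooth_partial.
  by move=> _ [q [Uq cq] <-]; rewrite /F /= chart_coordK.
have sXV := smooth_vf_sub VU sX; have sYV := smooth_vf_sub VU sY.
have actE Z : smooth_vf V Z -> forall q, V q -> act Z f q = \sum_j act Z (x j) q * F j q.
  by move=> sZ q Vq; rewrite /act (dfun_chart oV Vq _ sc) //; case: Vq.
have sa Z j : smooth_vf V Z -> smooth_on V (act Z (x j)) by move=> sZ; exact: sZ.
have act2 Z W : smooth_vf V Z -> smooth_vf V W -> act Z (act W f) p =
    \sum_j act Z (act W (x j)) p * pf j (chart_coord c p) +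
    \sum_j \sum_i act W (x j) p * act Z (x i) p *
       'D_(delta_mx 0 i) (pf j) (chart_coord c p).
  move=> sZ sW.
  rewrite {1}/act (dfun_near _ oV Vp (actE W sW)).
  rewrite (dfun_sumf oV Vp) => [|j]; last by apply: smooth_onM => //; exact: sa.
  rewrite -big_split /=; apply: eq_bigr => j _.
  rewrite (dfun_mulf oV Vp _ (sa _ _ sW) (sF j)) addrC [F j p * _]mulrC; congr (_ + _).
  rewrite (dfun_chart oV Vp _ sc cp (sF j)) mulr_sumr; apply: eq_bigr => i _.
  rewrite mulrA; congr (_ * _); apply: near_eq_derive.
  have := near_chart oV cp Vp; apply: filterS => y [q [cq _] <-].
  by rewrite /F /= chart_coordK.
rewrite (act2 X Y) // (act2 Y X) // opprD addrACA -sumrB.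
rewrite [X in _ + (X - _)]exchange_big /= -sumrB [X in _ + X]big1 ?addr0; last first.
  move=> i _; rewrite -sumrB big1 // => j _.
  have -> : 'D_(delta_mx 0 i) (pf j) (chart_coord c p) = 'D_(delta_mx 0 j) (pf i) (chart_coord c p).
    have ip : (chart_coord c @` (chart_dom c `&` V)) (chart_coord c p) by exists p.
    exact: (@partialC _ _ _ (f \o chart_param c) _ j i oc (sfc 2%N) ip).
  by rewrite [act Y (x j) p * _]mulrC subrr.
rewrite /act (dfun_chart oU Up _ sc cp sf); apply: eq_bigr => j _.
by rewrite dfun_chart_at mxE mulrBl.
Qed.

End VectorFieldClosure.
End Derivations.

(** * Charts from independent functions *)

Section ChartOfFunctions.
Context {R : realType} {n : nat} {M : manifold R n}.

(** The inverse function theorem for the functions read in the chart at [p]. The domain is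
cut down so that the image is a ball, which makes the leaves of the chart connected. *)
Lemma chart_of_functions (p : M) (U : set M) (F : 'I_n -> M -> R) (T : 'I_n -> tangent p) :
  open U -> U p -> (forall i, smooth_on U (F i)) ->
  (\matrix_(i, j) dfun (F j) (T i) \in unitmx) ->
  exists2 c : chart R n M, [/\ smooth_chart c, chart_dom c p & chart_dom c `<=` U] &
    (forall q, chart_coord c q = \row_j F j q) /\
    exists2 r, 0 < r & chart_coord c @` chart_dom c = ball (\row_j F j p) r.
Proof.
move=> oU Up sF uT; set c0 := chart_at p.
have c0p : chart_dom c0 p by exact: chart_at_dom.
have sc0 : smooth_chart c0 by exact: chart_at_smooth.
pose D := chart_coord c0 @` (chart_dom c0 `&` U).
have oD : open D by exact: chart_image_open.
pose C q : 'rV[R]_n := \row_j F j q.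
pose G x := C (chart_param c0 x).
have Dp : D (chart_coord c0 p) by exists p.
have sG j : smooth_rV D (fun x => G x 0 j).
  by apply: (smooth_ext oD _ (smooth_on_param sc0 oU (sF j))) => x _; rewrite mxE.
have JG : jac G (chart_coord c0 p) \in unitmx.
  have : (\matrix_i (T i : 'rV[R]_n)) *m jac G (chart_coord c0 p) \in unitmx.
    have dG : differentiable G (chart_coord c0 p).
      by apply: differentiable_row => j; exact: smooth_differentiable (sG j) Dp.
    congr (_ \in unitmx): uT; apply/row_matrixP => i; rewrite row_mul rowK -derive_jac //.
    rewrite derive_row //; apply/rowP => j; rewrite !mxE /dfun; congr ('D_ _ _ _).
    by apply/funext => x; rewrite mxE.
  by rewrite unitmx_mul => /andP [].
have [W [H [[oW Wp WD oGW] HG sH]]] := inverse_function oD Dp sG JG.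
have GE q : chart_dom c0 q -> G (chart_coord c0 q) = C q by move=> cq; rewrite /G chart_coordK.
have : nbhs (G (chart_coord c0 p)) (G @` W) by apply: open_nbhs_nbhs; split => //; exists (chart_coord c0 p).
rewrite GE //; move=> /nbhs_ballP [r /= r0 rGW].
pose V := chart_dom c0 `&` [set q | W (chart_coord c0 q) /\ ball (C p) r (C q)].
have VU : V `<=` U.
  move=> q [cq [Wq _]]; have [q' [cq' Uq'] E] := WD _ Wq.
  by rewrite -(chart_coordK cq) -E chart_coordK.
have cC q : U q -> {for q, continuous C}.
  move=> Uq; apply: continuous_row => j.
  have := smooth_on_continuous oU (sF j) Uq.
  by rewrite (_ : (fun y => C y 0 j) = F j) //; apply/funext => y; rewrite mxE.
have oV : open V.
  rewrite openE => q Vq; have [cq [Wq bq]] := Vq.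
  have n1 : \forall q' \near q, chart_dom c0 q' by apply: open_nbhs_nbhs; split => //; exact: chart_dom_open.
  have n2 : \forall q' \near q, W (chart_coord c0 q').
    by apply: (chart_coord_continuous cq); exact: open_nbhs_nbhs.
  have n3 : \forall q' \near q, ball (C p) r (C q').
    by apply: (cC q (VU _ Vq)); apply: open_nbhs_nbhs; split => //; exact: ball_open.
  exact: filterI n1 (filterI n2 n3).
have imV : C @` V = ball (C p) r.
  apply/seteqP; split => [_ [q [_ [_ bq]] <-] //|y yb].
  have [w Ww wy] := rGW _ yb; have [q [cq Uq] qw] := WD _ Ww.
  have Cq : C q = y by rewrite -wy -qw GE.
  by exists q => //; split => //; split; rewrite ?qw ?Cq.
have paramK q : V q -> chart_param c0 (H (C q)) = q.
  by move=> [cq [Wq _]]; rewrite -GE // HG // chart_coordK.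
have GWV q : V q -> (G @` W) (C q).
  by move=> [cq [Wq _]]; exists (chart_coord c0 q) => //; rewrite GE.
have cparam q : V q -> {for C q, continuous (chart_param c0 \o H)}.
  move=> Vq; apply: continuous_comp.
    apply: continuous_row => j.
    exact: smooth_continuous (sH j) (GWV _ Vq).
  have [cq [Wq _]] := Vq; rewrite -GE // HG //.
  exact: chart_param_continuous.
have oimV : open (C @` V) by rewrite imV; exact: ball_open.
pose c := @Chart R n M V C (chart_param c0 \o H) oV oimV paramK (fun q Vq => cC q (VU q Vq)) cparam.
exists c; last by split => //; exists r.
split => //; last by split => //; split => //; exact: ballxx.
move=> d ad; split => i.
  have ocd : open (C @` (V `&` chart_dom d)).
    by apply: (@chart_image_open _ _ _ c); exact: chart_dom_open.
  apply: (@smooth_comp _ _ _ _ (chart_coord c0 @` (chart_dom c0 `&` chart_dom d)) H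
     (fun x => chart_coord d (chart_param c0 x) 0 i)) => //.
  - by apply: chart_image_open; exact: chart_dom_open.
  - by move=> _ [q [[cq [Wq _]] dq] <-]; exists q => //; rewrite -[chart_coord c q]/(C q) -GE // HG.
  - move=> j; apply: smooth_sub (sH j).
    by move=> _ [q [Vq _] <-]; exact: GWV.
  by have [/(_ i)] := sc0 d ad.
apply: (@smooth_ext _ _ _ _ (F i \o chart_param d)).
- by apply: chart_image_open.
- by move=> x _; rewrite mxE.
exact: smooth_on_sub VU (sF i) d ad.
Qed.

End ChartOfFunctions.

(** * Triples indexed by ordinals *)

Section Triples.

Definition triple (T : Type) (a b c : T) (i : 'I_3) : T :=
  if i == inord 0 then a else if i == inord 1 then b else c.

Lemma ord3_eq : ((inord 1 == inord 0 :> 'I_3) = false) * ((inord 2 == inord 0 :> 'I_3) = false)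
  * ((inord 2 == inord 1 :> 'I_3) = false) * ((inord 0 == inord 1 :> 'I_3) = false)
  * ((inord 0 == inord 2 :> 'I_3) = false) * ((inord 1 == inord 2 :> 'I_3) = false).
Proof. by rewrite -!val_eqE /= !inordK. Qed.

Lemma triple0 T (a b c : T) : triple a b c (inord 0) = a.
Proof. by rewrite /triple eqxx. Qed.

Lemma triple1 T (a b c : T) : triple a b c (inord 1) = b.
Proof. by rewrite /triple ord3_eq eqxx. Qed.

Lemma triple2 T (a b c : T) : triple a b c (inord 2) = c.
Proof. by rewrite /triple !ord3_eq. Qed.

Definition tripleE := (triple0, triple1, triple2).

Lemma ord3P (P : 'I_3 -> Prop) : P (inord 0) -> P (inord 1) -> P (inord 2) -> forall i, P i.
Proof.
move=> P0 P1 P2 i; rewrite -(inord_val i).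
by case: i => -[|[|[|]]].
Qed.

Lemma sum_ord3 (V : nmodType) (F : 'I_3 -> V) :
  \sum_i F i = F (inord 0) + F (inord 1) + F (inord 2).
Proof.
rewrite 3!big_ord_recr big_ord0 /= add0r; congr (F _ + F _ + F _);
  by apply: val_inj; rewrite /= inordK.
Qed.

Lemma lower_triangular3_unitmx (K : fieldType) (A : 'M[K]_3) :
  A (inord 0) (inord 1) = 0 -> A (inord 0) (inord 2) = 0 -> A (inord 1) (inord 2) = 0 ->
  A (inord 0) (inord 0) != 0 -> A (inord 1) (inord 1) != 0 -> A (inord 2) (inord 2) != 0 ->
  A \in unitmx.
Proof.
move=> a01 a02 a12 a00 a11 a22; rewrite unitmxE unitfE det_trig.
  by apply/prodf_neq0 => i _; move: i; apply: ord3P.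
apply/is_trig_mxP; apply: ord3P; apply: ord3P; rewrite ?inordK //.
Qed.

End Triples.

(** * Simultaneous straightening of two commuting fields *)

Section Straightening.
Context {R : realType} {M : manifold R 3}.
Variables (U : set M) (X Y Z : vfield M) (k : M -> R) (p : M).
Hypotheses (oU : open U) (Up : U p) (sX : smooth_vf U X) (sY : smooth_vf U Y)
  (sk : smooth_on U k)
  (Xk : forall q, U q -> act X k q = 0) (Yk : forall q, U q -> act Y k q = 0)
  (XY : forall q, U q -> lie X Y q = 0)
  (Zk : act Z k p != 0)
  (XYZ : \matrix_i (triple (X p) (Y p) (Z p) i : 'rV[R]_3) \in unitmx).

(** A first chart in which the leaves are the levels of the last coordinate. The other two
coordinates are the linear functions of the coordinates at [p] dual to [X p] and [Y p]; the
Jacobian is then triangular in the basis [X p], [Y p], [Z p]. *)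
Lemma leaf_chart : exists2 c : chart R 3 M,
  [/\ smooth_chart c, chart_dom c p & chart_dom c `<=` U] &
  [/\ forall q, chart_coord c q 0 (inord 2) = k q,
      act X (fun q => chart_coord c q 0 (inord 0)) p = 1,
      act X (fun q => chart_coord c q 0 (inord 1)) p = 0,
      act Y (fun q => chart_coord c q 0 (inord 0)) p = 0 &
      act Y (fun q => chart_coord c q 0 (inord 1)) p = 1].
Proof.
set c0 := chart_at p; pose T := \matrix_i (triple (X p) (Y p) (Z p) i : 'rV[R]_3).
have sc0 : smooth_chart c0 by exact: chart_at_smooth.
pose V := U `&` chart_dom c0.
have oV : open V by apply: openI => //; exact: chart_dom_open.
have Vp : V p by split => //; exact: chart_at_dom.
pose A := invmx T.
pose l j q : R := \sum_i chart_coord c0 q 0 i * A i j.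
have sx i : smooth_on V (fun q => chart_coord c0 q 0 i).
  by apply: (smooth_on_sub _ (smooth_on_coord i sc0)) => q [].
have sl j : smooth_on V (l j).
  by apply: (smooth_on_sum oV) => i _; apply: (smooth_onM oV) => //; exact: smooth_on_cst.
have dl j (v : tangent p) : dfun (l j) v = ((v : 'rV[R]_3) *m A) 0 j.
  rewrite (dfun_sumf oV Vp) => [|i]; last by apply: (smooth_onM oV) => //; exact: smooth_on_cst.
  rewrite mxE; apply: eq_bigr => i _.
  rewrite (dfun_mulf oV Vp _ (sx i) (smooth_on_cst V (A i j))).
  by rewrite dfun_cst mulr0 add0r dfun_chart_at mulrC.
pose F := triple (l (inord 0)) (l (inord 1)) k.
have dlT i j : dfun (l j) (triple (X p) (Y p) (Z p) i) = (i == j)%:R.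
  rewrite dl -[triple _ _ _ i](rowK (fun i => triple (X p) (Y p) (Z p) i : 'rV[R]_3)) -/T -row_mul mulmxV //.
  by rewrite rowE mulmx1 mxE eqxx eq_sym.
have [||c [sc cp cV] [cF _]] := @chart_of_functions R 3 M p V F (triple (X p) (Y p) (Z p)) oV Vp.
- apply: ord3P; rewrite /F tripleE; [exact: sl|exact: sl|].
  by apply: smooth_on_sub sk => q [].
- apply: lower_triangular3_unitmx; rewrite !mxE /F !tripleE.
  + by have := dlT (inord 0) (inord 1); rewrite tripleE !ord3_eq.
  + exact: Xk.
  + exact: Yk.
  + by have := dlT (inord 0) (inord 0); rewrite tripleE eqxx => ->; exact: oner_neq0.
  + by have := dlT (inord 1) (inord 1); rewrite tripleE eqxx => ->; exact: oner_neq0.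
  + exact: Zk.
exists c; first by split => // q /cV [].
have cE j : (fun q => chart_coord c q 0 j) = F j.
  by apply/funext => q; rewrite cF mxE.
rewrite !cE /F !tripleE; split.
- by move=> q; rewrite cF mxE /F tripleE.
- by have := dlT (inord 0) (inord 0); rewrite tripleE eqxx.
- by have := dlT (inord 0) (inord 1); rewrite tripleE !ord3_eq.
- by have := dlT (inord 1) (inord 0); rewrite tripleE !ord3_eq.
- by have := dlT (inord 1) (inord 1); rewrite tripleE eqxx.
Qed.

(** A primitive on each leaf of the 1-form taking the constant values [cX] on [X] and [cY] on
[Y]; this form is closed along the leaves because [X] and [Y] commute. *)
Lemma leaf_primitive (cX cY : R) : exists V x, [/\ open V, V p, V `<=` U, smooth_on V x &
  forall q, V q -> act X x q = cX /\ act Y x q = cY].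
Proof.
have [c [sc cp cU] [ck X0p X1p Y0p Y1p]] := leaf_chart.
have oc : open (chart_dom c) by exact: chart_dom_open.
pose f j q : R := chart_coord c q 0 j.
have sf j : smooth_on (chart_dom c) (f j) by exact: smooth_on_coord.
have sXc := smooth_vf_sub cU sX; have sYc := smooth_vf_sub cU sY.
pose X0 := act X (f (inord 0)); pose X1 := act X (f (inord 1)).
pose Y0 := act Y (f (inord 0)); pose Y1 := act Y (f (inord 1)).
have sX0 : smooth_on (chart_dom c) X0 by exact: sXc.
have sX1 : smooth_on (chart_dom c) X1 by exact: sXc.
have sY0 : smooth_on (chart_dom c) Y0 by exact: sYc.
have sY1 : smooth_on (chart_dom c) Y1 by exact: sYc.
have f2 : f (inord 2) = k by apply/funext => q; rewrite /f ck.
pose det q := X0 q * Y1 q - X1 q * Y0 q.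
have sdet : smooth_on (chart_dom c) det by apply: (smooth_onB oc); exact: smooth_onM.
(* X and Y span the tangent planes of the leaves where this determinant is nonzero; it is 1 at p. *)
pose V := chart_dom c `&` [set q | 0 < det q].
have oV : open V by exact: smooth_on_gt0_open.
have Vp : V p by split => //; rewrite /= /det /X0 /X1 /Y0 /Y1 X0p X1p Y0p Y1p mulr1 mul0r subr0.
have Vc : V `<=` chart_dom c by move=> q [].
have VU q : V q -> U q by move=> /Vc/cU.
have detn q : V q -> det q != 0 by move=> [_ /= /lt0r_neq0].
(* Cramer's rule for the components of the form, determined by thX and thY below. *)
pose th0 q := (cX * Y1 q - cY * X1 q) / det q.
pose th1 q := (cY * X0 q - cX * Y0 q) / det q.
have sV g : smooth_on (chart_dom c) g -> smooth_on V g by exact: smooth_on_sub.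
have sC a : smooth_on V (cst a : M -> R) by exact: smooth_on_cst.
have sth0 : smooth_on V th0.
  apply: (smooth_onM oV); last by apply: (smooth_onV oV) => //; exact: sV.
  by apply: (smooth_onB oV); apply: (smooth_onM oV); [exact: sC|exact: sV|exact: sC|exact: sV].
have sth1 : smooth_on V th1.
  apply: (smooth_onM oV); last by apply: (smooth_onV oV) => //; exact: sV.
  by apply: (smooth_onB oV); apply: (smooth_onM oV); [exact: sC|exact: sV|exact: sC|exact: sV].
have thX q : V q -> X0 q * th0 q + X1 q * th1 q = cX.
  by move=> /detn; rewrite /th0 /th1 /det => d0; field.
have thY q : V q -> Y0 q * th0 q + Y1 q * th1 q = cY.
  by move=> /detn; rewrite /th0 /th1 /det => d0; field.
pose pd j g q : R := 'D_(delta_mx 0 j) (g \o chart_param c) (chart_coord c q).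
have actX g q : smooth_on V g -> V q ->
    act X g q = X0 q * pd (inord 0) g q + X1 q * pd (inord 1) g q.
  move=> sg Vq; rewrite /act (dfun_chart oV Vq (X q) sc (Vc _ Vq) sg) sum_ord3.
  rewrite -[dfun (fun q => chart_coord c q 0 (inord 2)) (X q)]/(act X (f (inord 2)) q) f2.
  by rewrite (Xk (VU q Vq)) mul0r addr0.
have actY g q : smooth_on V g -> V q ->
    act Y g q = Y0 q * pd (inord 0) g q + Y1 q * pd (inord 1) g q.
  move=> sg Vq; rewrite /act (dfun_chart oV Vq (Y q) sc (Vc _ Vq) sg) sum_ord3.
  rewrite -[dfun (fun q => chart_coord c q 0 (inord 2)) (Y q)]/(act Y (f (inord 2)) q) f2.
  by rewrite (Yk (VU q Vq)) mul0r addr0.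
have comm j q : V q -> act X (act Y (f j)) q = act Y (act X (f j)) q.
  move=> Vq; apply/eqP; rewrite -subr_eq0 -(act_lie oc sXc sYc (sf j) (Vc q Vq)).
  by rewrite /act (XY (VU q Vq)) /dfun derive0.
(* Differentiate the equation for the value on X along Y, the one for the value on Y along
   X, and subtract; the derivatives of the components of X and Y cancel by comm. *)
have closed_th q : V q -> pd (inord 1) th0 q = pd (inord 0) th1 q.
  move=> Vq.
  have dd (v : tangent q) g1 h1 g2 h2 a : smooth_on V g1 -> smooth_on V h1 -> smooth_on V g2 ->
      smooth_on V h2 -> (forall q, V q -> g1 q * h1 q + g2 q * h2 q = a) ->
      g1 q * dfun h1 v + h1 q * dfun g1 v + (g2 q * dfun h2 v + h2 q * dfun g2 v) = 0.
    move=> s1 s2 s3 s4 /(dfun_near v oV Vq) E; rewrite -(dfun_cst a v) -E.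
    by rewrite (dfun_addf oV Vq) ?(dfun_mulf oV Vq) //; exact: smooth_onM.
  have dX := dd (Y q) _ _ _ _ _ (sV _ sX0) sth0 (sV _ sX1) sth1 thX.
  have dY := dd (X q) _ _ _ _ _ (sV _ sY0) sth0 (sV _ sY1) sth1 thY.
  have c0 : dfun Y0 (X q) = dfun X0 (Y q) by exact: comm.
  have c1 : dfun Y1 (X q) = dfun X1 (Y q) by exact: comm.
  have aX0 := actX th0 q sth0 Vq; have aX1 := actX th1 q sth1 Vq.
  have aY0 := actY th0 q sth0 Vq; have aY1 := actY th1 q sth1 Vq.
  rewrite /act in aX0 aX1 aY0 aY1.
  apply: (mulfI (detn q Vq)); rewrite /det.
  clearbody th0 th1 X0 X1 Y0 Y1.
  rewrite aY0 aY1 in dX; rewrite aX0 aX1 c0 c1 in dY.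
  move: (pd _ th0 q) (pd (inord 0) th0 q) (pd _ th1 q) (pd (inord 0) th1 q) dX dY.
  move: (dfun X0 (Y q)) (dfun X1 (Y q)) (X0 q) (X1 q) (Y0 q) (Y1 q) (th0 q) (th1 q) => D0 D1 x0 x1 y0 y1 t0 t1.
  move=> a b c' d dX dY; apply: subr0_eq.
  by rewrite -[RHS](subrr 0) -[X in _ = X - _]dX -[X in _ = _ - X]dY; ring.
clearbody th0 th1.
have o2 : open (chart_coord c @` V) by rewrite -(setIidr Vc); exact: chart_image_open.
have : nbhs (chart_coord c p) (chart_coord c @` V) by apply: open_nbhs_nbhs; split => //; exists p.
move=> /nbhs_ballP [r /= r0 rV].
set o := chart_coord c p in rV *.
have sball g : smooth_on V g -> smooth_rV (ball o r) (g \o chart_param c).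
  move=> sg; apply: smooth_sub (smooth_on_param sc oV sg).
  by rewrite (setIidr Vc).
pose a : pred 'I_3 := fun i => i != inord 2.
pose theta := triple (th0 \o chart_param c) (th1 \o chart_param c) (cst 0).
have pdE g v i : ball o r v -> 'D_(delta_mx 0 i) (g \o chart_param c) v = pd i g (chart_param c v).
  by move=> /rV [q Vq <-]; rewrite /pd chart_coordK //; exact: Vc.
have [||x [sx dx]] := @leafwise_poincare R 3 a o r theta.
- by apply: ord3P; rewrite /theta ?tripleE => _; [exact: sball|exact: sball|exact: smooth_cst].
- have cl v : ball o r v -> pd (inord 1) th0 (chart_param c v) = pd (inord 0) th1 (chart_param c v).
    by move=> /rV [q Vq <-]; rewrite chart_coordK ?closed_th //; exact: Vc.
  have t0 : theta (inord 0) = th0 \o chart_param c by exact: triple0.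
  have t1 : theta (inord 1) = th1 \o chart_param c by exact: triple1.
  clearbody theta.
  have cl' v : ball o r v -> 'D_(delta_mx 0 (inord 1)) (theta (inord 0)) v
      = 'D_(delta_mx 0 (inord 0)) (theta (inord 1)) v.
    by move=> vb; rewrite t0 t1 (pdE th0) // (pdE th1) // cl.
  apply: ord3P; apply: ord3P => v; rewrite /a ?eqxx // => _ _ vb; first exact: cl'.
  by rewrite cl'.
pose W := V `&` [set q | ball o r (chart_coord c q)].
have oW : open W.
  rewrite openE => q [Vq bq].
  have n1 : \forall q' \near q, V q' by apply: open_nbhs_nbhs.
  have n2 : \forall q' \near q, ball o r (chart_coord c q').
    by apply: (chart_coord_continuous (Vc _ Vq)); apply: open_nbhs_nbhs; split => //; exact: ball_open.
  exact: filterI n1 n2.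
have WV : W `<=` V by move=> q [].
have Wc : W `<=` chart_dom c by move=> q /WV /Vc.
have sxc : smooth_on W (x \o chart_coord c).
  have oWc : open (chart_coord c @` W) by rewrite -(setIidr Wc); exact: chart_image_open.
  apply: (smooth_on_chart sc oW Wc); apply: (@smooth_ext _ _ _ oWc x).
    by move=> _ [q Wq <-]; rewrite /= chart_coordK //; exact: Wc.
  by apply: smooth_sub sx => _ [q [_ bq] <-].
exists W, (x \o chart_coord c); split => //.
- by split => //; exact: ballxx.
- by move=> q /WV /VU.
move=> q Wq; have Vq := WV q Wq; have bq := Wq.2.
have dxc i : a i -> 'D_(delta_mx 0 i) ((x \o chart_coord c) \o chart_param c) (chart_coord c q)
    = theta i (chart_coord c q).
  move=> ai; rewrite -(dx i _ ai bq); apply: near_eq_derive.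
  have := near_chart oW (Wc _ Wq) Wq; apply: filterS => v [q' [cq' _] <-].
  by rewrite /= chart_coordK.
have E (v : tangent q) : dfun k v = 0 -> dfun (x \o chart_coord c) v =
    dfun (f (inord 0)) v * th0 q + dfun (f (inord 1)) v * th1 q :> R.
  move=> kv; rewrite (dfun_chart oW Wq v sc (Wc _ Wq) sxc) sum_ord3.
  rewrite -[dfun (fun q => chart_coord c q 0 (inord 2)) v]/(dfun (f (inord 2)) v) f2 kv mul0r addr0.
  rewrite !dxc /a ?ord3_eq // /theta !tripleE /= chart_coordK //; exact: Vc.
have EX := E (X q) (Xk (VU _ Vq)); have EY := E (Y q) (Yk (VU _ Vq)).
by split; [rewrite [LHS]EX; exact: thX|rewrite [LHS]EY; exact: thY].
Qed.

(** The functions [x] and [y] with [X x = 1], [Y x = 0], [X y = 0], [Y y = 1] together with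
[k] have a triangular Jacobian in the basis [X p], [Y p], [Z p]. *)
Lemma straightening : exists2 c : chart R 3 M,
  [/\ smooth_chart c, chart_dom c p & chart_dom c `<=` U] &
  [/\ exists o r, 0 < r /\ chart_coord c @` chart_dom c = ball o r,
      forall q, chart_coord c q 0 (inord 2) = k q,
      forall q, chart_dom c q -> act X (fun q => chart_coord c q 0 (inord 0)) q = 1 /\
        act X (fun q => chart_coord c q 0 (inord 1)) q = 0 &
      forall q, chart_dom c q -> act Y (fun q => chart_coord c q 0 (inord 0)) q = 0 /\
        act Y (fun q => chart_coord c q 0 (inord 1)) q = 1].
Proof.
have [V [x [oV Vp VU sx dx]]] := leaf_primitive 1 0.
have [W [y [oW Wp WU sy dy]]] := leaf_primitive 0 1.
pose V' := V `&` W; have oV' : open V' by exact: openI.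
pose F := triple x y k.
have Vp' : V' p by [].
have [||c [sc cp cV] [cF [r r0 cr]]] := @chart_of_functions R 3 M p V' F (triple (X p) (Y p) (Z p)) oV' Vp'.
- apply: ord3P; rewrite /F tripleE.
  + by apply: smooth_on_sub sx => q [].
  + by apply: smooth_on_sub sy => q [].
  + by apply: smooth_on_sub sk => q [/VU].
- apply: lower_triangular3_unitmx; rewrite !mxE /F !tripleE -?/(act _ _ _).
  + by have [] := dy p Wp.
  + exact: Xk.
  + exact: Yk.
  + by have [] := dx p Vp; rewrite /act => -> _; exact: oner_neq0.
  + by have [] := dy p Wp; rewrite /act => _ ->; exact: oner_neq0.
  + exact: Zk.
exists c; first by split => // q /cV [/VU].
have cE j : (fun q => chart_coord c q 0 j) = F j.
  by apply/funext => q; rewrite cF mxE.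
rewrite !cE /F !tripleE; split.
- by exists (\row_j F j p), r.
- by move=> q; rewrite cF mxE /F tripleE.
- by move=> q /cV [/dx [Xx _] /dy [Xy _]].
- by move=> q /cV [/dx [_ Yx] /dy [_ Yy]].
Qed.

End Straightening.

(** * Pointwise algebra of almost contact metric structures *)

Section AlmostContactAlgebra.
Context {R : realType} {n : nat} {M : manifold R n}.
Variable S : almost_contact_metric M.
Implicit Types (p q : M).

Lemma g_linear_r p (u : tangent p) a v w : g S u (a *: v + w) = a * g S u v + g S u w.
Proof. by have [[H _ _] _ _] := g_metric S; exact: H. Qed.

Lemma g_sym p (u v : tangent p) : g S u v = g S v u.
Proof. by have [_ H _] := g_metric S; exact: H. Qed.

Lemma g_pos p (u : tangent p) : u != 0 -> 0 < g S u u.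
Proof. by have [_ _ H] := g_metric S; exact: H. Qed.

Lemma gDr p (u v w : tangent p) : g S u (v + w) = g S u v + g S u w.
Proof. by rewrite -[v]scale1r g_linear_r mul1r scale1r. Qed.

Lemma g0r p (u : tangent p) : g S u 0 = 0.
Proof. by have := gDr u 0 0; rewrite addr0 => /eqP; rewrite -subr_eq0 opprD addrA subrr sub0r oppr_eq0 => /eqP. Qed.

Lemma gZr p (u v : tangent p) a : g S u (a *: v) = a * g S u v.
Proof. by rewrite -[a *: v]addr0 g_linear_r g0r addr0. Qed.

Lemma gNr p (u v : tangent p) : g S u (- v) = - g S u v.
Proof. by rewrite -scaleN1r gZr mulN1r. Qed.

Lemma gDl p (u v w : tangent p) : g S (u + v) w = g S u w + g S v w.
Proof. by rewrite g_sym gDr !(g_sym w). Qed.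

Lemma gZl p (u v : tangent p) a : g S (a *: u) v = a * g S u v.
Proof. by rewrite g_sym gZr g_sym. Qed.

Lemma gNl p (u v : tangent p) : g S (- u) v = - g S u v.
Proof. by rewrite g_sym gNr g_sym. Qed.

Lemma g0l p (u : tangent p) : g S 0 u = 0.
Proof. by rewrite g_sym g0r. Qed.

Definition gE := (gDl, gDr, gZl, gZr, gNl, gNr, g0l, g0r).

Lemma etaD p (u v : tangent p) : eta S (u + v) = eta S u + eta S v.
Proof.
have [H _] := eta_smooth S.
by have := H p 1 u v; rewrite scale1r /= mul1r.
Qed.

Lemma etaZ p (u : tangent p) a : eta S (a *: u) = a * eta S u.
Proof.
have [H _] := eta_smooth S.
have e0 : eta S (0 : tangent p) = 0.
  by have := etaD 0 (0 : tangent p); rewrite addr0 => /eqP; rewrite -subr_eq0 opprD addrA subrr sub0r oppr_eq0 => /eqP.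
by have := H p a u 0; rewrite addr0 e0 addr0.
Qed.

Lemma phiD p (u v : tangent p) : phi S (u + v) = phi S u + phi S v.
Proof.
have [H _] := phi_smooth S.
by have := H p 1 u v; rewrite !scale1r.
Qed.

Lemma phiZ p (u : tangent p) a : phi S (a *: u) = a *: phi S u.
Proof.
have [H _] := phi_smooth S.
have e0 : phi S (0 : tangent p) = 0.
  by have := phiD 0 (0 : tangent p); rewrite addr0 => /eqP; rewrite -subr_eq0 opprD addrA subrr sub0r oppr_eq0 => /eqP.
by have := H p a u 0; rewrite addr0 e0 addr0.
Qed.

Lemma phiN p (u : tangent p) : phi S (- u) = - phi S u.
Proof. by rewrite -scaleN1r phiZ scaleN1r. Qed.

Lemma xi_neq0 p : xi S p != 0.
Proof.
apply/eqP => x0; have := eta_xi S p; rewrite x0 -(scale0r (0 : tangent p)) etaZ mul0r => /eqP.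
by rewrite eq_sym oner_eq0.
Qed.

(** Since [phi (phi xi) = - xi + eta(xi) xi = 0], applying the formula for [phi^2] to
[phi xi] shows that [phi xi] is a multiple of [xi]; the factor squares to 0. *)
Lemma phi_xi p : phi S (xi S p) = 0.
Proof.
set s := eta S (phi S (xi S p)).
have pp : phi S (phi S (xi S p)) = 0 by rewrite phi_phi eta_xi scale1r addrC subrr.
have p0 : phi S (0 : tangent p) = 0 by rewrite -(scale0r (0 : tangent p)) phiZ !scale0r.
have E : phi S (xi S p) = s *: xi S p.
  have := phi_phi S (phi S (xi S p)); rewrite pp p0 => /esym/eqP.
  by rewrite addrC subr_eq0 => /eqP <-.
have := pp; rewrite E phiZ E scalerA => /eqP.
rewrite scaler_eq0 (negbTE (xi_neq0 p)) orbF mulf_eq0 orbb => /eqP s0.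
by rewrite s0 scale0r.
Qed.

Lemma eta_phi p (u : tangent p) : eta S (phi S u) = 0.
Proof.
have := phi_phi S (phi S u); rewrite (phi_phi S u) phiD phiN phiZ phi_xi scaler0 addr0 => /eqP.
rewrite -subr_eq0 opprD addrA subrr sub0r oppr_eq0 scaler_eq0 (negbTE (xi_neq0 p)) orbF.
by move=> /eqP.
Qed.

(** Put [v = xi] in the compatibility of [g] with [phi] and use [phi xi = 0]. *)
Lemma eta_g p (u : tangent p) : eta S u = g S u (xi S p).
Proof.
have := g_phi_phi S u (xi S p); rewrite phi_xi g0r eta_xi mulr1 => /esym/eqP.
by rewrite subr_eq0 => /eqP.
Qed.

Lemma g_xi_xi p : g S (xi S p) (xi S p) = 1.
Proof. by rewrite -eta_g eta_xi. Qed.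

Lemma g_phi_skew p (u v : tangent p) : g S u (phi S v) = - g S (phi S u) v.
Proof.
have := g_phi_phi S u (phi S v); rewrite eta_phi mulr0 subr0 => <-.
by rewrite phi_phi gDr gNr gZr -eta_g eta_phi mulr0 addr0.
Qed.

Lemma g_phi_self p (u : tangent p) : g S u (phi S u) = 0.
Proof.
have := g_phi_skew u u; rewrite (g_sym (phi S u)) => /eqP.
by rewrite -addr_eq0 -mulr2n mulrn_eq0 /= => /eqP.
Qed.

End AlmostContactAlgebra.

Lemma mul_triple_mx (K : fieldType) (w u0 u1 u2 : 'rV[K]_3) :
  w *m (\matrix_i triple u0 u1 u2 i) =
  w 0 (inord 0) *: u0 + w 0 (inord 1) *: u1 + w 0 (inord 2) *: u2.
Proof. by rewrite mulmx_sum_row sum_ord3 !rowK !tripleE. Qed.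

(** * Adapted orthonormal frames *)

Section Frames.
Context {R : realType} {M : manifold R 3}.
Variable S : almost_contact_metric M.
Implicit Types (U V : set M) (E X Y Z : vfield M).

(** A local section of the unit circle bundle of the kernel of [eta]; it gives the adapted
orthonormal frame [xi], [E], [phi E]. *)
Definition unit_section U E := [/\ open U, smooth_vf U E &
  forall q, U q -> g S (E q) (E q) = 1 /\ eta S (E q) = 0].

Definition phi_vf E : vfield M := fun q => phi S (E q).

Section OneFrame.
Variables (U : set M) (E : vfield M).
Hypothesis fE : unit_section U E.
Notation F := (phi_vf E).

Lemma phi_section_unit : unit_section U F.
Proof.
have [oU sE uE] := fE; split => //.
  by have [_ H] := phi_smooth S; exact: H.
move=> q Uq; have [gEE eE] := uE q Uq.
by rewrite g_phi_phi gEE eE mul0r subr0 eta_phi.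
Qed.

Section At.
Variable q : M.
Hypothesis Uq : U q.

Lemma frame_phi_phi : phi S (F q) = - E q.
Proof. by have [_ _ /(_ q Uq) [_ eE]] := fE; rewrite /phi_vf phi_phi eE scale0r addr0. Qed.

Lemma frame_g : [/\ g S (xi S q) (xi S q) = 1, g S (E q) (E q) = 1, g S (F q) (F q) = 1
  & [/\ g S (xi S q) (E q) = 0, g S (xi S q) (F q) = 0 & g S (E q) (F q) = 0]].
Proof.
have [_ _ /(_ q Uq) [gEE eE]] := fE; have [_ _ /(_ q Uq) [gFF eF]] := phi_section_unit.
by rewrite g_xi_xi gEE gFF !(g_sym S (xi S q)) -!eta_g eE eF g_phi_self.
Qed.

Lemma frame_gE : (g S (xi S q) (xi S q) = 1) * (g S (E q) (E q) = 1) * (g S (F q) (F q) = 1) *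
  (g S (xi S q) (E q) = 0) * (g S (xi S q) (F q) = 0) * (g S (E q) (F q) = 0) *
  (g S (E q) (xi S q) = 0) * (g S (F q) (xi S q) = 0) * (g S (F q) (E q) = 0).
Proof.
have [g1 g2 g3 [g4 g5 g6]] := frame_g.
by rewrite g1 g2 g3 g4 g5 g6 (g_sym S (E q) (xi S q)) (g_sym S (F q)) (g_sym S (F q)) g4 g5 g6.
Qed.

Lemma frame_unitmx : \matrix_i (triple (E q) (F q) (xi S q) i : 'rV[R]_3) \in unitmx.
Proof.
set T := \matrix_i _; rewrite -row_free_unit -kermx_eq0; apply/eqP/row_matrixP => i.
set w := row i (kermx T).
have wT : w *m T = 0 by rewrite /w -row_mul mulmx_ker row0.
have : (w 0 (inord 0) *: E q + w 0 (inord 1) *: F q + w 0 (inord 2) *: xi S q : tangent q) = 0.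
  by rewrite -[RHS]wT /T mul_triple_mx.
rewrite row0; clearbody w; move=> w0.
have w2 : w 0 (inord 2) = 0.
  by have := congr1 (fun v : tangent q => g S v (xi S q)) w0; rewrite !gE !frame_gE; lra.
have w00 : w 0 (inord 0) = 0.
  by have := congr1 (fun v : tangent q => g S v (E q)) w0; rewrite !gE !frame_gE; lra.
have w1 : w 0 (inord 1) = 0.
  by have := congr1 (fun v : tangent q => g S v (F q)) w0; rewrite !gE !frame_gE; lra.
by apply/rowP; apply: ord3P; rewrite mxE.
Qed.

Lemma frame_decomp (v : tangent q) :
  v = g S v (E q) *: E q + g S v (F q) *: F q + g S v (xi S q) *: xi S q.
Proof.
set T := \matrix_i (triple (E q) (F q) (xi S q) i : 'rV[R]_3).
pose w := (v : 'rV[R]_3) *m invmx T.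
have E1 : v = w 0 (inord 0) *: E q + w 0 (inord 1) *: F q + w 0 (inord 2) *: xi S q.
  have -> : v = w *m T by rewrite /w mulmxKV //; exact: frame_unitmx.
  exact: mul_triple_mx.
have H (u : tangent q) := congr1 (fun v : tangent q => g S v u) E1.
have w0 := H (E q); have w1 := H (F q); have w2 := H (xi S q).
rewrite !gE !frame_gE !mulr0 !mulr1 ?addr0 ?add0r in w0 w1 w2.
by rewrite w0 w1 w2.
Qed.

Lemma frame_eq (u v : tangent q) : g S u (E q) = g S v (E q) -> g S u (F q) = g S v (F q) ->
  g S u (xi S q) = g S v (xi S q) -> u = v.
Proof. by move=> e1 e2 e3; rewrite (frame_decomp u) (frame_decomp v) e1 e2 e3. Qed.

Lemma parseval (u v : tangent q) : g S u v =
  g S u (E q) * g S v (E q) + g S u (F q) * g S v (F q) + g S u (xi S q) * g S v (xi S q).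
Proof. by rewrite {1}(frame_decomp u) !gE ![g S _ v](g_sym S) . Qed.

End At.
End OneFrame.
End Frames.

(** * Locality and Leibniz rule of the bracket *)

Section Brackets.
Context {R : realType} {n : nat} {M : manifold R n}.
Implicit Types (p q : M) (U V : set M) (X Y Z : vfield M) (f : M -> R).

Lemma act_locally_const U X f (a : R) p : open U -> U p -> (forall q, U q -> f q = a) -> act X f p = 0.
Proof. by move=> oU Up fa; rewrite /act (dfun_near _ oU Up fa) dfun_cst. Qed.

Lemma act_local U X f f' p : open U -> U p -> (forall q, U q -> f q = f' q) -> act X f p = act X f' p.
Proof. by move=> oU Up ff; exact: dfun_near oU Up ff. Qed.

Lemma lieE X Y p i : (lie X Y p : 'rV[R]_n) 0 i =
  act X (act Y (fun q => chart_coord (chart_at p) q 0 i)) p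
  - act Y (act X (fun q => chart_coord (chart_at p) q 0 i)) p.
Proof. by rewrite mxE. Qed.

Lemma lie_antisym X Y p : lie X Y p = - lie Y X p.
Proof. by apply/rowP => i; rewrite !mxE opprB. Qed.

Lemma lie_local U X Y Y' p : open U -> U p -> (forall q, U q -> Y q = Y' q) -> lie X Y p = lie X Y' p.
Proof.
move=> oU Up YY; apply/rowP => i; apply: etrans (lieE X Y p i) _; apply: etrans _ (esym (lieE X Y' p i)).
set x : M -> R := fun q => chart_coord (chart_at p) q 0 i.
have e1 : act X (act Y x) p = act X (act Y' x) p.
  by apply: (act_local _ oU Up) => q Uq; rewrite /act (YY q Uq).
have e2 : act Y (act X x) p = act Y' (act X x) p.
  exact: (congr1 (fun v : tangent p => dfun (act X x) v) (YY p Up)).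
exact: (congr2 (fun a b => a - b) e1 e2).
Qed.

Variable U : set M.
Hypothesis oU : open U.

Let tangent_act p (u v : tangent p) : U p ->
  (forall f V, open V -> V p -> V `<=` U -> smooth_on V f -> dfun f u = dfun f v) -> u = v.
Proof.
move=> Up H; apply: tangent_eq => i.
pose V := U `&` chart_dom (chart_at p).
have oV : open V by apply: openI => //; exact: chart_dom_open.
apply: (H _ V) => //; first by split => //; exact: chart_at_dom.
  by move=> q [].
by apply: (smooth_on_sub _ (smooth_on_coord i (chart_at_smooth p))) => q [].
Qed.

Lemma lieDr X Y Z p : smooth_vf U X -> smooth_vf U Y -> smooth_vf U Z -> U p ->
  lie X (fun q => Y q + Z q) p = lie X Y p + lie X Z p.
Proof.
move=> sX sY sZ Up; apply: (tangent_act Up) => f V oV Vp VU sf.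
have sXV := smooth_vf_sub VU sX; have sYV := smooth_vf_sub VU sY; have sZV := smooth_vf_sub VU sZ.
have sS := smooth_vfD sYV sZV.
have sXf : smooth_on V (act X f) by exact: sXV.
have sYf : smooth_on V (act Y f) by exact: sYV.
have sZf : smooth_on V (act Z f) by exact: sZV.
have A1 := act_lie oV sXV sS sf Vp.
have A2 := act_lie oV sXV sYV sf Vp.
have A3 := act_lie oV sXV sZV sf Vp.
apply: etrans A1 _; apply: etrans _ (esym (dfunD oV Vp _ _ sf)).
apply: etrans _ (esym (congr2 +%R A2 A3)).
have E : forall q, V q -> act (fun q => Y q + Z q) f q = act Y f q + act Z f q.
  by move=> q Vq; exact: (dfunD oV Vq _ _ sf).
have B1 := etrans (act_local X oV Vp E) (dfun_addf oV Vp (X p) sYf sZf).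
have B2 := dfunD oV Vp (Y p) (Z p) sXf.
apply: etrans (congr2 (fun a b => a - b) B1 B2) _.
by rewrite opprD addrACA.
Qed.

Lemma lie_leibniz X Y f p : smooth_vf U X -> smooth_vf U Y -> smooth_on U f -> U p ->
  lie X (fun q => f q *: Y q) p = act X f p *: Y p + f p *: lie X Y p.
Proof.
move=> sX sY sf Up; apply: (tangent_act Up) => h V oV Vp VU sh.
have sXV := smooth_vf_sub VU sX; have sYV := smooth_vf_sub VU sY; have sfV := smooth_on_sub VU sf.
have sS := smooth_vfZ sfV sYV.
have sXh : smooth_on V (act X h) by exact: sXV.
have sYh : smooth_on V (act Y h) by exact: sYV.
have A1 := act_lie oV sXV sS sh Vp.
have A2 := act_lie oV sXV sYV sh Vp.
have E : forall q, V q -> act (fun q => f q *: Y q) h q = f q * act Y h q.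
  by move=> q Vq; exact: (dfunZ oV Vq _ _ sh).
have B1 := etrans (act_local X oV Vp E) (dfun_mulf oV Vp (X p) sfV sYh).
have B2 := dfunZ oV Vp (f p) (Y p) sXh.
apply: etrans A1 _; apply: etrans (congr2 (fun a b => a - b) B1 B2) _.
apply: etrans _ (esym (dfunD oV Vp _ _ sh)).
apply: etrans _ (esym (congr2 +%R (dfunZ oV Vp _ _ sh) (dfunZ oV Vp _ _ sh))).
apply: etrans _ (congr1 (fun a => act X f p * dfun h (Y p) + f p * a) (esym A2)).
have ringE (a b c d e : R) : a * b + c * d - a * e = d * c + a * (b - e) by ring.
exact: ringE.
Qed.

(** The bracket is defined pointwise, through a chart that varies with the point; its
smoothness comes from the torsion-free connection. *)
Lemma lie_smooth (g : two_tensor M) (nabla : connection M) X Y : levi_civita g nabla ->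
  smooth_vf U X -> smooth_vf U Y -> smooth_vf U (lie X Y).
Proof.
move=> L sX sY; have A := levi_civita_affine L.
apply: (@smooth_vf_ext _ _ _ _ (fun q => nabla X Y q - nabla Y X q)).
  by move=> q Uq; exact: (levi_civita_torsion_free L oU).
by apply: smooth_vfB; exact: nabla_smooth.
Qed.

End Brackets.

(** * The connection of an almost Kenmotsu structure *)

Section AlmostKenmotsuConnection.
Context {R : realType} {M : manifold R 3}.
Variables (S : almost_contact_metric M) (nabla : connection M).
Hypotheses (hK : almost_kenmotsu S) (L : levi_civita (g S) nabla).
Implicit Types (q : M) (X Y Z : vfield M).
Notation xi := (xi S).

(** Vector identities are reduced to identities between the scalar functions [g(Y, Z)],
[g([X, Y], Z)] and [g(nabla_X Y, Z)] of frame fields, which linear arithmetic can handle. *)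
Definition gfun Y Z : M -> R := fun q => g S (Y q) (Z q).
Definition glie X Y Z : M -> R := gfun (lie X Y) Z.
Definition gnabla X Y Z : M -> R := gfun (nabla X Y) Z.

Section OnOpen.
Variable U : set M.
Hypothesis oU : open U.

Lemma xi_smooth_on : smooth_vf U xi.
Proof. exact: (smooth_vf_sub (@subsetT _ U) (xi_smooth S)). Qed.
Hint Resolve xi_smooth_on : core.

Lemma nabla_smooth_vf X Y : smooth_vf U X -> smooth_vf U Y -> smooth_vf U (nabla X Y).
Proof. by move=> sX sY; exact: (nabla_smooth (levi_civita_affine L) oU sX sY). Qed.

Lemma gfun_smooth X Y : smooth_vf U X -> smooth_vf U Y -> smooth_on U (gfun X Y).
Proof. by move=> sX sY; have [[_ _ H] _ _] := g_metric S; exact: (H U X Y oU sX sY). Qed.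

Lemma gnabla_smooth X Y Z : smooth_vf U X -> smooth_vf U Y -> smooth_vf U Z -> smooth_on U (gnabla X Y Z).
Proof. by move=> sX sY sZ; apply: gfun_smooth => //; exact: nabla_smooth_vf. Qed.

Section At.
Variable q : M.
Hypothesis Uq : U q.

Lemma gnabla_metric X Y Z : smooth_vf U X -> smooth_vf U Y -> smooth_vf U Z ->
  act X (gfun Y Z) q = gnabla X Y Z q + gnabla X Z Y q.
Proof.
move=> sX sY sZ; apply: etrans (levi_civita_metric L oU sX sY sZ Uq) _.
by rewrite [X in _ + X]g_sym.
Qed.

Lemma gnabla_torsion X Y Z : smooth_vf U X -> smooth_vf U Y ->
  gnabla X Y Z q - gnabla Y X Z q = glie X Y Z q.
Proof.
move=> sX sY; rewrite /glie /gfun -(levi_civita_torsion_free L oU sX sY Uq).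
by rewrite gDl gNl.
Qed.

Lemma gnabla_skew X Y Z (a : R) : smooth_vf U X -> smooth_vf U Y -> smooth_vf U Z ->
  (forall q, U q -> gfun Y Z q = a) -> gnabla X Y Z q = - gnabla X Z Y q.
Proof.
move=> sX sY sZ ca; have := gnabla_metric sX sY sZ.
by rewrite (act_locally_const X oU Uq ca) => /esym/eqP; rewrite addr_eq0 => /eqP.
Qed.

(** As [eta = g(., xi)] and the connection is metric and torsion-free, the difference of
the two sides is [d eta (X, Z)] up to sign. *)
Lemma gnabla_xi_sym X Z : smooth_vf U X -> smooth_vf U Z -> gnabla X xi Z q = gnabla Z xi X q.
Proof.
move=> sX sZ; have [H _] := hK; have := H U X Z oU sX sZ q Uq; rewrite /d1.
have e Y : (fun q => eta S (Y q)) = gfun Y xi by apply/funext => p; exact: eta_g.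
rewrite !e (gnabla_metric sX sZ xi_smooth_on) (gnabla_metric sZ sX xi_smooth_on).
have -> : eta S (lie X Z q) = glie X Z xi q by exact: eta_g.
rewrite -(gnabla_torsion xi sX sZ).
move: (gnabla X Z xi q) (gnabla X xi Z q) (gnabla Z X xi q) (gnabla Z xi X q) => a b c d; lra.
Qed.

(** The metric moves the outer derivatives off the vectors. In the bracket term,
self-adjointness of [nabla xi] turns the direction of differentiation, a bracket, into an
argument of the metric, so that only derivatives along the given fields remain. *)
Lemma curvature_xi X Y Z : smooth_vf U X -> smooth_vf U Y -> smooth_vf U Z ->
  g S (curvature nabla X Y xi q) (Z q) =
  (act X (gnabla Y xi Z) q - g S (nabla Y xi q) (nabla X Z q))
  - (act Y (gnabla X xi Z) q - g S (nabla X xi q) (nabla Y Z q))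
  - g S (nabla Z xi q) (lie X Y q).
Proof.
move=> sX sY sZ.
have sYx := nabla_smooth_vf sY xi_smooth_on; have sXx := nabla_smooth_vf sX xi_smooth_on.
have sL : smooth_vf U (lie X Y) by exact: (lie_smooth oU L).
have E1 := gnabla_metric sX sYx sZ; have E2 := gnabla_metric sY sXx sZ.
have E3 := gnabla_xi_sym sL sZ.
rewrite /curvature !gDl !gNl.
have -> : g S (nabla X (nabla Y xi) q) (Z q) = act X (gnabla Y xi Z) q - g S (nabla Y xi q) (nabla X Z q).
  rewrite [act X _ q]E1 /gnabla /gfun [g S (nabla Y xi q) _]g_sym.
  by rewrite addrK.
have -> : g S (nabla Y (nabla X xi) q) (Z q) = act Y (gnabla X xi Z) q - g S (nabla X xi q) (nabla Y Z q).
  rewrite [act Y _ q]E2 /gnabla /gfun [g S (nabla X xi q) _]g_sym.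
  by rewrite addrK.
by congr (_ - _); exact: E3.
Qed.

End At.
End OnOpen.
End AlmostKenmotsuConnection.

(** * Functions constant along the leaves of a chart *)

Section LeafConstant.
Context {R : realType}.

(** The ray from the centre of its leaf to [v] stays in the ball and in the leaf. *)
Lemma leafwise_constant n (a : pred 'I_n) (o : 'rV[R]_n) r (f : 'rV[R]_n -> R) v :
  smooth_rV (ball o r) f ->
  (forall i v, a i -> ball o r v -> 'D_(delta_mx 0 i) f v = 0) ->
  ball o r v -> f v = f (leaf_shrink a o 0 v).
Proof.
move=> sf df vb; rewrite -{1}(leaf_shrink1 a o v).
pose h := leaf_part a (v - o); pose v0 := v - leaf_part a (v - o).
have [|t t01 E] := @mean_value_line _ _ f ('D_h f) v0 h 1 ltr01.
  move=> t t01; have tb := leaf_shrink_ball a t01 vb.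
  apply: DeriveDef => //; apply: diff_derivable.
  exact: smooth_differentiable sf tb.
have tb := leaf_shrink_ball a (subset_itv_oo_cc t01) vb.
move: E; rewrite mulr1 (derive_dir_sum _ (smooth_differentiable sf tb)) big1.
  by move/eqP; rewrite subr_eq0 => /eqP E; rewrite /leaf_shrink scale0r add0r.
by move=> i _; rewrite mxE; case: (boolP (a i)) => [ai|_]; rewrite ?scale0r // df ?scaler0.
Qed.

Lemma smooth_R_line n (o : 'rV[R]_n) r (f : 'rV[R]_n -> R) (b : 'rV[R]_n) (j : 'I_n) (D : set R) :
  smooth_rV (ball o r) f -> (forall t, D t -> ball o r (t *: delta_mx 0 j + b)) ->
  smooth_R D (fun t => f (t *: delta_mx 0 j + b)).
Proof.
move=> sf Db; pose e : 'rV[R]_n := delta_mx 0 j; pose line t := t *: e + b.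
pose T := line @^-1` ball o r.
have oT : open T.
  apply: open_comp; last exact: ball_open.
  move=> t _; apply: cvgD; last exact: cvg_cst.
  exact: scalel_continuous.
pose fk k := iter k (fun g => 'D_e g) f.
have sfk k : smooth_rV (ball o r) (fk k).
  by elim: k => [//|k IH]; exact: smooth_partial.
have dk k t : T t -> is_derive t 1 (fun s => fk k (line s)) (fk k.+1 (line t)).
  move=> Tt; apply: is_derive_line; apply: DeriveDef => //; apply: diff_derivable.
  exact: smooth_differentiable (sfk k) Tt.
have E k : forall t, T t -> fk k (line t) = derive1n k (f \o line) t.
  elim: k => [//|k IH] t Tt.
  rewrite derive1nS derive1E; have [_ <-] := dk k t Tt.
  by apply: near_eq_derive; exact: open_near_eq oT Tt IH.
move=> k t /Db Tt; have [d _] := dk k t Tt.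
by apply: near_eq_derivable d; exact: open_near_eq oT Tt (E k).
Qed.

Context {M : manifold R 3}.

(** Since the image of the chart is a ball centred at [o], every leaf meets the line through
[o] in the direction of the last coordinate, and [f] is determined by its values there. *)
Lemma function_of_last_coordinate (c : chart R 3 M) o r (f : M -> R) :
  smooth_chart c -> chart_coord c @` chart_dom c = ball o r -> smooth_on (chart_dom c) f ->
  (forall q, chart_dom c q -> act (coord_vf c (inord 0)) f q = 0 /\ act (coord_vf c (inord 1)) f q = 0) ->
  exists2 m : R -> R, smooth_R ((fun q => chart_coord c q 0 (inord 2)) @` chart_dom c) m &
    forall q, chart_dom c q -> f q = m (chart_coord c q 0 (inord 2)).
Proof.
move=> sc imc sf df; have oc := chart_dom_open c.
pose fh := f \o chart_param c; pose a : pred 'I_3 := fun i => i != inord 2.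
have sfh : smooth_rV (ball o r) fh.
  have := smooth_on_param sc oc sf; rewrite setIid imc; exact.
have dfh i v : a i -> ball o r v -> 'D_(delta_mx 0 i) fh v = 0.
  rewrite -imc => ai [q cq <-]; have [d0 d1] := df q cq.
  apply: etrans (esym (dfun_coord_vf i sc oc sf cq cq)) _.
  have D : forall j : 'I_3, a j -> act (coord_vf c j) f q = 0.
    apply: (@ord3P (fun j => a j -> act (coord_vf c j) f q = 0)).
    - by move=> _; exact: d0.
    - by move=> _; exact: d1.
    - by move=> a2; exfalso; move: a2; rewrite /a eqxx.
  exact: D i ai.
pose b : 'rV[R]_3 := \row_i (if a i then o 0 i else 0).
have bE (v : 'rV[R]_3) : v 0 (inord 2) *: delta_mx 0 (inord 2) + b = leaf_shrink a o 0 v.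
  apply/rowP => i; rewrite leaf_shrinkE mul0r addr0 !mxE /a /=.
  by case: (eqVneq i (inord 2)) => [->|_]; rewrite /= ?mulr1 ?addr0 ?mulr0 ?add0r.
have zero01 : (0 : R) \in `[0, 1] by rewrite in_itv /= lexx ler01.
exists (fun t => fh (t *: delta_mx 0 (inord 2) + b)).
  apply: (smooth_R_line sfh) => _ [q cq <-]; rewrite bE.
  by apply: leaf_shrink_ball => //; rewrite -imc; exists q.
move=> q cq; rewrite bE -(leafwise_constant sfh dfh) /fh /= ?chart_coordK //.
by rewrite -imc; exists q.
Qed.

End LeafConstant.

(* Keeps conversion from expanding frame identities into directional derivatives. *)
Local Opaque lie act dfun.

(** * Frame coefficients of the connection and the curvature equations *)

Section FrameCoefficients.
Context {R : realType} {M : manifold R 3}.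
Variables (S : almost_contact_metric M) (nabla : connection M).
Hypotheses (hK : almost_kenmotsu S) (L : levi_civita (g S) nabla).
Variables (U : set M) (E : vfield M).
Hypothesis fE : unit_section S U E.
Notation xi := (xi S).
Notation F := (phi_vf S E).
Notation gnabla := (gnabla S nabla).
Notation glie := (glie S).

Let oU : open U. Proof. by case: fE. Qed.
Let sE : smooth_vf U E. Proof. by case: fE. Qed.
Let sF : smooth_vf U F. Proof. by case: (phi_section_unit fE). Qed.
Let sx : smooth_vf U xi. Proof. exact: xi_smooth_on. Qed.

(** The entries [g(h E, E)] and [g(h E, phi E)], read off from
[nabla_E xi = E - phi (h E)]; that they are the entries of [h] is [h_op_frame]. *)
Definition hEE : M -> R := fun q => - gnabla E xi F q.
Definition hEF : M -> R := fun q => gnabla E xi E q - 1.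

Lemma hEE_smooth : smooth_on U hEE.
Proof. by apply: (smooth_onN oU); exact: gnabla_smooth. Qed.

Lemma hEF_smooth : smooth_on U hEF.
Proof. by apply: (smooth_onB oU); [exact: gnabla_smooth|exact: smooth_on_cst]. Qed.

Lemma frame_gfun : [/\ forall q, U q -> gfun S xi xi q = 1, forall q, U q -> gfun S E E q = 1,
  forall q, U q -> gfun S F F q = 1 &
  [/\ forall q, U q -> gfun S xi E q = 0, forall q, U q -> gfun S xi F q = 0,
     forall q, U q -> gfun S E F q = 0 & [/\ forall q, U q -> gfun S E xi q = 0,
     forall q, U q -> gfun S F xi q = 0 & forall q, U q -> gfun S F E q = 0]]].
Proof. by split; [..|split; [..|split]] => q Uq; rewrite /gfun !(frame_gE fE Uq). Qed.

Section At.
Variable q : M.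
Hypothesis Uq : U q.

Let half (a : R) : a = - a -> a = 0. Proof. lra. Qed.

Lemma gnabla_xi_xi X : smooth_vf U X -> gnabla X xi xi q = 0.
Proof.
move=> sX; apply: half; have [gx _ _ _] := frame_gfun.
exact: (gnabla_skew L oU Uq sX sx sx gx).
Qed.

Lemma gnabla_self X : smooth_vf U X -> gnabla X E E q = 0 /\ gnabla X F F q = 0.
Proof.
move=> sX; have [_ gEE gFF _] := frame_gfun; split; apply: half.
  exact: (gnabla_skew L oU Uq sX sE sE gEE).
exact: (gnabla_skew L oU Uq sX sF sF gFF).
Qed.

Lemma gnabla_swap X : smooth_vf U X -> [/\ gnabla X E F q = - gnabla X F E q,
  gnabla X E xi q = - gnabla X xi E q & gnabla X F xi q = - gnabla X xi F q].
Proof.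
move=> sX; have [_ _ _ [_ _ gEF [gEx gFx _]]] := frame_gfun; split.
- exact: (gnabla_skew L oU Uq sX sE sF gEF).
- exact: (gnabla_skew L oU Uq sX sE sx gEx).
- exact: (gnabla_skew L oU Uq sX sF sx gFx).
Qed.

(** By self-adjointness this is [g(nabla_X xi, xi)], half the derivative of a constant. *)
Lemma xi_geodesic X : smooth_vf U X -> gnabla xi xi X q = 0.
Proof. by move=> sX; rewrite (gnabla_xi_sym hK L oU Uq sx sX) gnabla_xi_xi. Qed.

(** The equation for [d Phi], evaluated on [xi], [E], [phi E], where all values of [Phi] are
constant. *)
Lemma kenmotsu_trace : glie xi E E q + glie xi F F q = -2.
Proof.
have [_ H] := hK; have K := H U xi E F oU sx sE sF q Uq.
have Phi (u : tangent q) : [/\ fundamental_form S u (F q) = - g S u (E q),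
    fundamental_form S u (xi q) = 0 & fundamental_form S u (E q) = g S u (F q)].
  by rewrite /fundamental_form (frame_phi_phi fE Uq) gNr phi_xi g0r.
have c1 : forall q, U q -> fundamental_form S (E q) (F q) = -1.
  by move=> p Up; rewrite /fundamental_form (frame_phi_phi fE Up) gNr (frame_gE fE Up).
have c2 : forall q, U q -> fundamental_form S (F q) (xi q) = 0.
  by move=> p Up; rewrite /fundamental_form phi_xi g0r.
have c3 : forall q, U q -> fundamental_form S (xi q) (E q) = 0.
  by move=> p Up; rewrite /fundamental_form -[phi S (E p)]/(F p) (frame_gE fE Up).
have [P1 _ _] := Phi (lie xi E q); have [_ P2 _] := Phi (lie E F q).
have [_ _ P3] := Phi (lie F xi q).
have P3' : g S (lie F xi q) (F q) = - glie xi F F q by rewrite (lie_antisym F xi) gNl.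
have A1 := act_locally_const xi oU Uq c1.
have A2 := act_locally_const E oU Uq c2.
have A3 := act_locally_const F oU Uq c3.
have lhs (a1 a2 a3 t1 t2 t3 x d : R) : a1 = 0 -> a2 = 0 -> a3 = 0 -> t1 = - x -> t2 = 0 ->
    t3 = - d -> a1 + a2 + a3 - t1 - t2 - t3 = x + d by move=> -> -> -> -> -> ->; ring.
have rhs (a1 a2 a3 t1 t2 t3 : R) : a1 = 1 -> t1 = -1 -> t2 = 0 -> t3 = 0 ->
    2 * (a1 * t1 + a2 * t2 + a3 * t3) = -2 by move=> -> -> -> ->; ring.
apply: etrans (esym (lhs _ _ _ _ _ _ _ _ A1 A2 A3 P1 P2 (etrans P3 P3'))) _.
apply: etrans K _.
exact: (rhs _ _ _ _ _ _ (eta_xi S q) (c1 q Uq) (c2 q Uq) (c3 q Uq)).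
Qed.

(** A self-adjoint operator on a plane with trace 2 depends on two functions. *)
Lemma frame_gnabla_xi : [/\ gnabla E xi E q = 1 + hEF q, gnabla E xi F q = - hEE q,
  gnabla F xi E q = - hEE q & gnabla F xi F q = 1 - hEF q].
Proof.
have EF : gnabla E xi E q + gnabla F xi F q = 2.
  have := kenmotsu_trace.
  rewrite -(gnabla_torsion L oU Uq E sx sE) -(gnabla_torsion L oU Uq F sx sF).
  have [-> _] := gnabla_self sx; have [_ ->] := gnabla_self sx; lra.
have sym : gnabla F xi E q = gnabla E xi F q by exact: (gnabla_xi_sym hK L oU Uq sF sE).
rewrite sym /hEE /hEF; split; move: EF; lra.
Qed.

Notation w := (gnabla xi E F q).

Lemma frame_glie_xi : [/\ glie xi E E q = - 1 - hEF q, glie xi E F q = w + hEE q,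
  glie xi F E q = hEE q - w, glie xi F F q = hEF q - 1 & glie xi E xi q = 0 /\ glie xi F xi q = 0].
Proof.
have [e1 e2 e3 e4] := frame_gnabla_xi; have [EE FF] := gnabla_self sx.
have [sEF sEx sFx] := gnabla_swap sx.
rewrite -!(gnabla_torsion L oU Uq) // e1 e2 e3 e4 EE FF sEx sFx !xi_geodesic // !gnabla_xi_xi //.
by split; [move: sEF; lra..|split; lra].
Qed.

(** Expand the Lie derivative with the brackets of [xi] with the frame; the rotation [w] of
the frame along [xi] commutes with [phi] and drops out. *)
Lemma h_op_frame : h_op S E q = hEE q *: E q + hEF q *: F q /\
  h_op S F q = hEF q *: E q - hEE q *: F q.
Proof.
have [bEE bEF bFE bFF [bEx bFx]] := frame_glie_xi.
have dE : lie xi E q = (-1 - hEF q) *: E q + (w + hEE q) *: F q.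
  apply: etrans (frame_decomp fE Uq _) _.
  rewrite -[g S _ (E q)]/(glie xi E E q) -[g S _ (F q)]/(glie xi E F q) -[g S _ (xi q)]/(glie xi E xi q).
  by rewrite bEE bEF bEx scale0r addr0.
have dF : lie xi F q = (hEE q - w) *: E q + (hEF q - 1) *: F q.
  apply: etrans (frame_decomp fE Uq _) _.
  rewrite -[g S _ (E q)]/(glie xi F E q) -[g S _ (F q)]/(glie xi F F q) -[g S _ (xi q)]/(glie xi F xi q).
  by rewrite bFE bFF bFx scale0r addr0.
have pF : phi S (F q) = - E q by exact: (frame_phi_phi fE Uq).
rewrite /h_op /lie_endo -[fun q => phi S (E q)]/F.
have -> : lie xi (fun p => phi S (F p)) q = - lie xi E q.
  have e : forall p, U p -> phi S (F p) = (-1) *: E p.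
    by move=> p Up; rewrite scaleN1r; exact: (frame_phi_phi fE Up).
  rewrite (lie_local xi oU Uq e) (lie_leibniz oU sx sE (smooth_on_cst U (-1)) Uq).
  by rewrite (act_locally_const (a := -1) xi oU Uq) // scale0r add0r scaleN1r.
rewrite dE dF !phiD !phiZ pF -[phi S (E q)]/(F q).
move: (E q) (F q) w (hEE q) (hEF q) => e f ww a b; split; apply/rowP => i; rewrite !mxE.
  by field.
by field.
Qed.

End At.

Lemma act_hEE X q : U q -> act X hEE q = - act X (gnabla E xi F) q.
Proof. by move=> Uq; apply: (dfun_oppf oU Uq); exact: gnabla_smooth. Qed.

Lemma act_hEF X q : U q -> act X hEF q = act X (gnabla E xi E) q.
Proof.
move=> Uq; have sc : smooth_on U (gnabla E xi E) by exact: gnabla_smooth.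
apply: etrans (dfun_subf oU Uq (X q) sc (smooth_on_cst U 1)) _.
by rewrite dfun_cst subr0.
Qed.

Section Curvature.
Variables (kappa mu : M -> R).
Hypothesis hkm : generalized_kappa_mu S nabla kappa mu.
Variable q : M.
Hypothesis Uq : U q.
Notation w := (gnabla xi E F q).

Lemma act_gnabla_F X : act X (gnabla F xi E) q = - act X hEE q /\ act X (gnabla F xi F) q = - act X hEF q.
Proof.
split.
  rewrite (act_hEE X Uq) opprK; apply: (act_local X oU Uq) => p Up.
  by have [_ -> -> _] := frame_gnabla_xi Up.
have e : forall p, U p -> gnabla F xi F p = 1 - hEF p.
  by move=> p Up; have [_ _ _ ->] := frame_gnabla_xi Up.
apply: etrans (act_local X oU Uq e) _.
apply: etrans (dfun_subf oU Uq (X q) (smooth_on_cst U 1) hEF_smooth) _.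
by rewrite dfun_cst sub0r.
Qed.

Let g_horizontal (u v : tangent q) a b c d : g S u (E q) = a -> g S u (F q) = b ->
  g S u (xi q) = 0 -> g S v (E q) = c -> g S v (F q) = d -> g S u v = a * c + b * d.
Proof. by move=> <- <- ux <- <-; rewrite (parseval fE Uq u v) ux mul0r addr0. Qed.

(** The components of the curvature equation for [R(xi, E) xi] along [E] and [phi E], and of
the one for [R(xi, phi E) xi] along [phi E]. *)
Lemma frame_curvature :
  [/\ act xi hEF q + 2 * hEE q * w + (1 + hEF q) ^+ 2 + hEE q ^+ 2 = - kappa q - mu q * hEE q,
   - act xi hEE q + 2 * hEF q * w - 2 * hEE q = - mu q * hEF q &
   - act xi hEF q - 2 * hEE q * w + hEE q ^+ 2 + (1 - hEF q) ^+ 2 = - kappa q + mu q * hEE q].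
Proof.
have [_ _ HR] := hkm.
have [e1 e2 e3 e4] := frame_gnabla_xi Uq; have [hE hF] := h_op_frame Uq.
have [bEE bEF bFE bFF [bEx bFx]] := frame_glie_xi Uq.
have [sEF _ _] := gnabla_swap Uq sx.
have [xEE xFF] := gnabla_self Uq sx.
have nx0 : nabla xi xi q = 0.
  by apply: (frame_eq fE Uq); rewrite g0l; apply: (xi_geodesic Uq).
have eE : eta S (E q) = 0 by have [_ _ /(_ q Uq) []] := fE.
have eF : eta S (F q) = 0 by rewrite /phi_vf eta_phi.
have gg := frame_gE fE Uq.
have [cF1 cF2] := act_gnabla_F xi.
have cE1 := act_hEE xi Uq; have cE2 := act_hEF xi Uq.
have x0 X Z : smooth_vf U Z -> act X (gnabla xi xi Z) q = 0.
  by move=> sZ; apply: (act_locally_const X oU Uq) => p Up; exact: (xi_geodesic Up sZ).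
have gx0 (v : tangent q) : g S (nabla xi xi q) v = 0 by rewrite nx0 g0l.
have Exx := gnabla_xi_xi Uq sE; have Fxx := gnabla_xi_xi Uq sF.
have KE := HR U xi E oU sx sE q Uq; have KF := HR U xi F oU sx sF q Uq.
rewrite eE eF eta_xi hE hF in KE KF.
have C1 := curvature_xi hK L oU Uq sx sE sE.
have C2 := curvature_xi hK L oU Uq sx sE sF.
have C4 := curvature_xi hK L oU Uq sx sF sF.
have G1 : g S (curvature nabla xi E xi q) (E q) = - kappa q - mu q * hEE q.
  by rewrite KE !gE !gg; ring.
have G2 : g S (curvature nabla xi E xi q) (F q) = - mu q * hEF q.
  by rewrite KE !gE !gg; ring.
have G4 : g S (curvature nabla xi F xi q) (F q) = - kappa q + mu q * hEE q.
  by rewrite KF !gE !gg; ring.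
(* Assembles the values of the terms of curvature_xi; those with nabla_xi xi vanish. *)
have comb (G a t1 b t2 t3 G' a' t1' t3' : R) : G = (a - t1) - (b - t2) - t3 ->
    G = G' -> a = a' -> t1 = t1' -> b = 0 -> t2 = 0 -> t3 = t3' -> G' = a' - t1' - t3'.
  by move=> E1 E2 E3 E4 E5 E6 E7; rewrite -E2 E1 E3 E4 E5 E6 E7; ring.
have xEF : gnabla xi F E q = - w by rewrite sEF opprK.
have wE : g S (nabla xi E q) (F q) = w by [].
have R1 := comb _ _ _ _ _ _ _ _ _ _ C1 G1 (esym cE2) (g_horizontal e1 e2 Exx xEE wE)
  (x0 E E sE) (gx0 _) (g_horizontal e1 e2 Exx bEE bEF).
have cE1' : act xi (gnabla E xi F) q = - act xi hEE q by rewrite cE1 opprK.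
have R2 := comb _ _ _ _ _ _ _ _ _ _ C2 G2 cE1' (g_horizontal e1 e2 Exx xEF xFF)
  (x0 E F sF) (gx0 _) (g_horizontal e3 e4 Fxx bEE bEF).
have R4 := comb _ _ _ _ _ _ _ _ _ _ C4 G4 cF2 (g_horizontal e3 e4 Fxx xEF xFF)
  (x0 F F sF) (gx0 _) (g_horizontal e3 e4 Fxx bFE bFF).
move: R1 R2 R4; move: (act xi hEE q) (act xi hEF q) w (hEE q) (hEF q) (kappa q) (mu q) => da db ww a b k m.
by move=> R1 R2 R4; split; [rewrite R1|rewrite R2|rewrite R4]; ring.
Qed.

End Curvature.
End FrameCoefficients.

(** * Smooth eigenvectors of h *)

Section EigenSection.
Context {R : realType} {M : manifold R 3}.
Variable S : almost_contact_metric M.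
Notation xi := (xi S).

(** The derivatives of [f] and [k] produced by the two brackets in [h] cancel, because
[phi] is pointwise linear. *)
Lemma h_op_comb U (X Y : vfield M) (f k : M -> R) q : open U -> smooth_vf U X -> smooth_vf U Y ->
  smooth_on U f -> smooth_on U k -> U q ->
  h_op S (fun q => f q *: X q + k q *: Y q) q = f q *: h_op S X q + k q *: h_op S Y q.
Proof.
move=> oU sX sY sf sk Uq.
have sx : smooth_vf U xi by exact: xi_smooth_on.
have sphi Z : smooth_vf U Z -> smooth_vf U (fun q => phi S (Z q)).
  by have [_ H] := phi_smooth S; exact: H.
have e : (fun q => phi S (f q *: X q + k q *: Y q)) =
    (fun q => f q *: phi S (X q) + k q *: phi S (Y q)).
  by apply: functional_extensionality_dep => p; rewrite phiD !phiZ.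
have fin (df dk ff kk : R) (x y u v s t : tangent q) :
    2^-1 *: ((df *: phi S x + ff *: u) + (dk *: phi S y + kk *: v)
       - phi S ((df *: x + ff *: s) + (dk *: y + kk *: t)))
    = ff *: (2^-1 *: (u - phi S s)) + kk *: (2^-1 *: (v - phi S t)).
  rewrite !phiD !phiZ; move: (phi S x) (phi S y) (phi S s) (phi S t) => a b c d.
  by apply/rowP => i; rewrite !mxE; ring.
have lin A B : smooth_vf U A -> smooth_vf U B ->
    lie xi (fun q => f q *: A q + k q *: B q) q =
    (act xi f q *: A q + f q *: lie xi A q) + (act xi k q *: B q + k q *: lie xi B q).
  move=> sA sB; apply: etrans (lieDr oU sx (smooth_vfZ sf sA) (smooth_vfZ sk sB) Uq) _.
  exact: (congr2 +%R (lie_leibniz oU sx sA sf Uq) (lie_leibniz oU sx sB sk Uq)).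
rewrite /h_op /lie_endo e (lin _ _ (sphi _ sX) (sphi _ sY)) (lin _ _ sX sY).
exact: fin.
Qed.

(** Only near [p], where [V] does not vanish. *)
Lemma unit_section_normalize U (V : vfield M) p : open U -> U p -> smooth_vf U V ->
  (forall q, U q -> eta S (V q) = 0) -> V p != 0 ->
  exists U', [/\ U' p, U' `<=` U, smooth_on U' (fun q => (Num.sqrt (g S (V q) (V q)))^-1) &
    unit_section S U' (fun q => (Num.sqrt (g S (V q) (V q)))^-1 *: V q)].
Proof.
move=> oU Up sV eV V0.
have sg : smooth_on U (fun q => g S (V q) (V q)) by exact: gfun_smooth.
pose U' := U `&` [set q | 0 < g S (V q) (V q)].
have oU' : open U' by exact: smooth_on_gt0_open.
have U'U : U' `<=` U by move=> q [].
have ss : smooth_on U' (fun q => Num.sqrt (g S (V q) (V q))).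
  by apply: (smooth_on_sqrt oU') => [q []//|]; exact: smooth_on_sub U'U sg.
have si : smooth_on U' (fun q => (Num.sqrt (g S (V q) (V q)))^-1).
  by apply: (smooth_onV oU') => // q [_ gV]; rewrite gt_eqF // sqrtr_gt0.
exists U'; split => //; first by split => //; exact: g_pos.
split => //; first by apply: smooth_vfZ => //; exact: smooth_vf_sub U'U sV.
move=> q [Uq /= gV]; rewrite gZl gZr etaZ eV // mulr0; split => //.
have s0 : 0 < Num.sqrt (g S (V q) (V q)) by rewrite sqrtr_gt0.
rewrite -{3}(sqr_sqrtr (ltW gV)) expr2; field.
by rewrite gt_eqF.
Qed.

Lemma coord_vf_chart_at (p : M) i : coord_vf (chart_at p) i p = (delta_mx 0 i : 'rV[R]_3) :> tangent p.
Proof.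
have sc := chart_at_smooth p; have cp := chart_at_dom p.
have oc := chart_dom_open (chart_at p).
apply/rowP => j; rewrite -dfun_chart_at.
apply: etrans (dfun_coord_vf i sc oc (smooth_on_coord j sc) cp cp) _.
rewrite -(derive_coord j (chart_coord (chart_at p) p)); apply: near_eq_derive.
have := near_chart openT cp I; apply: filterS => x [q [cq _] <-].
by rewrite /= chart_coordK.
Qed.

(** The projections to the kernel of [eta] of the three coordinate fields cannot all vanish
at [p], otherwise all of them would be multiples of [xi p]. *)
Lemma exists_unit_section (p : M) : exists U E, U p /\ unit_section S U E.
Proof.
pose c := chart_at p; pose U := chart_dom c.
have oU : open U by exact: chart_dom_open.
have Up : U p by exact: chart_at_dom.
pose V i : vfield M := fun q => coord_vf c i q - eta S (coord_vf c i q) *: xi q.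
have sx : smooth_vf U xi by exact: xi_smooth_on.
have sc i : smooth_vf U (coord_vf c i) by apply: coord_vf_smooth; exact: chart_at_smooth.
have sV i : smooth_vf U (V i).
  apply: smooth_vfB => //; apply: smooth_vfZ => //.
  by have [_ H] := eta_smooth S; exact: H.
have eV i q : eta S (V i q) = 0.
  by rewrite /V -scaleNr etaD etaZ eta_xi mulr1 subrr.
have [i Vi] : exists i, V i p != 0.
  apply: contrapT => H.
  have V0 i : V i p = 0 by apply/eqP/negPn/negP => Vi; apply: H; exists i.
  have E i j : (i == j)%:R = eta S (coord_vf c i p) * (xi p : 'rV[R]_3) 0 j.
    have /eqP := V0 i; rewrite subr_eq0 coord_vf_chart_at => /eqP.
    by move=> /(congr1 (fun v : 'rV[R]_3 => v 0 j)); rewrite !mxE eqxx eq_sym.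
  have contra (a b x y : R) : 1 = b * y -> 0 = a * y -> 1 = a * x -> False.
    move=> h1 h2 h3; have /eqP : b * y * (a * x) = 0.
      have -> : b * y * (a * x) = a * y * (b * x) by ring.
      by rewrite -h2 mul0r.
    by rewrite -h1 -h3 mulr1 oner_eq0.
  have e11 := E (inord 1) (inord 1); have e01 := E (inord 0) (inord 1); have e00 := E (inord 0) (inord 0).
  rewrite eqxx in e11; rewrite eqxx in e00; rewrite !ord3_eq in e01.
  exact: contra e11 e01 e00.
have [U' [U'p _ _ fE]] := unit_section_normalize oU Up (sV i) (fun q _ => eV i q) Vi.
by exists U', (fun q => (Num.sqrt (g S (V i q) (V i q)))^-1 *: V i q).
Qed.

Variables (nabla : connection M) (kappa mu : M -> R).
Hypotheses (hK : almost_kenmotsu S) (L : levi_civita (g S) nabla)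
  (hkm : generalized_kappa_mu S nabla kappa mu) (hkappa : forall p, kappa p < -1).

Definition lambda : M -> R := fun q => Num.sqrt (-1 - kappa q).

Lemma lambda_gt0 q : 0 < lambda q.
Proof. by rewrite sqrtr_gt0 subr_gt0. Qed.

Lemma lambda_sqr q : lambda q ^+ 2 = -1 - kappa q.
Proof. by rewrite sqr_sqrtr // subr_ge0 ltW. Qed.

Lemma lambda_smooth : smooth_on setT lambda.
Proof.
have [sk _ _] := hkm.
apply: (smooth_on_sqrt openT); first by move=> q _; rewrite subr_gt0.
by apply: (smooth_onB openT) => //; exact: smooth_on_cst.
Qed.

(** In the sum of the first and the last equation of [frame_curvature] the derivatives
along [xi], the rotation [w] and the terms with [mu] cancel. *)
Lemma hEE_hEF_sqr U E q : unit_section S U E -> U q ->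
  hEE S nabla E q ^+ 2 + hEF S nabla E q ^+ 2 = lambda q ^+ 2.
Proof.
move=> fE Uq; have [R1 _ R3] := frame_curvature hK L fE hkm Uq.
rewrite lambda_sqr; move: R1 R3; lra.
Qed.

(** Replacing [E] by [phi E] changes the sign of [hEE], and [lambda] is positive. *)
Lemma exists_section_hEE (p : M) : exists U E, [/\ U p, unit_section S U E &
  0 < lambda p + hEE S nabla E p].
Proof.
have [U [E [Up fE]]] := exists_unit_section p.
have sq := hEE_hEF_sqr fE Up; have l0 := lambda_gt0 p.
have [a0|a0] := ltP 0 (lambda p + hEE S nabla E p); first by exists U, E.
have fF := phi_section_unit fE.
exists U, (phi_vf S E); split => //.
have [hE hF] := h_op_frame hK L fE Up; have [hF' _] := h_op_frame hK L fF Up.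
have : g S (h_op S (phi_vf S E) p) (phi_vf S E p) = - hEE S nabla E p.
  by rewrite hF !gE !(frame_gE fE Up); ring.
rewrite hF' !gE !(frame_gE fF Up) mulr1 mulr0 addr0 => ->.
by move: a0 l0; lra.
Qed.

(** The image of [E] under [h + lambda], that is [(lambda + hEE) E + hEF phi E], is an
eigenvector because [h^2 = lambda^2] on the kernel of [eta]; it is nonzero at [p] by the
choice of [E]. *)
Lemma exists_eigen_section (p : M) : exists U X, [/\ U p, unit_section S U X &
  forall q, U q -> h_op S X q = lambda q *: X q].
Proof.
have [U [E [Up fE a0]]] := exists_section_hEE p.
have [oU sE uE] := fE; have [_ sF uF] := phi_section_unit fE.
have sal := hEE_smooth L fE; have sbe := hEF_smooth L fE.
have sl : smooth_on U lambda by exact: smooth_on_sub (@subsetT _ U) lambda_smooth.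
pose A := hEE S nabla E; pose B := hEF S nabla E.
have sA : smooth_on U (fun q => lambda q + A q) by exact: smooth_onD.
pose V : vfield M := fun q => (lambda q + A q) *: E q + B q *: phi_vf S E q.
have sV : smooth_vf U V by apply: smooth_vfD => //; exact: smooth_vfZ.
have eV q : U q -> eta S (V q) = 0.
  by move=> Uq; have [_ e1] := uE q Uq; have [_ e2] := uF q Uq; rewrite etaD !etaZ e1 e2 !mulr0 addr0.
have hV q : U q -> h_op S V q = lambda q *: V q.
  move=> Uq; rewrite (h_op_comb oU sE sF sA sbe Uq).
  have [-> ->] := h_op_frame hK L fE Uq; have := hEE_hEF_sqr fE Uq.
  rewrite -/A -/B /V; move: (A q) (B q) (lambda q) (E q) (phi_vf S E q) => a b l e f ab.
  apply/rowP => i; rewrite !mxE; move: (e 0 i) (f 0 i) => ei fi.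
  have -> : (l + a) * (a * ei + b * fi) + b * (b * ei - a * fi) =
    (l * a + (a ^+ 2 + b ^+ 2)) * ei + l * b * fi by ring.
  by rewrite ab; ring.
have V0 : V p != 0.
  apply/eqP => V0; have := congr1 (fun v : tangent p => g S v (E p)) V0.
  rewrite /V !gE !(frame_gE fE Up) mulr1 mulr0 addr0 => E0.
  by rewrite E0 ltxx in a0.
have [U' [U'p U'U sn fX]] := unit_section_normalize oU Up sV eV V0.
set N := fun q => (Num.sqrt (g S (V q) (V q)))^-1 in sn fX *.
exists U', (fun q => N q *: V q); split => // q U'q.
have oU' : open U' by case: fX.
have sV' := smooth_vf_sub U'U sV.
have := h_op_comb oU' sV' sV' sn (smooth_on_cst U' 0) U'q.
have -> : (fun q => N q *: V q + (cst 0 : M -> R) q *: V q) = (fun q => N q *: V q).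
  by apply: functional_extensionality_dep => x; rewrite scale0r addr0.
by move=> ->; rewrite scale0r addr0 hV; [rewrite !scalerA mulrC|exact: U'U].
Qed.

End EigenSection.

(** * Structure equations of the eigenframe *)

Section EigenStructure.
Context {R : realType} {M : manifold R 3}.
Variables (S : almost_contact_metric M) (nabla : connection M) (kappa mu : M -> R).
Hypotheses (hK : almost_kenmotsu S) (L : levi_civita (g S) nabla)
  (hkm : generalized_kappa_mu S nabla kappa mu) (hkappa : forall p, kappa p < -1)
  (hdkappa : forall p (u v : tangent p), wedge11 (dfun kappa) (eta S) u v = 0).
Variables (U : set M) (X : vfield M).
Hypotheses (fX : unit_section S U X) (hX : forall q, U q -> h_op S X q = lambda kappa q *: X q).
Notation xi := (xi S).
Notation F := (phi_vf S X).
Notation gnabla := (gnabla S nabla).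
Notation glie := (glie S).
Notation lambda := (lambda kappa).

Let oU : open U. Proof. by case: fX. Qed.
Let sX : smooth_vf U X. Proof. by case: fX. Qed.
Let sF : smooth_vf U F. Proof. by case: (phi_section_unit fX). Qed.
Let sx : smooth_vf U xi. Proof. exact: xi_smooth_on. Qed.
Let sk : smooth_on U kappa.
Proof. by have [sk _ _] := hkm; exact: smooth_on_sub (@subsetT _ U) sk. Qed.
Let sl : smooth_on U lambda.
Proof. exact: smooth_on_sub (@subsetT _ U) (lambda_smooth hkm hkappa). Qed.

Lemma eigen_hEE_hEF q : U q -> hEE S nabla X q = lambda q /\ hEF S nabla X q = 0.
Proof.
move=> Uq; have [hE _] := h_op_frame hK L fX Uq.
have e1 := congr1 (fun v : tangent q => g S v (X q)) hE.
have e2 := congr1 (fun v : tangent q => g S v (F q)) hE.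
rewrite hX // !gE !(frame_gE fX Uq) in e1 e2.
by move: e1 e2; rewrite !mulr0 !mulr1 addr0 add0r.
Qed.

(** Evaluate [d kappa /\ eta = 0] on [v] and [xi]. *)
Lemma horizontal_kappa q (v : tangent q) : eta S v = 0 -> dfun kappa v = 0.
Proof.
move=> ev; have := hdkappa v (xi q); rewrite /wedge11 eta_xi ev mulr1 mulr0 subr0.
exact.
Qed.

Lemma dfun_kappa_lambda q (v : tangent q) : U q -> dfun kappa v = - 2 * lambda q * dfun lambda v.
Proof.
move=> Uq.
have e : forall p, U p -> kappa p = -1 - lambda p * lambda p.
  by move=> p _; rewrite -expr2 lambda_sqr //; ring.
have E1 := dfun_near v oU Uq e.
have E2 := dfun_subf oU Uq v (smooth_on_cst U (-1)) (smooth_onM oU sl sl).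
have E3 := dfun_mulf oU Uq v sl sl.
have E0 := dfun_cst (-1) v.
apply: etrans E1 _; apply: etrans E2 _; apply: etrans (congr2 (fun a b => a - b) E0 E3) _.
by move: (dfun lambda v) (lambda q) => a b; ring.
Qed.

Lemma horizontal_lambda q (v : tangent q) : U q -> eta S v = 0 -> dfun lambda v = 0.
Proof.
move=> Uq ev; have := dfun_kappa_lambda v Uq; rewrite (horizontal_kappa ev) => /esym/eqP.
by rewrite !mulf_eq0 oppr_eq0 pnatr_eq0 /= (gt_eqF (lambda_gt0 hkappa q)) => /eqP.
Qed.

Section At.
Variable q : M.
Hypothesis Uq : U q.

Let eX : eta S (X q) = 0. Proof. by have [_ _ /(_ q Uq) []] := fX. Qed.
Let eF : eta S (F q) = 0. Proof. by rewrite /phi_vf eta_phi. Qed.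

Let act_hEE0 (Z : vfield M) : eta S (Z q) = 0 -> act Z (hEE S nabla X) q = 0.
Proof.
move=> eZ; have e : forall p, U p -> hEE S nabla X p = lambda p by move=> p /eigen_hEE_hEF [].
by rewrite (act_local Z oU Uq e); exact: horizontal_lambda.
Qed.

Let act_hEF0 (Z : vfield M) : act Z (hEF S nabla X) q = 0.
Proof.
have e : forall p, U p -> hEF S nabla X p = 0 by move=> p /eigen_hEE_hEF [].
exact: (act_locally_const Z oU Uq e).
Qed.

(** With [hEE = lambda] and [hEF = 0] the first two equations of [frame_curvature] give
[2 lambda w = - lambda mu] and the derivative of [lambda]. *)
Lemma eigen_w : gnabla xi X F q = - mu q / 2 /\ act xi lambda q = -2 * lambda q.
Proof.
have [R1 R2 _] := frame_curvature hK L fX hkm Uq.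
have l2 := lambda_sqr hkappa q; have l0 := lambda_gt0 hkappa q.
have e : forall p, U p -> hEE S nabla X p = lambda p by move=> p /eigen_hEE_hEF [].
have e1 := act_local xi oU Uq e.
have [aq bq] := eigen_hEE_hEF Uq.
rewrite (act_hEF0 xi) aq bq in R1; rewrite e1 aq bq in R2.
split; last by move: R2; lra.
have : lambda q * (2 * gnabla xi X F q + mu q) = 0.
  by move: R1 l2; move: (gnabla xi X F q) (lambda q) (mu q) (kappa q) => w l m k R1 l2; lra.
move/eqP; rewrite mulf_eq0 (gt_eqF l0) /= => /eqP; lra.
Qed.

Let g_horizontal (u v : tangent q) a b c d : g S u (X q) = a -> g S u (F q) = b ->
  g S u (xi q) = 0 -> g S v (X q) = c -> g S v (F q) = d -> g S u v = a * c + b * d.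
Proof. by move=> <- <- ux <- <-; rewrite (parseval fX Uq u v) ux mul0r addr0. Qed.

(** The components of [R(X, phi X) xi = 0] along [X] and [phi X] are the Codazzi equations
of [nabla xi]. The coefficients of [nabla xi] are constant along [X] and [phi X], so what
remains is [lambda B = 0] and [lambda A = 0], where [A] and [B] are also the components of
[[X, phi X]] up to sign; the component along [xi] vanishes as [nabla xi] is self-adjoint. *)
Lemma eigen_commute : lie X F q = 0.
Proof.
have [_ _ HR] := hkm.
have [e1 e2 e3 e4] := frame_gnabla_xi hK L fX Uq.
have [aq bq] := eigen_hEE_hEF Uq; have l0 := lambda_gt0 hkappa q.
rewrite aq bq ?addr0 ?subr0 in e1 e2 e3 e4.
have [XA _ XAx] := gnabla_swap L fX Uq sX; have [FB FBx _] := gnabla_swap L fX Uq sF.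
have [XXX XFF] := gnabla_self L fX Uq sX; have [FXX FFF] := gnabla_self L fX Uq sF.
have Xxx := gnabla_xi_xi L fX Uq sX; have Fxx := gnabla_xi_xi L fX Uq sF.
have [cFX cFF] := act_gnabla_F hK L fX Uq X.
have cXF := act_hEE L fX F Uq; have cXX := act_hEF L fX F Uq.
rewrite act_hEE0 ?eX // oppr0 in cFX; rewrite act_hEF0 oppr0 in cFF.
rewrite act_hEE0 ?eF // in cXF; rewrite act_hEF0 in cXX.
set A := gnabla X X F q in XA *; set B := gnabla F X F q in FB *.
have XA' : gnabla X F X q = - A by rewrite XA opprK.
have FB' : gnabla F F X q = - B by rewrite FB opprK.
have bX : glie X F X q = - A by rewrite -(gnabla_torsion L oU Uq X sX sF) XA' FXX subr0.
have bF : glie X F F q = - B by rewrite -(gnabla_torsion L oU Uq F sX sF) XFF sub0r.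
have bx : glie X F xi q = 0.
  by rewrite -(gnabla_torsion L oU Uq xi sX sF) XAx FBx e2 e3 subrr.
have K := HR U X F oU sX sF q Uq.
have K0 : curvature nabla X F xi q = 0.
  have fin (a b c d : tangent q) (k m : R) :
    k *: (0 *: a - 0 *: b) + m *: (0 *: c - 0 *: d) = 0.
    by rewrite !scale0r subrr !scaler0 addr0.
  apply: etrans K _; rewrite eX eF; exact: fin.
have G0 (u : tangent q) : g S (curvature nabla X F xi q) u = 0 by rewrite K0 g0l.
have C5 := curvature_xi hK L oU Uq sX sF sX.
have C6 := curvature_xi hK L oU Uq sX sF sF.
have comb (G a t1 b t2 t3 a' t1' b' t2' t3' : R) : G = (a - t1) - (b - t2) - t3 ->
    G = 0 -> a = a' -> t1 = t1' -> b = b' -> t2 = t2' -> t3 = t3' -> 0 = (a' - t1') - (b' - t2') - t3'.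
  by move=> E1 E2 E3 E4 E5 E6 E7; rewrite -E2 E1 E3 E4 E5 E6 E7.
have AE : g S (nabla X X q) (F q) = A by [].
have BE : g S (nabla F X q) (F q) = B by [].
have cXF' : act F (gnabla X xi F) q = 0 by move: cXF => /esym/eqP; rewrite oppr_eq0 => /eqP.
have R5 := comb _ _ _ _ _ _ _ _ _ _ _ C5 (G0 _) cFX (g_horizontal e3 e4 Fxx XXX AE)
  (esym cXX) (g_horizontal e1 e2 Xxx FXX BE) (g_horizontal e1 e2 Xxx bX bF).
have R6 := comb _ _ _ _ _ _ _ _ _ _ _ C6 (G0 _) cFF (g_horizontal e3 e4 Fxx XA' XFF)
  cXF' (g_horizontal e1 e2 Xxx FB' FFF) (g_horizontal e3 e4 Fxx bX bF).
have [A0 B0] : A = 0 /\ B = 0.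
  have fin (a b l : R) : 0 < l -> 0 = (0 - (- l * 0 + 1 * a)) - (0 - (1 * 0 + - l * b))
      - (1 * (- a) + - l * (- b)) -> 0 = (0 - (- l * (- a) + 1 * 0)) - (0 - (1 * (- b) + - l * 0))
      - (- l * (- a) + 1 * (- b)) -> a = 0 /\ b = 0.
    move=> l1 h5 h6; have {}h5 : l * b = 0 by move: h5; lra.
    have {}h6 : l * a = 0 by move: h6; lra.
    by split; apply/eqP; [move/eqP: h6|move/eqP: h5]; rewrite mulf_eq0 (gt_eqF l1).
  exact: (fin _ _ _ l0 R5 R6).
apply: (frame_eq fX Uq); rewrite g0l.
- by apply: etrans bX _; rewrite A0 oppr0.
- by apply: etrans bF _; rewrite B0 oppr0.
- exact: bx.
Qed.

Lemma eigen_lie_xi : lie xi X q = - X q + (lambda q - mu q / 2) *: F q /\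
  lie xi F q = (lambda q + mu q / 2) *: X q - F q.
Proof.
have [b1 b2 b3 b4 [b5 b6]] := frame_glie_xi hK L fX Uq.
have [aq bq] := eigen_hEE_hEF Uq; have [wq _] := eigen_w.
rewrite aq bq wq in b1 b2 b3 b4.
split; apply: etrans (frame_decomp fX Uq _) _.
  have -> : g S (lie xi X q) (X q) = -1 by apply: etrans b1 _; ring.
  have -> : g S (lie xi X q) (F q) = lambda q - mu q / 2 by apply: etrans b2 _; ring.
  have -> : g S (lie xi X q) (xi q) = 0 by exact: b5.
  by rewrite scale0r addr0 scaleN1r.
have -> : g S (lie xi F q) (X q) = lambda q + mu q / 2 by apply: etrans b3 _; ring.
have -> : g S (lie xi F q) (F q) = -1 by apply: etrans b4 _; ring.
have -> : g S (lie xi F q) (xi q) = 0 by exact: b6.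
by rewrite scale0r addr0 scaleN1r.
Qed.

Lemma eigen_kappa : [/\ act X kappa q = 0, act F kappa q = 0 & act xi kappa q = - 4 * (kappa q + 1)].
Proof.
split; [exact: horizontal_kappa eX|exact: horizontal_kappa eF|].
apply: etrans (dfun_kappa_lambda (xi q) Uq) _.
have [_ xl] := eigen_w; have l2 := lambda_sqr hkappa q.
have -> : dfun lambda (xi q) = -2 * lambda q by exact: xl.
have -> : kappa q = -1 - lambda q ^+ 2 by rewrite l2; ring.
by ring.
Qed.

End At.
End EigenStructure.

(** * The components of xi in the adapted coordinates *)

Section Coordinates.
Context {R : realType} {M : manifold R 3}.
Variables (S : almost_contact_metric M) (nabla : connection M) (kappa mu : M -> R).
Hypotheses (hK : almost_kenmotsu S) (L : levi_civita (g S) nabla)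
  (hkm : generalized_kappa_mu S nabla kappa mu) (hkappa : forall p, kappa p < -1)
  (hdkappa : forall p (u v : tangent p), wedge11 (dfun kappa) (eta S) u v = 0).
Notation xi := (xi S).

Lemma h_op_xi q : h_op S xi q = 0 *: xi q.
Proof.
have sx := xi_smooth S.
have ll : lie xi xi q = 0.
  have half (v : 'rV[R]_3) : v = - v -> v = 0.
    by move=> vN; apply/rowP => i; have /rowP /(_ i) := vN; rewrite !mxE; lra.
  exact: half (lie_antisym xi xi q).
have l0 : lie xi (fun q => phi S (xi q)) q = 0.
  have e : forall p, [set: M] p -> phi S (xi p) = (cst 0 : M -> R) p *: xi p.
    by move=> p _; rewrite phi_xi scale0r.
  rewrite (lie_local xi openT I e) (lie_leibniz openT sx sx (smooth_on_cst _ 0) I).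
  by rewrite (act_locally_const (a := 0) xi openT I) // !scale0r addr0.
have p0 : phi S (0 : tangent q) = 0 by rewrite -(scale0r (0 : tangent q)) phiZ !scale0r.
by rewrite /h_op /lie_endo l0 ll p0 subrr scaler0 scale0r.
Qed.

Section InChart.
Variables (U : set M) (X : vfield M) (c : chart R 3 M).
Hypotheses (fX : unit_section S U X) (hX : forall q, U q -> h_op S X q = lambda kappa q *: X q)
  (sc : smooth_chart c) (cU : chart_dom c `<=` U)
  (cz : forall q, chart_coord c q 0 (inord 2) = kappa q).
Notation F := (phi_vf S X).
Notation W := (chart_dom c).
Notation lambda := (lambda kappa).
Let x q : R := chart_coord c q 0 (inord 0).
Let y q : R := chart_coord c q 0 (inord 1).
Hypotheses (Xc : forall q, W q -> act X x q = 1 /\ act X y q = 0)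
  (Fc : forall q, W q -> act F x q = 0 /\ act F y q = 1).

Let oW : open W. Proof. exact: chart_dom_open. Qed.
Let sX : smooth_vf W X. Proof. by case: fX => _ sX _; exact: smooth_vf_sub cU sX. Qed.
Let sF : smooth_vf W F.
Proof. by case: (phi_section_unit fX) => _ sF _; exact: smooth_vf_sub cU sF. Qed.
Let sxi : smooth_vf W xi. Proof. exact: xi_smooth_on. Qed.
Let sx : smooth_on W x. Proof. exact: smooth_on_coord. Qed.
Let sy : smooth_on W y. Proof. exact: smooth_on_coord. Qed.
Let sl : smooth_on W lambda.
Proof. exact: smooth_on_sub (@subsetT _ W) (lambda_smooth hkm hkappa). Qed.
Let sm : smooth_on W mu.
Proof. by have [_ sm _] := hkm; exact: smooth_on_sub (@subsetT _ W) sm. Qed.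

Let a := act xi x.
Let b := act xi y.
Let sa : smooth_on W a. Proof. exact: sxi. Qed.
Let sb : smooth_on W b. Proof. exact: sxi. Qed.

Lemma chart_frame q : W q -> [/\ X q = coord_vf c (inord 0) q, F q = coord_vf c (inord 1) q &
  xi q = a q *: coord_vf c (inord 0) q + b q *: coord_vf c (inord 1) q
    - (4 * (kappa q + 1)) *: coord_vf c (inord 2) q].
Proof.
move=> Wq; have Uq := cU Wq.
have [k1 k2 k3] := eigen_kappa hK L hkm hkappa hdkappa fX hX Uq.
have ez : (fun q => chart_coord c q 0 (inord 2)) = kappa by apply/funext.
have dec (v : tangent q) (d0 d1 d2 : R) : dfun x v = d0 -> dfun y v = d1 -> dfun kappa v = d2 ->
    v = d0 *: coord_vf c (inord 0) q + d1 *: coord_vf c (inord 1) q + d2 *: coord_vf c (inord 2) q.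
  by move=> <- <- <-; rewrite {1}(tangent_coord_vf v sc Wq) sum_ord3 ez.
have [x1 y1] := Xc Wq; have [x2 y2] := Fc Wq; split.
- by rewrite (dec _ _ _ _ x1 y1 k1) scale1r !scale0r !addr0.
- by rewrite (dec _ _ _ _ x2 y2 k2) scale1r !scale0r !addr0 add0r.
- rewrite {1}(dec (xi q) (a q) (b q) _ erefl erefl k3); congr (_ + _).
  by rewrite -scaleNr mulNr.
Qed.

(** Apply the brackets [[xi, X]] and [[xi, phi X]] to [x] and [y], whose derivatives along
[X] and [phi X] are constant. *)
Lemma act_components q : W q ->
  [/\ act X a q = 1, act F a q = - (lambda q + mu q / 2),
      act X b q = - (lambda q - mu q / 2) & act F b q = 1].
Proof.
move=> Wq; have Uq := cU Wq.
have [lX lF] := eigen_lie_xi hK L hkm hkappa fX hX Uq.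
have [x1 y1] := Xc Wq; have [x2 y2] := Fc Wq.
have key Z (f : M -> R) (d : R) : smooth_vf W Z -> smooth_on W f -> (forall q, W q -> act Z f q = d) ->
    act Z (act xi f) q = - dfun f (lie xi Z q).
  move=> sZ sf Zf; have E := act_lie oW sxi sZ sf Wq.
  have E0 := act_locally_const xi oW Wq Zf.
  have fin (u v w : R) : u = v - w -> v = 0 -> w = - u by move=> -> ->; ring.
  exact: fin E E0.
have dlX (f : M -> R) (u v : R) : smooth_on W f -> dfun f (X q) = u -> dfun f (F q) = v ->
    dfun f (lie xi X q) = - u + (lambda q - mu q / 2) * v.
  by move=> sf <- <-; rewrite lX (dfunD oW Wq _ _ sf) (dfunN oW Wq _ sf) (dfunZ oW Wq _ _ sf).
have dlF (f : M -> R) (u v : R) : smooth_on W f -> dfun f (X q) = u -> dfun f (F q) = v ->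
    dfun f (lie xi F q) = (lambda q + mu q / 2) * u - v.
  by move=> sf <- <-; rewrite lF (dfunD oW Wq _ _ sf) (dfunN oW Wq _ sf) (dfunZ oW Wq _ _ sf).
split.
- apply: etrans (key X x 1 sX sx (fun q Wq => (Xc Wq).1)) _.
  by rewrite (dlX x _ _ sx x1 x2); ring.
- apply: etrans (key F x 0 sF sx (fun q Wq => (Fc Wq).1)) _.
  by rewrite (dlF x _ _ sx x1 x2); ring.
- apply: etrans (key X y 0 sX sy (fun q Wq => (Xc Wq).2)) _.
  by rewrite (dlX y _ _ sy y1 y2); ring.
- apply: etrans (key F y 1 sF sy (fun q Wq => (Fc Wq).2)) _.
  by rewrite (dlF y _ _ sy y1 y2); ring.
Qed.

Lemma act_lambda q : W q -> act X lambda q = 0 /\ act F lambda q = 0.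
Proof.
move=> Wq; have Uq := cU Wq.
have eX : eta S (X q) = 0 by have [_ _ /(_ q Uq) []] := fX.
have eF : eta S (F q) = 0 by rewrite /phi_vf eta_phi.
by split; exact: (horizontal_lambda hkm hkappa hdkappa fX).
Qed.

(** Apply the commuting fields in both orders to [a] for the derivative along [X], and to
[b] for the derivative along [phi X]: one of the orders differentiates a constant. *)
Lemma act_mu q : W q -> act X mu q = 0 /\ act F mu q = 0.
Proof.
move=> Wq; have Uq := cU Wq.
have comm f : smooth_on W f -> act X (act F f) q = act F (act X f) q.
  move=> sf; have E := act_lie oW sX sF sf Wq.
  have E0 : act (lie X F) f q = 0.
    have l0 := eigen_commute hK L hkm hkappa hdkappa fX hX Uq.
    by apply: etrans (dfun0 f q); exact: (congr1 (fun v : tangent q => dfun f v) l0).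
  have fin (u v w : R) : u = v - w -> u = 0 -> v = w.
    by move=> -> /eqP; rewrite subr_eq0 => /eqP.
  exact: fin E E0.
have sh : smooth_on W (fun q => mu q / 2) by apply: (smooth_onM oW) => //; exact: smooth_on_cst.
have dh (v : tangent q) : dfun (fun q => mu q / 2) v = 2^-1 * dfun mu v.
  apply: etrans (dfun_mulf oW Wq v sm (smooth_on_cst W 2^-1)) _.
  by rewrite dfun_cst mulr0 add0r.
have dp (v : tangent q) : dfun lambda v = 0 -> dfun (fun q => - (lambda q + mu q / 2)) v = - (2^-1 * dfun mu v).
  move=> l0; apply: etrans (dfun_oppf oW Wq v (smooth_onD oW sl sh)) _.
  by apply: etrans (congr1 -%R (dfun_addf oW Wq v sl sh)) _; rewrite dh l0 add0r.
have dm (v : tangent q) : dfun lambda v = 0 -> dfun (fun q => - (lambda q - mu q / 2)) v = 2^-1 * dfun mu v.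
  move=> l0; apply: etrans (dfun_oppf oW Wq v (smooth_onB oW sl sh)) _.
  by apply: etrans (congr1 -%R (dfun_subf oW Wq v sl sh)) _; rewrite dh l0 sub0r opprK.
have [Xl Fl] := act_lambda Wq.
have half (u : R) : 2^-1 * u = 0 -> u = 0 by lra.
split; apply: half.
  have e1 : forall p, W p -> act F a p = - (lambda p + mu p / 2) by move=> p /act_components [].
  have e2 : forall p, W p -> act X a p = 1 by move=> p /act_components [].
  have E1 := etrans (act_local X oW Wq e1) (dp (X q) Xl).
  have E2 := act_locally_const F oW Wq e2.
  have fin (u v w : R) : u = v -> u = - w -> v = 0 -> w = 0.
    by move=> -> -> /eqP; rewrite oppr_eq0 => /eqP.
  exact: fin (comm a sa) E1 E2.
have e1 : forall p, W p -> act X b p = - (lambda p - mu p / 2) by move=> p /act_components [].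
have e2 : forall p, W p -> act F b p = 1 by move=> p /act_components [].
have E1 := etrans (act_local F oW Wq e1) (dm (F q) Fl).
have E2 := act_locally_const X oW Wq e2.
have fin (u v w : R) : u = v -> v = w -> u = 0 -> w = 0 by move=> -> ->.
exact: fin (comm b sb) E1 E2.
Qed.

Let G (e : R) q : R := 2^-1 * (mu q + e * lambda q).

Let sG e : smooth_on W (G e).
Proof.
apply: (smooth_onM oW); first exact: smooth_on_cst.
by apply: (smooth_onD oW) => //; apply: (smooth_onM oW) => //; exact: smooth_on_cst.
Qed.

Let dG e q (v : tangent q) : W q -> dfun lambda v = 0 -> dfun mu v = 0 -> dfun (G e) v = 0.
Proof.
move=> Wq l0 m0.
have sel : smooth_on W (fun q => e * lambda q) by apply: (smooth_onM oW) => //; exact: smooth_on_cst.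
apply: etrans (dfun_mulf oW Wq v (smooth_on_cst W 2^-1) (smooth_onD oW sm sel)) _.
have E1 := dfun_addf oW Wq v sm sel.
have E2 := dfun_mulf oW Wq v (smooth_on_cst W e) sl.
by rewrite E1 E2 m0 l0 !dfun_cst !mulr0 !addr0 mulr0.
Qed.

(** The parts of the components of [xi] that become the functions [f] and [r] of the last
coordinate. *)
Definition rest_a q := a q - x q + G 2 q * y q.
Definition rest_b q := b q - y q - G (-2) q * x q.

Lemma rest_smooth : smooth_on W rest_a /\ smooth_on W rest_b.
Proof.
split.
  by apply: (smooth_onD oW); [exact: (smooth_onB oW)|exact: (smooth_onM oW)].
by apply: (smooth_onB oW); [exact: (smooth_onB oW)|exact: (smooth_onM oW)].
Qed.

Lemma rest_constant q : W q -> [/\ act X rest_a q = 0, act F rest_a q = 0,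
  act X rest_b q = 0 & act F rest_b q = 0].
Proof.
move=> Wq; have [Xl Fl] := act_lambda Wq; have [Xm Fm] := act_mu Wq.
have [Xa Fa Xb Fb] := act_components Wq.
have [x1 y1] := Xc Wq; have [x2 y2] := Fc Wq.
have sGM e (f : M -> R) (sf : smooth_on W f) := smooth_onM oW (sG e) sf.
have da (v : tangent q) (d1 d2 d3 : R) : dfun lambda v = 0 -> dfun mu v = 0 -> dfun a v = d1 ->
    dfun x v = d2 -> dfun y v = d3 -> dfun rest_a v = d1 - d2 + G 2 q * d3.
  move=> l0 m0 <- <- <-; apply: etrans (dfun_addf oW Wq v (smooth_onB oW sa sx) (sGM 2 y sy)) _.
  have E1 := dfun_subf oW Wq v sa sx; have E2 := dfun_mulf oW Wq v (sG 2) sy.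
  by rewrite E1 E2 (dG 2 Wq l0 m0) mulr0 addr0.
have db (v : tangent q) (d1 d2 d3 : R) : dfun lambda v = 0 -> dfun mu v = 0 -> dfun b v = d1 ->
    dfun y v = d2 -> dfun x v = d3 -> dfun rest_b v = d1 - d2 - G (-2) q * d3.
  move=> l0 m0 <- <- <-; apply: etrans (dfun_subf oW Wq v (smooth_onB oW sb sy) (sGM (-2) x sx)) _.
  have E1 := dfun_subf oW Wq v sb sy; have E2 := dfun_mulf oW Wq v (sG (-2)) sx.
  by rewrite E1 E2 (dG (-2) Wq l0 m0) mulr0 addr0.
split.
- by apply: etrans (da _ _ _ _ Xl Xm Xa x1 y1) _; rewrite /G; ring.
- by apply: etrans (da _ _ _ _ Fl Fm Fa x2 y2) _; rewrite /G; field.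
- by apply: etrans (db _ _ _ _ Xl Xm Xb y1 x1) _; rewrite /G; field.
- by apply: etrans (db _ _ _ _ Fl Fm Fb y2 x2) _; rewrite /G; ring.
Qed.

End InChart.
End Coordinates.

Theorem theorem4p1 (R : realType) (M : manifold R 3)
    (S : almost_contact_metric M) (nabla : connection M) (kappa mu : M -> R)
    (hS : almost_kenmotsu S)
    (hnabla : levi_civita (g S) nabla)
    (hkm : generalized_kappa_mu S nabla kappa mu)
    (hdkappa : forall p (u v : tangent p),
       wedge11 (dfun kappa) (eta S) u v = 0)
    (hkappa : forall p, kappa p < -1) :
  forall p : M, exists c : chart R 3 M,
    let U := chart_dom c in
    let x := fun q => chart_coord c q 0 (inord 0) in
    let y := fun q => chart_coord c q 0 (inord 1) in
    let z := fun q => chart_coord c q 0 (inord 2) in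
    let ddx := coord_vf c (inord 0) in
    let ddy := coord_vf c (inord 1) in
    let ddz := coord_vf c (inord 2) in
    let lambda := fun q => Num.sqrt (-1 - kappa q) in
    [/\ smooth_chart c, U p & forall q, U q -> z q < -1] /\
    exists X : vfield M,
      let phiX := fun q => phi S (X q) in
      [/\ smooth_vf U X &
          forall q, U q ->
          [/\ [/\ g S (xi S q) (xi S q) = 1, g S (X q) (X q) = 1
                & g S (phiX q) (phiX q) = 1]
            & [/\ g S (xi S q) (X q) = 0, g S (xi S q) (phiX q) = 0
                & g S (X q) (phiX q) = 0]]] /\
      (forall q, U q ->
         [/\ h_op S X q = lambda q *: X q,
             exists e, h_op S phiX q = e *: phiX q
           & exists e, h_op S (xi S) q = e *: xi S q]) /\
      [/\ forall q, U q -> kappa q = z q,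
          exists m : R -> R, forall q, U q -> mu q = m (z q)
        & exists f r : R -> R,
          [/\ smooth_R (z @` U) f, smooth_R (z @` U) r
            & forall q, U q ->
              let s := Num.sqrt (-1 - z q) in
              let a := x q - 2^-1 * (mu q + 2 * s) * y q + f (z q) in
              let b := y q + 2^-1 * (mu q - 2 * s) * x q + r (z q) in
              [/\ X q = ddx q, phiX q = ddy q
                & xi S q = a *: ddx q + b *: ddy q
                           - (4 * (z q + 1)) *: ddz q]]].

Proof.
move=> p.
have [U [X [Up fX hX]]] := exists_eigen_section hS hnabla hkm hkappa p.
have [oU sX uX] := fX; have [_ sF uF] := phi_section_unit fX.
have [sk _ _] := hkm.
have str q (Uq : U q) := eigen_kappa hS hnabla hkm hkappa hdkappa fX hX Uq.
have xk : act (xi S) kappa p != 0.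
  have [_ _ ->] := str p Up; rewrite mulf_neq0 ?oppr_eq0 ?pnatr_eq0 //.
  by rewrite lt_eqF // -ltrBrDr sub0r.
have Xk q : U q -> act X kappa q = 0 by move=> /str [].
have Fk q : U q -> act (phi_vf S X) kappa q = 0 by move=> /str [].
have XF q (Uq : U q) := eigen_commute hS hnabla hkm hkappa hdkappa fX hX Uq.
have sk' := smooth_on_sub (@subsetT _ U) sk.
have [c [sc cp cU] [[ctr [r [r0 imc]]] cz Xc Fc]] :=
  straightening oU Up sX sF sk' Xk Fk XF xk (frame_unitmx fX Up).
have frm q (Wq : chart_dom c q) := chart_frame hS hnabla hkm hkappa hdkappa fX hX sc cU cz Xc Fc Wq.
have [sra srb] := rest_smooth hkm hkappa sc.
have rc q (Wq : chart_dom c q) := rest_constant hS hnabla hkm hkappa hdkappa fX hX sc cU Xc Fc Wq.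
have mc q (Wq : chart_dom c q) := act_mu hS hnabla hkm hkappa hdkappa fX hX sc cU Xc Fc Wq.
have [_ smu _] := hkm.
have along f q : chart_dom c q -> act X f q = 0 -> act (phi_vf S X) f q = 0 ->
    act (coord_vf c (inord 0)) f q = 0 /\ act (coord_vf c (inord 1)) f q = 0.
  move=> Wq f1 f2; have [e1 e2 _] := frm q Wq; split.
    exact: etrans (congr1 (fun v : tangent q => dfun f v) (esym e1)) f1.
  exact: etrans (congr1 (fun v : tangent q => dfun f v) (esym e2)) f2.
have [m _ mE] : exists2 m : R -> R, smooth_R ((fun q => chart_coord c q 0 (inord 2)) @` chart_dom c) m &
    forall q, chart_dom c q -> mu q = m (chart_coord c q 0 (inord 2)).
  apply: (function_of_last_coordinate sc imc (smooth_on_sub (@subsetT _ _) smu)) => q Wq.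
  by have [m1 m2] := mc q Wq; exact: along.
have [f sf fE] := function_of_last_coordinate sc imc sra
  (fun q Wq => let: And4 a1 a2 _ _ := rc q Wq in along _ q Wq a1 a2).
have [k sk2 kE] := function_of_last_coordinate sc imc srb
  (fun q Wq => let: And4 _ _ b1 b2 := rc q Wq in along _ q Wq b1 b2).
exists c; split; first by split => // q _; rewrite cz.
exists X; split; [|split].
- split; first exact: smooth_vf_sub cU sX.
  by move=> q /cU Uq; have [g1 g2 g3 [g4 g5 g6]] := frame_g fX Uq.
- move=> q /cU Uq; split; first exact: hX.
    exists (- lambda kappa q); have [_ hF] := h_op_frame hS hnabla fX Uq.
    have [aq bq] := eigen_hEE_hEF hS hnabla fX hX Uq.
    by apply: etrans hF _; rewrite aq bq scale0r sub0r scaleNr.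
  by exists 0; exact: h_op_xi.
split; [by move=> q _; rewrite cz|by exists m|exists f, k; split => // q Wq].
have [e1 e2 e3] := frm q Wq.
move=> s a b; split => //.
have sE : s = lambda kappa q by rewrite /s cz.
have aE : act (xi S) (fun q0 : M => chart_coord c q0 0 (inord 0)) q = a.
  by rewrite /a -(fE q Wq) /rest_a sE; ring.
have bE : act (xi S) (fun q0 : M => chart_coord c q0 0 (inord 1)) q = b.
  by rewrite /b -(kE q Wq) /rest_b sE; ring.
by rewrite e3 aE bE cz.
Qed.
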